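(* Every Toeplitz kernel is a transposed paired kernel: for $a\in L^\infty$, $$\ker T_a=\ker\Sigma_{a,b}\qquad\text{for any outer function } b\in H^\infty.$$
   Context: $\mathbb T$ is the unit circle, $L^2=L^2(\mathbb T)$, $L^\infty=L^\infty(\mathbb T)$; $H^2_+=H^2(\mathbb D)$ is the Hardy space regarded as a closed subspace of $L^2$ via boundary values, $H^2_-=(H^2_+)^\perp$ in $L^2$, and $P^\pm$ are the orthogonal projections of $L^2$ onto $H^2_\pm$. $H^\infty=H^\infty(\mathbb D)$. The Toeplitz operator is $T_a:H^2_+\to H^2_+$, $T_af=P^+(af)$. For $a,b\in L^\infty$, $\Sigma_{a,b}f=P^+(af)+P^-(bf)$ for $f\in L^2$. *)

(* Defs.v *)
From mathcomp Require Import all_boot all_order all_algebra complex.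
From mathcomp Require Import all_classical all_reals all_analysis.

Set Implicit Arguments.
Unset Strict Implicit.
Unset Printing Implicit Defensive.

Import Order.TTheory GRing.Theory Num.Theory.
Import numFieldNormedType.Exports.

Local Open Scope classical_set_scope.
Local Open Scope complex_scope.
Local Open Scope ring_scope.

(* A function on the unit circle is represented by its pull-back along
   t |-> e^(it), a function R -> R[i] of which only the restriction to
   [0, 2 pi] matters.  Elements of L^2 and L^oo are represented by functions;
   equality in these spaces is equality almost everywhere on [0, 2 pi]. *)

Section Circle.
Variable R : realType.
Implicit Types (a b f g h : R -> R[i]) (F : R[i] -> R[i]) (V : set (R -> R[i])).

Local Notation mu := (@lebesgue_measure R).
Local Notation modulus := (@ComplexField.Normc.normc R).

Definition angles : set R := `[0, 2 * pi].

Definition cis (t : R) : R[i] := cos t +i* sin t.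

Definition cexp (z : R[i]) : R[i] := (expR (complex.Re z))%:C * cis (complex.Im z).

Definition eq_ae f g : Prop := {ae mu, forall t, angles t -> f t = g t}.

Definition circle_measurable f : Prop :=
  measurable_fun angles (fun t => complex.Re (f t)) /\
  measurable_fun angles (fun t => complex.Im (f t)).

Definition circle_mean f : R[i] :=
  ((2 * pi)^-1)%:C *
  ((\int[mu]_(t in angles) complex.Re (f t)) +i*
   (\int[mu]_(t in angles) complex.Im (f t))).

Definition sqnorm2 f : \bar R :=
  ((2 * pi)^-1)%:E * \int[mu]_(t in angles) (modulus (f t) ^+ 2)%:E.

Definition L2 : set (R -> R[i]) :=
  [set f | circle_measurable f /\ (sqnorm2 f < +oo)%E].

Definition Linfty : set (R -> R[i]) :=
  [set f | circle_measurable f /\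
     exists M : R, {ae mu, forall t, angles t -> modulus (f t) <= M}].

Definition inner2 f g : R[i] := circle_mean (fun t => f t * (g t)^*).

Definition unit_disk : set R[i] := [set z | modulus z < 1].

Definition H2_disk : set (R[i] -> R[i]) :=
  [set F : R[i] -> R[i] | exists c : nat -> R[i],
     cvgn (series (fun n => modulus (c n) ^+ 2)) /\
     forall z, unit_disk z ->
       series (fun n => c n * z ^+ n : R[i]^o) @ \oo --> (F z : R[i]^o)].

Definition Hinfty_disk : set (R[i] -> R[i]) :=
  [set F : R[i] -> R[i] |
     (forall z, unit_disk z -> derivable (F : R[i]^o -> R[i]^o) z 1) /\
     exists M : R, forall z, unit_disk z -> modulus (F z) <= M].

(* f is the boundary function of F: the limit in L^2 of the dilations
   F(r e^(it)) as r tends to 1 from below *)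
Definition boundary_function F f : Prop :=
  L2 f /\
  sqnorm2 (fun t => F (r%:C * cis t) - f t) @[r --> (1 : R)^'-] --> (0 : \bar R).

Definition H2_plus : set (R -> R[i]) :=
  [set f | exists2 F, H2_disk F & boundary_function F f].

Definition H2_minus : set (R -> R[i]) :=
  [set f | L2 f /\ forall h, H2_plus h -> inner2 f h = 0].

Definition is_orth_proj V f g : Prop :=
  V g /\ forall h, V h -> inner2 (fun t => f t - g t) h = 0.

(* a representative of the orthogonal projection of f onto V; the default
   value 0 is never used when f is in L^2 and V is a closed subspace of L^2 *)
Definition orth_proj V f : R -> R[i] := xget (fun=> 0) (is_orth_proj V f).

Definition P_plus f := orth_proj H2_plus f.
Definition P_minus f := orth_proj H2_minus f.

Definition toeplitz a f : R -> R[i] := P_plus (fun t => a t * f t).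

Definition Sigma_op a b f : R -> R[i] :=
  fun t => P_plus (fun s => a s * f s) t + P_minus (fun s => b s * f s) t.

Definition ker_toeplitz a : set (R -> R[i]) :=
  [set f | H2_plus f /\ eq_ae (toeplitz a f) (fun=> 0)].

Definition ker_Sigma a b : set (R -> R[i]) :=
  [set f | L2 f /\ eq_ae (Sigma_op a b f) (fun=> 0)].

Definition transposed_paired_kernel V : Prop :=
  exists a b, [/\ Linfty a, Linfty b & V = ker_Sigma a b].

(* F(z) = lam exp ((1 / (2 pi)) \int (e^(it) + z) / (e^(it) - z) log phi(t) dt)
   with |lam| = 1, phi > 0 and log phi integrable *)
Definition outer F : Prop :=
  exists (lam : R[i]) (phi : R -> R),
  [/\ modulus lam = 1,
      measurable_fun angles phi /\ (forall t, angles t -> 0 < phi t),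
      mu.-integrable angles (fun t => (ln (phi t))%:E) &
      forall z, unit_disk z ->
        F z = lam * cexp (circle_mean (fun t =>
                (cis t + z) / (cis t - z) * (ln (phi t))%:C))].

Definition outer_Hinfty b : Prop :=
  Linfty b /\
  exists F, [/\ Hinfty_disk F, outer F & boundary_function F b].

End Circle.

(* Main.v *)
Require Import Defs.
From mathcomp Require Import all_boot all_order all_algebra complex.
From mathcomp Require Import all_classical all_reals all_analysis.
From mathcomp Require Import measurable_realfun ring lra.

(* Write b = lam exp (H (log phi)) with H the Herglotz transform.  If f is in
   H^2_+ and P^+(af) = 0, then bf is in H^2_+, so P^-(bf) = 0.  Conversely
   P^+(af) + P^-(bf) = 0 forces both terms to vanish, since H^2_+ and H^2_- are
   orthogonal; hence bf is in H^2_+ and f has to be recovered from bf.  For this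
   let G_n = exp (n - H (max (log phi + n, 0))), which is bounded by e^n in the
   disk.  Then b G_n = lam exp (- H (max (- log phi - n, 0))) is bounded by 1
   and its mean tends to lam, so b G_n tends to lam in L^2.  The negative
   Fourier coefficients of G_n b f vanish, hence so do those of f.  Boundary
   values of G_n are avoided by working with its dilations G_n(r e^(it)), which
   are uniform limits of polynomials in e^(it).

   H^2_+ is identified with the space of f in L^2 whose negative Fourier
   coefficients vanish, which rests on the completeness of L^2 and on the
   uniqueness theorem for Fourier series; the latter is obtained from
   the Abel means arctan (r sin t / (1 - r cos t)) of the sawtooth function. *)

Set Implicit Arguments.
Unset Strict Implicit.
Unset Printing Implicit Defensive.

Import Order.TTheory GRing.Theory Num.Theory.
Import numFieldNormedType.Exports.

Local Open Scope classical_set_scope.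
Local Open Scope complex_scope.
Local Open Scope ring_scope.

(** The dilations of F are known to tend to b in L^2 only, so their products with f are controlled
    in L^1 but not in L^2, and closedness of H^2_+ does not apply to them. Membership of such a
    limit is tested on one negative Fourier coefficient at a time: the conjugate character is
    absorbed in f, and Cauchy-Schwarz is applied to f against the small L^2 factor. The truncation
    at level n is imposed by 1/b, which need not be bounded, since log phi may be unbounded below.
    The bound e^n is uniform in the disk, so n is fixed first and the radius r is chosen afterwards.
    The L^2 convergence of b G_n is read off from a mean: if |q| <= 1, then ||1 - q||^2 <= 2 - 2 Re
    (mean of q), and the mean of exp g is the exponential of the mean of g, because the mean is
    multiplicative on uniform limits of analytic polynomials. Functions rather than classes are
    manipulated and projections are chosen representatives, so vanishing is expressed either by
    [eq_ae] or by a zero squared norm [nrm2]. *)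

Local Notation Re := complex.Re.
Local Notation Im := complex.Im.
Local Notation modulus := (@ComplexField.Normc.normc _).

(** * Complex numbers *)

Section ComplexModulus.
Variable R : realType.
Implicit Types (x y z : R[i]) (r : R).

Lemma normc_modulus z : `|z| = (modulus z)%:C.
Proof. by []. Qed.

Lemma modulus_ge0 z : 0 <= modulus z.
Proof. by case: z => a b /=; rewrite sqrtr_ge0. Qed.

Lemma modulusM x y : modulus (x * y) = modulus x * modulus y.
Proof. exact: ComplexField.Normc.normcM. Qed.

Lemma modulusD x y : modulus (x + y) <= modulus x + modulus y.
Proof. exact: le_normcD. Qed.

Lemma modulusN x : modulus (- x) = modulus x.
Proof. exact: normcN. Qed.

Lemma modulusB x y : modulus (x - y) <= modulus x + modulus y.
Proof. by rewrite -(modulusN y) modulusD. Qed.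

Lemma modulus_distC x y : modulus (x - y) = modulus (y - x).
Proof. by rewrite -modulusN opprB. Qed.

Lemma modulus0 : modulus (0 : R[i]) = 0.
Proof. exact: ComplexField.Normc.normc0. Qed.

Lemma modulus1 : modulus (1 : R[i]) = 1.
Proof. exact: ComplexField.Normc.normc1. Qed.

Lemma modulus0_eq0 x : modulus x = 0 -> x = 0.
Proof. exact: ComplexField.Normc.eq0_normc. Qed.

Lemma modulusV x : modulus x^-1 = (modulus x)^-1.
Proof. exact: ComplexField.Normc.normcV. Qed.

Lemma modulusX x n : modulus (x ^+ n) = modulus x ^+ n.
Proof. by elim: n => [|n ih]; rewrite ?expr0 ?modulus1// !exprS modulusM ih. Qed.

Lemma modulus_real r : modulus r%:C = `|r|.
Proof. by rewrite /= expr0n/= addr0 sqrtr_sqr. Qed.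

Lemma modulus_conj x : modulus x^* = modulus x.
Proof. by case: x => a b /=; rewrite sqrrN. Qed.

Lemma sqr_modulus x : modulus x ^+ 2 = Re x ^+ 2 + Im x ^+ 2.
Proof. by case: x => a b /=; rewrite sqr_sqrtr// addr_ge0// sqr_ge0. Qed.

Lemma mulcJ x : x * x^* = (modulus x ^+ 2)%:C.
Proof.
by rewrite sqr_modulus; case: x => a b; simpc; congr (_ +i* _); rewrite /=; ring.
Qed.

Lemma normr_Re_le x : `|Re x| <= modulus x.
Proof.
by case: x => a b /=; rewrite -sqrtr_sqr ler_wsqrtr// lerDl sqr_ge0.
Qed.

Lemma normr_Im_le x : `|Im x| <= modulus x.
Proof.
by case: x => a b /=; rewrite -sqrtr_sqr ler_wsqrtr// lerDr sqr_ge0.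
Qed.

Lemma modulus_le x : modulus x <= `|Re x| + `|Im x|.
Proof.
rewrite -[leLHS]ger0_norm ?modulus_ge0// -[leRHS]ger0_norm ?addr_ge0//.
rewrite -ler_sqr ?nnegrE// !real_normK ?num_real// sqr_modulus sqrrD.
rewrite !real_normK ?num_real// addrAC lerDl mulrn_wge0// mulr_ge0//.
Qed.

Lemma ReD x y : Re (x + y) = Re x + Re y. Proof. by case: x; case: y. Qed.
Lemma ImD x y : Im (x + y) = Im x + Im y. Proof. by case: x; case: y. Qed.
Lemma ReN x : Re (- x) = - Re x. Proof. by case: x. Qed.
Lemma ImN x : Im (- x) = - Im x. Proof. by case: x. Qed.
Lemma ReM x y : Re (x * y) = Re x * Re y - Im x * Im y.
Proof. by case: x; case: y. Qed.
Lemma ImM x y : Im (x * y) = Re x * Im y + Im x * Re y.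
Proof. by case: x; case: y. Qed.
Lemma ReJ x : Re x^* = Re x. Proof. by case: x. Qed.
Lemma ImJ x : Im x^* = - Im x. Proof. by case: x. Qed.

Lemma conjJK x : x^*^* = x. Proof. exact: conjcK. Qed.
Lemma conjJ0 : (0 : R[i])^* = 0. Proof. exact: conjc0. Qed.
Lemma conjJ1 : (1 : R[i])^* = 1. Proof. exact: conjc1. Qed.
Lemma conjcV x : (x^-1)^* = (x^*)^-1. Proof. exact: fmorphV. Qed.
Lemma conjJ_real r : (r%:C)^* = r%:C. Proof. exact: conjc_real. Qed.
Lemma conjcD x y : (x + y)^* = x^* + y^*. Proof. exact: rmorphD. Qed.
Lemma conjcB x y : (x - y)^* = x^* - y^*. Proof. exact: rmorphB. Qed.
Lemma conjcM x y : (x * y)^* = x^* * y^*. Proof. exact: rmorphM. Qed.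
Lemma realCD (a b : R) : (a + b)%:C = a%:C + b%:C. Proof. exact: rmorphD. Qed.
Lemma realCB (a b : R) : (a - b)%:C = a%:C - b%:C. Proof. exact: rmorphB. Qed.
Lemma realCM (a b : R) : (a * b)%:C = a%:C * b%:C. Proof. exact: rmorphM. Qed.

Lemma modulus_cis (t : R) : modulus (cis t) = 1.
Proof. by rewrite /cis/= cos2Dsin2 sqrtr1. Qed.

Lemma cisD (s t : R) : cis (s + t) = cis s * cis t.
Proof. by rewrite /cis; simpc; congr (_ +i* _); rewrite ?cosD ?sinD; ring. Qed.

Lemma cis0 : cis (0 : R) = 1.
Proof. by rewrite /cis cos0 sin0. Qed.

Lemma cisN (t : R) : cis (- t) = (cis t)^*.
Proof. by rewrite /cis cosN sinN. Qed.

Lemma cis_neq0 (t : R) : cis t != 0.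
Proof.
apply/eqP => /(congr1 (@ComplexField.Normc.normc _)).
by rewrite modulus_cis modulus0; apply/eqP/oner_neq0.
Qed.

Lemma cisJV (t : R) : (cis t)^* = (cis t)^-1.
Proof.
apply: (mulfI (cis_neq0 t)).
by rewrite mulfV ?cis_neq0// mulcJ modulus_cis expr1n.
Qed.

Lemma cisX (t : R) n : cis t ^+ n = cis (n%:R * t).
Proof.
elim: n => [|n ih]; first by rewrite mul0r cis0.
by rewrite exprS ih -cisD -natr1 mulrDl mul1r addrC.
Qed.

End ComplexModulus.

(** * Integration on the circle *)

Section CircleMean.
Variable R : realType.
Implicit Types (f g h : R -> R[i]) (c : R[i]).

Local Notation mu := (@lebesgue_measure R).
Local Notation angles := (@angles R).
Local Notation rint f := (\int[mu]_(t in angles) f t).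

(** Integrability is asked of each coordinate because [circle_mean] is assembled from two real
    integrals. *)
Definition L1 f : Prop :=
  mu.-integrable angles (EFin \o (fun t => Re (f t))) /\
  mu.-integrable angles (EFin \o (fun t => Im (f t))).

Lemma measurable_angles : measurable (angles : set (measurableTypeR R)).
Proof. exact: measurable_itv. Qed.
Local Hint Resolve measurable_angles : core.

Lemma twopi_gt0 : 0 < 2 * pi :> R.
Proof. by rewrite mulr_gt0// pi_gt0. Qed.

Lemma mu_angles : mu angles = (2 * pi)%:E.
Proof. by rewrite /angles lebesgue_measure_itv/= lte_fin twopi_gt0 -EFinB subr0. Qed.

Lemma mu_angles_lty : (mu angles < +oo)%E.
Proof. by rewrite mu_angles ltry. Qed.

Lemma circle_measurable_cst c : circle_measurable (fun=> c).
Proof. by split; exact: measurable_cst. Qed.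

Lemma circle_measurableD f g : circle_measurable f -> circle_measurable g ->
  circle_measurable (fun t => f t + g t).
Proof.
move=> [f1 f2] [g1 g2]; split.
- by under eq_fun do rewrite ReD; exact: measurable_funD.
- by under eq_fun do rewrite ImD; exact: measurable_funD.
Qed.

Lemma circle_measurableM f g : circle_measurable f -> circle_measurable g ->
  circle_measurable (fun t => f t * g t).
Proof.
move=> [f1 f2] [g1 g2]; split.
- under eq_fun do rewrite ReM.
  by apply: measurable_funB; apply: measurable_funM.
- under eq_fun do rewrite ImM.
  by apply: measurable_funD; apply: measurable_funM.
Qed.

Lemma circle_measurableJ f : circle_measurable f ->
  circle_measurable (fun t => (f t)^*).
Proof.
move=> [f1 f2]; split; first by under eq_fun do rewrite ReJ.
by under eq_fun do rewrite ImJ; exact: measurable_funN.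
Qed.

Lemma circle_measurableZ c f : circle_measurable f ->
  circle_measurable (fun t => c * f t).
Proof. by apply: circle_measurableM; exact: circle_measurable_cst. Qed.

Lemma circle_measurableN f : circle_measurable f ->
  circle_measurable (fun t => - f t).
Proof.
by move=> /(circle_measurableZ (-1)); under eq_fun do rewrite mulN1r.
Qed.

Lemma circle_measurableB f g : circle_measurable f -> circle_measurable g ->
  circle_measurable (fun t => f t - g t).
Proof.
by move=> mf mg; apply: circle_measurableD => //; exact: circle_measurableN.
Qed.

Lemma circle_measurable_cis : circle_measurable (@cis R).
Proof.
by split; apply: measurable_funTS; apply: continuous_measurable_fun;
  [exact: continuous_cos|exact: continuous_sin].
Qed.

Lemma circle_measurableX f n : circle_measurable f ->
  circle_measurable (fun t => f t ^+ n).
Proof.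
move=> mf; elim: n => [|n ih].
  by under eq_fun do rewrite expr0; exact: circle_measurable_cst.
by under eq_fun do rewrite exprS; exact: circle_measurableM.
Qed.

Lemma measurable_sqr_modulus f : circle_measurable f ->
  measurable_fun angles (fun t => modulus (f t) ^+ 2).
Proof.
move=> [f1 f2]; under eq_fun do rewrite sqr_modulus.
by apply: measurable_funD; apply: measurable_funX.
Qed.

Lemma measurable_modulus f : circle_measurable f ->
  measurable_fun angles (fun t => modulus (f t)).
Proof.
move=> mf.
(* The modulus becomes the power 1/2 of its square, whose measurability is already known. *)
have -> : (fun t => modulus (f t)) = (fun t => (modulus (f t) ^+ 2) `^ 2^-1).
  apply/funext => t; rewrite powR12_sqrt ?sqr_ge0// sqrtr_sqr ger0_norm//.
  exact: modulus_ge0.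
apply: (measurableT_comp (measurable_powR _)); exact: measurable_sqr_modulus.
Qed.

Lemma L1_measurable f : L1 f -> circle_measurable f.
Proof.
by move=> [/measurable_int/measurable_EFinP f1 /measurable_int/measurable_EFinP f2].
Qed.

Lemma L1_dominated f (p : R -> R) : circle_measurable f ->
  mu.-integrable angles (EFin \o p) ->
  (forall t, angles t -> modulus (f t) <= p t) -> L1 f.
Proof.
move=> [f1 f2] ip fp; split.
- apply: le_integrable ip => //; first exact/measurable_EFinP.
  move=> t at_; rewrite /= lee_fin (le_trans (normr_Re_le _))//.
  by rewrite (le_trans (fp _ at_))// ler_norm.
- apply: le_integrable ip => //; first exact/measurable_EFinP.
  move=> t at_; rewrite /= lee_fin (le_trans (normr_Im_le _))//.
  by rewrite (le_trans (fp _ at_))// ler_norm.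
Qed.

Lemma integrable_cst_angles (k : R) : mu.-integrable angles (EFin \o (fun=> k)).
Proof.
apply: measurable_bounded_integrable => //; first exact: mu_angles_lty.
by exists `|k|; split; [exact: num_real|move=> x kx t _ /=; exact: ltW].
Qed.

Lemma L1_bounded f (k : R) : circle_measurable f ->
  (forall t, angles t -> modulus (f t) <= k) -> L1 f.
Proof. by move=> mf; apply: L1_dominated => //; exact: integrable_cst_angles. Qed.

Lemma L1_cst c : L1 (fun=> c).
Proof. by apply: (@L1_bounded _ (modulus c)) => //; exact: circle_measurable_cst. Qed.

Lemma integrable_modulus f : L1 f ->
  mu.-integrable angles (EFin \o (fun t => modulus (f t))).
Proof.
move=> lf; have mf := L1_measurable lf; case: lf => f1 f2.
have := integrableD measurable_angles (integrable_abse f1) (integrable_abse f2).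
apply: le_integrable => //; first by apply/measurable_EFinP; exact: measurable_modulus.
move=> t _; rewrite /= ger0_norm ?modulus_ge0// lee_fin.
by rewrite [leRHS]ger0_norm ?addr_ge0// modulus_le.
Qed.

Lemma L1D f g : L1 f -> L1 g -> L1 (fun t => f t + g t).
Proof.
move=> [f1 f2] [g1 g2]; split.
- by under [X in EFin \o X]eq_fun do rewrite ReD; exact: integrableD f1 g1.
- by under [X in EFin \o X]eq_fun do rewrite ImD; exact: integrableD f2 g2.
Qed.

Lemma L1Z c f : L1 f -> L1 (fun t => c * f t).
Proof.
move=> lf; have mf := L1_measurable lf.
have im := integrableZl measurable_angles (modulus c) (integrable_modulus lf).
apply: (L1_dominated (circle_measurableZ c mf) (p := fun t => modulus c * modulus (f t))) => //.
by move=> t _; rewrite modulusM.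
Qed.

Lemma L1N f : L1 f -> L1 (fun t => - f t).
Proof. by move=> /(L1Z (-1)); under eq_fun do rewrite mulN1r. Qed.

Lemma L1B f g : L1 f -> L1 g -> L1 (fun t => f t - g t).
Proof. by move=> lf /L1N; exact: L1D. Qed.

Lemma L1J f : L1 f -> L1 (fun t => (f t)^*).
Proof.
move=> lf; apply: (L1_dominated _ (integrable_modulus lf)).
  exact/circle_measurableJ/L1_measurable.
by move=> t _; rewrite modulus_conj.
Qed.

Lemma L1Mr_bounded f g (k : R) : L1 f -> circle_measurable g ->
  (forall t, angles t -> modulus (g t) <= k) -> L1 (fun t => g t * f t).
Proof.
move=> lf mg gk; have mf := L1_measurable lf.
have im := integrableZl measurable_angles k (integrable_modulus lf).
apply: (L1_dominated (circle_measurableM mg mf) (p := fun t => k * modulus (f t))) => //.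
by move=> t at_; rewrite modulusM ler_wpM2r ?modulus_ge0// gk.
Qed.

Lemma Re_circle_mean f : Re (circle_mean f) = (2 * pi)^-1 * rint (fun t => Re (f t)).
Proof. by rewrite /circle_mean ReM/= mul0r subr0. Qed.

Lemma Im_circle_mean f : Im (circle_mean f) = (2 * pi)^-1 * rint (fun t => Im (f t)).
Proof. by rewrite /circle_mean ImM/= mul0r addr0. Qed.

Lemma eq_ReIm (x y : R[i]) : Re x = Re y -> Im x = Im y -> x = y.
Proof. by case: x; case: y => /= a b c d -> ->. Qed.

Lemma circle_meanD f g : L1 f -> L1 g ->
  circle_mean (fun t => f t + g t) = circle_mean f + circle_mean g.
Proof.
move=> [f1 f2] [g1 g2]; apply: eq_ReIm.
- rewrite ReD !Re_circle_mean -mulrDr -RintegralD//; congr (_ * _).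
  by apply: eq_Rintegral => t _; rewrite ReD.
- rewrite ImD !Im_circle_mean -mulrDr -RintegralD//; congr (_ * _).
  by apply: eq_Rintegral => t _; rewrite ImD.
Qed.

Lemma circle_meanZ c f : L1 f ->
  circle_mean (fun t => c * f t) = c * circle_mean f.
Proof.
move=> [f1 f2].
have rZ k (p : R -> R) : mu.-integrable angles (EFin \o p) ->
    mu.-integrable angles (EFin \o (fun t => k * p t)).
  by move=> ip; exact: (integrableZl measurable_angles k ip).
apply: eq_ReIm.
- rewrite [in RHS](ReM c) !Re_circle_mean Im_circle_mean.
  transitivity ((2 * pi)^-1 * rint (fun t => Re c * Re (f t) - Im c * Im (f t))).
    by congr (_ * _); apply: eq_Rintegral => t _; rewrite ReM.
  by rewrite RintegralB ?RintegralZl//; [ring|exact: rZ|exact: rZ].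
- rewrite [in RHS](ImM c) !Im_circle_mean Re_circle_mean.
  transitivity ((2 * pi)^-1 * rint (fun t => Re c * Im (f t) + Im c * Re (f t))).
    by congr (_ * _); apply: eq_Rintegral => t _; rewrite ImM.
  by rewrite RintegralD ?RintegralZl//; [ring|exact: rZ|exact: rZ].
Qed.

Lemma circle_meanN f : L1 f -> circle_mean (fun t => - f t) = - circle_mean f.
Proof.
by move=> lf; rewrite -mulN1r -circle_meanZ//; under [in RHS]eq_fun do rewrite mulN1r.
Qed.

Lemma circle_meanB f g : L1 f -> L1 g ->
  circle_mean (fun t => f t - g t) = circle_mean f - circle_mean g.
Proof. by move=> lf lg; rewrite circle_meanD ?circle_meanN//; exact: L1N. Qed.

Lemma circle_meanJ f : L1 f ->
  circle_mean (fun t => (f t)^*) = (circle_mean f)^*.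
Proof.
move=> [f1 f2]; apply: eq_ReIm.
- rewrite ReJ !Re_circle_mean; congr (_ * _).
  by apply: eq_Rintegral => t _; rewrite ReJ.
- rewrite ImJ !Im_circle_mean -mulrN; congr (_ * _).
  rewrite -mulN1r -RintegralZl//.
  by apply: eq_Rintegral => t _; rewrite ImJ mulN1r.
Qed.

Lemma circle_mean_cst c : circle_mean (fun=> c) = c.
Proof.
have e k : (2 * pi)^-1 * rint (fun=> k) = k.
  rewrite Rintegral_cst; last exact: measurable_angles.
  by rewrite [X in fine X]mu_angles/= mulrC mulfK// gt_eqF// twopi_gt0.
by apply: eq_ReIm; rewrite (Re_circle_mean, Im_circle_mean) e.
Qed.

Lemma L1_sum (I : Type) (s : seq I) (F : I -> R -> R[i]) :
  (forall i, L1 (F i)) -> L1 (fun t => \sum_(i <- s) F i t).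
Proof.
move=> lF; elim: s => [|i s ih].
  by under eq_fun do rewrite big_nil; exact: L1_cst.
by under eq_fun do rewrite big_cons; exact: L1D.
Qed.

Lemma circle_mean_sum (I : Type) (s : seq I) (F : I -> R -> R[i]) :
  (forall i, L1 (F i)) ->
  circle_mean (fun t => \sum_(i <- s) F i t) = \sum_(i <- s) circle_mean (F i).
Proof.
move=> lF; elim: s => [|i s ih].
  by rewrite big_nil -[RHS](circle_mean_cst 0); under eq_fun do rewrite big_nil.
rewrite big_cons -ih -circle_meanD//; last exact: L1_sum.
by under eq_fun do rewrite big_cons.
Qed.

Lemma Re_circle_mean_le f g : L1 f -> L1 g ->
  (forall t, angles t -> Re (f t) <= Re (g t)) ->
  Re (circle_mean f) <= Re (circle_mean g).
Proof.
move=> [f1 _] [g1 _] fg; rewrite !Re_circle_mean ler_wpM2l ?invr_ge0 ?(ltW twopi_gt0)//.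
exact: le_Rintegral.
Qed.

(* Rotating by the argument of the mean reduces the bound to real parts. *)
Lemma modulus_circle_mean_le f (p : R -> R) : L1 f ->
  mu.-integrable angles (EFin \o p) ->
  (forall t, angles t -> modulus (f t) <= p t) ->
  modulus (circle_mean f) <= Re (circle_mean (fun t => (p t)%:C)).
Proof.
move=> lf ip fp; set m := circle_mean f.
have lp : L1 (fun t => (p t)%:C) by split => //; exact: integrable_cst_angles.
have [m0|m0] := eqVneq (modulus m) 0.
  rewrite m0 -[leLHS]/(Re (0 : R[i])) -{1}(circle_mean_cst 0).
  apply: Re_circle_mean_le => //; first exact: L1_cst.
  by move=> t /fp /= ; apply: le_trans; exact: modulus_ge0.
pose u := m^* * (modulus m)^-1%:C.
have mu1 : modulus u = 1.
  by rewrite modulusM modulus_conj modulus_real ger0_norm ?invr_ge0 ?modulus_ge0// mulfV.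
have -> : modulus m = Re (circle_mean (fun t => u * f t)).
  rewrite circle_meanZ// -/m /u mulrAC [m^* * m]mulrC mulcJ -rmorphM/=.
  by rewrite expr2 mulfK.
apply: Re_circle_mean_le => //; first exact: L1Z.
move=> t at_; rewrite (le_trans (ler_norm _))// (le_trans (normr_Re_le _))//.
by rewrite modulusM mu1 mul1r fp.
Qed.

Lemma modulus_circle_mean_bounded f (k : R) : L1 f ->
  (forall t, angles t -> modulus (f t) <= k) -> modulus (circle_mean f) <= k.
Proof.
move=> lf fk; have := modulus_circle_mean_le lf (integrable_cst_angles k) fk.
by rewrite circle_mean_cst.
Qed.

End CircleMean.

(** * The space L^2 *)

Section InnerProduct.
Variable R : realType.
Implicit Types (f g h : R -> R[i]) (c : R[i]).

Local Notation mu := (@lebesgue_measure R).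
Local Notation angles := (@angles R).

(** This is the square of the L^2 norm, as a real number. It is informative only on [L2], since
    [fine] sends +oo to 0. Being quadratic, it satisfies the triangle inequality only up to a factor
    2, which explains the constants in later estimates. *)
Definition nrm2 f : R := fine (sqnorm2 f).

Let mA := @measurable_angles R.
Local Hint Resolve mA : core.

Lemma sqnorm2_ge0 f : (0 <= sqnorm2 f)%E.
Proof.
rewrite mule_ge0 ?lee_fin ?invr_ge0 ?(ltW (twopi_gt0 R))// integral_ge0// => t _.
by rewrite lee_fin sqr_ge0.
Qed.

Lemma nrm2_ge0 f : 0 <= nrm2 f.
Proof. exact/fine_ge0/sqnorm2_ge0. Qed.

Lemma L2P f : L2 f <-> circle_measurable f /\
  mu.-integrable angles (EFin \o (fun t => modulus (f t) ^+ 2)).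
Proof.
have int_ge0 : (0 <= \int[mu]_(t in angles) (modulus (f t) ^+ 2)%:E)%E.
  by apply: integral_ge0 => t _; rewrite lee_fin sqr_ge0.
have tp := twopi_gt0 R.
split=> -[mf].
- move=> fin; split => //; apply/integrableP; split.
    by apply/measurable_EFinP; exact: measurable_sqr_modulus.
  under eq_integral do rewrite /= ger0_norm ?sqr_ge0//.
  move: fin; rewrite /sqnorm2; move: int_ge0; case: (integral _ _ _) => // [r _ _|_].
    by rewrite ltry.
  by rewrite gt0_muley ?ltxx// lte_fin invr_gt0.
- move=> /integrableP[_ fin]; split => //.
  move: fin; under eq_integral do rewrite /= ger0_norm ?sqr_ge0//.
  rewrite /sqnorm2; move: int_ge0; case: (integral _ _ _) => // r _ _.
  by rewrite -EFinM ltry.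
Qed.

Lemma L2_measurable f : L2 f -> circle_measurable f.
Proof. by case. Qed.

Lemma sqnorm2E f : L2 f -> sqnorm2 f = (nrm2 f)%:E.
Proof. by move=> [_ fin]; rewrite /nrm2 fineK// ge0_fin_numE// sqnorm2_ge0. Qed.

Lemma L1_sqr_modulus f : L2 f -> L1 (fun t => (modulus (f t) ^+ 2)%:C).
Proof. by move=> /L2P[mf int]; split => //; exact: integrable_cst_angles. Qed.

Lemma nrm2E f : L2 f -> nrm2 f = Re (circle_mean (fun t => (modulus (f t) ^+ 2)%:C)).
Proof.
move=> /L2P[mf int]; rewrite /nrm2 /sqnorm2 Re_circle_mean fineM//.
exact: integrable_fin_num.
Qed.

Lemma inner2_self f : L2 f -> inner2 f f = (nrm2 f)%:C.
Proof.
move=> lf; rewrite /inner2; under [X in circle_mean X]eq_fun do rewrite mulcJ.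
apply: eq_ReIm; first by rewrite -nrm2E.
by rewrite Im_circle_mean/= Rintegral_cst// mul0r mulr0.
Qed.

Lemma mulr_le_sqrD (x y : R) : x * y <= x ^+ 2 + y ^+ 2.
Proof. by have := sqr_ge0 (x - y); have := sqr_ge0 (x + y); lra. Qed.

Lemma L1M f g : L2 f -> L2 g -> L1 (fun t => f t * g t).
Proof.
move=> /L2P[mf int_f] /L2P[mg int_g].
apply: (L1_dominated (p := fun t => modulus (f t) ^+ 2 + modulus (g t) ^+ 2)).
- exact: circle_measurableM.
- exact: integrableD int_f int_g.
- by move=> t _; rewrite modulusM mulr_le_sqrD.
Qed.

Lemma L2_dominated f (p : R -> R) : circle_measurable f ->
  mu.-integrable angles (EFin \o p) ->
  (forall t, angles t -> modulus (f t) ^+ 2 <= p t) -> L2 f.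
Proof.
move=> mf ip fp; apply/L2P; split => //.
apply: le_integrable ip => //.
  by apply/measurable_EFinP; exact: measurable_sqr_modulus.
by move=> t at_; rewrite /= lee_fin ger0_norm ?sqr_ge0// (le_trans (fp _ at_))// ler_norm.
Qed.

Lemma L2_bounded f (k : R) : circle_measurable f ->
  (forall t, angles t -> modulus (f t) <= k) -> L2 f.
Proof.
move=> mf fk; apply: (L2_dominated mf (integrable_cst_angles (k ^+ 2))) => t at_.
by rewrite ler_pXn2r ?nnegrE ?modulus_ge0 ?fk// (le_trans _ (fk _ at_)) ?modulus_ge0.
Qed.

Lemma sqr_modulusD_le (x y : R[i]) :
  modulus (x + y) ^+ 2 <= 2 * modulus x ^+ 2 + 2 * modulus y ^+ 2.
Proof.
apply: (@le_trans _ _ ((modulus x + modulus y) ^+ 2)).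
  by rewrite ler_pXn2r ?nnegrE ?addr_ge0 ?modulus_ge0// modulusD.
by have := sqr_ge0 (modulus x - modulus y); nra.
Qed.

Lemma integrable_sqr_modulusD f g : L2 f -> L2 g ->
  mu.-integrable angles
    (EFin \o (fun t => 2 * modulus (f t) ^+ 2 + 2 * modulus (g t) ^+ 2)).
Proof.
move=> /L2P[mf int_f] /L2P[mg int_g].
by have := integrableD mA (integrableZl mA 2 int_f) (integrableZl mA 2 int_g).
Qed.

Lemma L2D f g : L2 f -> L2 g -> L2 (fun t => f t + g t).
Proof.
move=> lf lg; apply: (L2_dominated _ (integrable_sqr_modulusD lf lg)).
  by apply: circle_measurableD; exact: L2_measurable.
by move=> t _; exact: sqr_modulusD_le.
Qed.

Lemma L2M_bounded f g (k : R) : L2 f -> circle_measurable g ->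
  (forall t, angles t -> modulus (g t) <= k) -> L2 (fun t => g t * f t).
Proof.
move=> /L2P[mf int_f] mg gk.
have ip := integrableZl mA (k ^+ 2) int_f.
apply: (L2_dominated (p := fun t => k ^+ 2 * modulus (f t) ^+ 2) _ ip).
  by apply: circle_measurableM.
move=> t at_; rewrite modulusM exprMn ler_wpM2r ?sqr_ge0//.
by rewrite ler_pXn2r ?nnegrE ?modulus_ge0 ?gk// (le_trans _ (gk _ at_)) ?modulus_ge0.
Qed.

Lemma L2Z c f : L2 f -> L2 (fun t => c * f t).
Proof.
move=> lf; by apply: (L2M_bounded (k := modulus c)) => //; exact: circle_measurable_cst.
Qed.

Lemma L2N f : L2 f -> L2 (fun t => - f t).
Proof. by move=> /(L2Z (-1)); under eq_fun do rewrite mulN1r. Qed.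

Lemma L2B f g : L2 f -> L2 g -> L2 (fun t => f t - g t).
Proof. by move=> lf /L2N; exact: L2D. Qed.

Lemma L2J f : L2 f -> L2 (fun t => (f t)^*).
Proof.
move=> /L2P[mf int_f]; apply: (L2_dominated _ int_f).
  exact: circle_measurableJ.
by move=> t _; rewrite modulus_conj.
Qed.

Lemma L2_cst c : L2 (fun=> c).
Proof. by apply: (@L2_bounded _ (modulus c)) => //; exact: circle_measurable_cst. Qed.

Lemma L2_sum (I : Type) (s : seq I) (F : I -> R -> R[i]) :
  (forall i, L2 (F i)) -> L2 (fun t => \sum_(i <- s) F i t).
Proof.
move=> lF; elim: s => [|i s ih].
  by under eq_fun do rewrite big_nil; exact: L2_cst.
by under eq_fun do rewrite big_cons; exact: L2D.
Qed.

Lemma L2_L1 f : L2 f -> L1 f.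
Proof. by move=> /L1M /(_ (L2_cst 1)); under eq_fun do rewrite mulr1. Qed.

Lemma L1_inner2 f g : L2 f -> L2 g -> L1 (fun t => f t * (g t)^*).
Proof. by move=> lf lg; apply: L1M => //; exact: L2J. Qed.

Lemma inner2Dl f g h : L2 f -> L2 g -> L2 h ->
  inner2 (fun t => f t + g t) h = inner2 f h + inner2 g h.
Proof.
move=> lf lg lh; rewrite /inner2 -circle_meanD; [|exact: L1_inner2..].
by under [in LHS]eq_fun do rewrite mulrDl.
Qed.

Lemma inner2Zl c f h : L2 f -> L2 h ->
  inner2 (fun t => c * f t) h = c * inner2 f h.
Proof.
move=> lf lh; rewrite /inner2 -circle_meanZ; last exact: L1_inner2.
by under [in LHS]eq_fun do rewrite -mulrA.
Qed.

Lemma inner2Nl f h : L2 f -> L2 h -> inner2 (fun t => - f t) h = - inner2 f h.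
Proof.
by move=> lf lh; rewrite -mulN1r -inner2Zl//; under [in RHS]eq_fun do rewrite mulN1r.
Qed.

Lemma inner2Bl f g h : L2 f -> L2 g -> L2 h ->
  inner2 (fun t => f t - g t) h = inner2 f h - inner2 g h.
Proof. by move=> lf lg lh; rewrite inner2Dl ?inner2Nl//; exact: L2N. Qed.

Lemma inner2C f g : L2 f -> L2 g -> inner2 g f = (inner2 f g)^*.
Proof.
move=> lf lg; rewrite /inner2 -circle_meanJ; last exact: L1_inner2.
congr circle_mean; apply/funext => t. by rewrite conjcM conjJK mulrC.
Qed.

Lemma inner2_suml (I : Type) (s : seq I) (F : I -> R -> R[i]) h :
  (forall i, L2 (F i)) -> L2 h ->
  inner2 (fun t => \sum_(i <- s) F i t) h = \sum_(i <- s) inner2 (F i) h.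
Proof.
move=> lF lh; rewrite /inner2 -circle_mean_sum; last by move=> i; exact: L1_inner2.
by under [in LHS]eq_fun do rewrite mulr_suml.
Qed.

Lemma inner2Zr c f h : L2 f -> L2 h ->
  inner2 h (fun t => c * f t) = c^* * inner2 h f.
Proof.
move=> lf lh; rewrite inner2C ?inner2Zl//; last exact: L2Z.
by rewrite conjcM -inner2C.
Qed.

Lemma inner2Br f g h : L2 f -> L2 g -> L2 h ->
  inner2 h (fun t => f t - g t) = inner2 h f - inner2 h g.
Proof.
move=> lf lg lh; rewrite inner2C ?inner2Bl//; last exact: L2B.
by rewrite conjcB -!inner2C.
Qed.

Lemma nrm2D_le f g : L2 f -> L2 g ->
  nrm2 (fun t => f t + g t) <= 2 * nrm2 f + 2 * nrm2 g.
Proof.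
move=> lf lg; rewrite !nrm2E//; last exact: L2D.
have e (x y : R) (u v : R[i]) : x * Re u + y * Re v = Re (x%:C * u + y%:C * v).
  by rewrite ReD !ReM/= !mul0r !subr0.
rewrite e -!circle_meanZ; [|exact: L1_sqr_modulus..].
rewrite -circle_meanD; [|exact/L1Z/L1_sqr_modulus..].
apply: Re_circle_mean_le => //; first exact/L1_sqr_modulus/L2D.
  by apply: L1D; exact/L1Z/L1_sqr_modulus.
by move=> t _; rewrite ReD !ReM/= !mul0r !subr0 sqr_modulusD_le.
Qed.

Lemma nrm2Z c f : L2 f -> nrm2 (fun t => c * f t) = modulus c ^+ 2 * nrm2 f.
Proof.
move=> lf; apply: (@complexI R).
by rewrite -inner2_self ?inner2Zl ?inner2Zr ?inner2_self ?mulrA ?mulcJ ?rmorphM//; exact: L2Z.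
Qed.

Lemma nrm2N f : nrm2 (fun t => - f t) = nrm2 f.
Proof. by rewrite /nrm2 /sqnorm2; under eq_integral do rewrite modulusN. Qed.

Lemma nrm2_distC f g : nrm2 (fun t => f t - g t) = nrm2 (fun t => g t - f t).
Proof. by rewrite -nrm2N; congr nrm2; apply/funext => t; rewrite opprB. Qed.

Lemma nrm2_triangle f g h : L2 f -> L2 g -> L2 h ->
  nrm2 (fun t => f t - h t) <=
  2 * nrm2 (fun t => f t - g t) + 2 * nrm2 (fun t => g t - h t).
Proof.
move=> lf lg lh; rewrite (_ : (fun t => f t - h t) = fun t => (f t - g t) + (g t - h t)).
  by apply: nrm2D_le; exact: L2B.
by apply/funext => t; rewrite addrA subrK.
Qed.

Lemma nrm2_bounded f (k : R) : circle_measurable f ->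
  (forall t, angles t -> modulus (f t) <= k) -> nrm2 f <= k ^+ 2.
Proof.
move=> mf fk; rewrite nrm2E; last exact: L2_bounded fk.
rewrite -[leRHS]/(Re (k ^+ 2)%:C) -(circle_mean_cst (k ^+ 2)%:C).
apply: Re_circle_mean_le => //; [exact/L1_sqr_modulus/(L2_bounded mf fk)|exact: L1_cst|].
move=> t at_ /=.
by rewrite ler_pXn2r ?nnegrE ?modulus_ge0 ?fk// (le_trans _ (fk _ at_)) ?modulus_ge0.
Qed.

Lemma nrm2M_bounded f g (k : R) : L2 f -> circle_measurable g ->
  (forall t, angles t -> modulus (g t) <= k) ->
  nrm2 (fun t => g t * f t) <= k ^+ 2 * nrm2 f.
Proof.
move=> lf mg gk; rewrite !nrm2E//; last exact: L2M_bounded gk.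
have e (x : R) (u : R[i]) : x * Re u = Re (x%:C * u) by rewrite ReM/= mul0r subr0.
rewrite e -circle_meanZ; last exact: L1_sqr_modulus.
apply: Re_circle_mean_le => //; first exact/L1_sqr_modulus/(L2M_bounded lf mg gk).
  exact/L1Z/L1_sqr_modulus.
move=> t at_; rewrite ReM/= mul0r subr0 modulusM exprMn ler_wpM2r ?sqr_ge0//.
by rewrite ler_pXn2r ?nnegrE ?modulus_ge0 ?gk// (le_trans _ (gk _ at_)) ?modulus_ge0.
Qed.

Lemma nrm2B f g : L2 f -> L2 g ->
  nrm2 (fun t => f t - g t) = nrm2 f - 2 * Re (inner2 f g) + nrm2 g.
Proof.
move=> lf lg; apply: (@complexI R); rewrite -inner2_self; last exact: L2B.
rewrite inner2Bl// ?inner2Br//; try exact: L2B.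
rewrite !inner2_self// (inner2C lf lg); case: (inner2 f g) => a b.
by simpc; congr (_ +i* _); rewrite /=; ring.
Qed.

(** The squared norm of f - x z g is nonnegative for real x, and putting z = [inner2 f g] into the
    coefficient makes the cross term real. The minimiser x = 1 / [nrm2 g] gives the claim. A
    function with [nrm2 g] = 0 need not be zero, so that case is treated apart. *)
Lemma cauchy_schwarz f g : L2 f -> L2 g ->
  modulus (inner2 f g) ^+ 2 <= nrm2 f * nrm2 g.
Proof.
move=> lf lg; set z := inner2 f g.
have key (x : R) : 0 <= nrm2 f - 2 * x * modulus z ^+ 2 + x ^+ 2 * modulus z ^+ 2 * nrm2 g.
  have := nrm2_ge0 (fun t => f t - (x%:C * z) * g t).
  rewrite nrm2B//; last exact: L2Z.
  rewrite inner2Zr// -/z nrm2Z// conjcM conjJ_real -mulrA [z^* * z]mulrC mulcJ.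
  rewrite modulusM modulus_real exprMn real_normK ?num_real//.
  by rewrite -rmorphM/= mulrA.
have [g0|g0] := eqVneq (nrm2 g) 0.
  rewrite g0 mulr0.
  have [//|z0] := leP (modulus z ^+ 2) 0.
  (* With [nrm2 g] = 0 the bound is affine in x, and this x makes it equal to -1. *)
  have := key ((nrm2 f + 1) / (2 * modulus z ^+ 2)).
  rewrite g0 mulr0 addr0.
  have -> : 2 * ((nrm2 f + 1) / (2 * modulus z ^+ 2)) * modulus z ^+ 2 = nrm2 f + 1.
    by field; apply: contraTneq z0 => ->; rewrite expr0n ltxx.
  by lra.
have gp : 0 < nrm2 g by rewrite lt_neqAle eq_sym g0 nrm2_ge0.
have := key (nrm2 g)^-1.
have -> : nrm2 f - 2 * (nrm2 g)^-1 * modulus z ^+ 2 +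
    (nrm2 g)^-1 ^+ 2 * modulus z ^+ 2 * nrm2 g = nrm2 f - modulus z ^+ 2 / nrm2 g.
  by field.
by rewrite subr_ge0 ler_pdivrMr.
Qed.

End InnerProduct.

(** * Null functions, and almost everywhere convergence from summable increments *)

Section Completeness.
Variable R : realType.
Implicit Types (f g h : R -> R[i]) (c : R[i]).

Local Notation mu := (@lebesgue_measure R).
Local Notation angles := (@angles R).

Let mA := @measurable_angles R.
Local Hint Resolve mA : core.

Lemma ae_imp (P Q : R -> Prop) : (forall t, P t -> Q t) ->
  {ae mu, forall t, P t} -> {ae mu, forall t, Q t}.
Proof. by move=> PQ; apply: (@filterS _ _ (ae_filter_ringOfSetsType mu)). Qed.

Lemma ae_imp2 (P Q S : R -> Prop) : (forall t, P t -> Q t -> S t) ->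
  {ae mu, forall t, P t} -> {ae mu, forall t, Q t} -> {ae mu, forall t, S t}.
Proof. by move=> PQ; apply: (@filterS2 _ _ (ae_filter_ringOfSetsType mu)). Qed.

Lemma sqnorm2_eq_ae f g : circle_measurable f -> circle_measurable g ->
  eq_ae f g -> sqnorm2 f = sqnorm2 g.
Proof.
move=> mf mg fg; congr (_ * _)%E; apply: ge0_ae_eq_integral => //.
- by apply/measurable_EFinP; exact: measurable_sqr_modulus.
- by apply/measurable_EFinP; exact: measurable_sqr_modulus.
- by move=> t _; rewrite lee_fin sqr_ge0.
- by move=> t _; rewrite lee_fin sqr_ge0.
- by move: fg; apply: ae_imp => t /[apply] ->.
Qed.

Lemma nrm2_0 : nrm2 (fun=> 0 : R[i]) = 0.
Proof.
rewrite /nrm2 /sqnorm2; under eq_integral do rewrite modulus0 expr0n/=.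
by rewrite integral0 mule0.
Qed.

Lemma nrm2_eq0 f : L2 f -> nrm2 f = 0 -> eq_ae f (fun=> 0).
Proof.
move=> lf f0; have mf := L2_measurable lf.
have : (\int[mu]_(t in angles) (modulus (f t) ^+ 2)%:E = 0)%E.
  have := sqnorm2E lf; rewrite f0 /sqnorm2 => /eqP.
  by rewrite mule_eq0 eqe invr_eq0 (gt_eqF (twopi_gt0 R))/= => /eqP.
move=> i0; have mE := proj2 (measurable_EFinP _ _) (measurable_sqr_modulus mf).
have [H _] := ae_eq_integral_abs mu mA mE.
have /H : (\int[mu]_(x in angles) `|(EFin \o (fun t => modulus (f t) ^+ 2)%R) x| = 0)%E.
  by rewrite -[RHS]i0; apply: eq_integral => t _; rewrite /= ger0_norm// sqr_ge0.
apply: ae_imp => t /[apply] -[] /eqP; rewrite sqrf_eq0 => /eqP.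
exact: modulus0_eq0.
Qed.

Lemma eq_ae_nrm2B f g : circle_measurable f -> circle_measurable g -> eq_ae f g ->
  nrm2 (fun t => f t - g t) = 0.
Proof.
move=> mf mg fg; rewrite -[RHS]nrm2_0 /nrm2; congr fine; apply: sqnorm2_eq_ae.
- exact: circle_measurableB.
- exact: circle_measurable_cst.
- by move: fg; apply: ae_imp => t /[apply] ->; rewrite subrr.
Qed.

Lemma inner2_nrm0 f g : L2 f -> L2 g -> nrm2 f = 0 -> inner2 f g = 0.
Proof.
move=> lf lg f0; apply: modulus0_eq0; apply/eqP.
have := cauchy_schwarz lf lg; rewrite f0 mul0r => le0.
by rewrite -sqrf_eq0 eq_le le0 sqr_ge0.
Qed.

Lemma eq_ae_inner2l f g h : L2 f -> L2 g -> L2 h -> eq_ae f g ->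
  inner2 f h = inner2 g h.
Proof.
move=> lf lg lh fg; apply/eqP; rewrite -subr_eq0 -inner2Bl//; apply/eqP.
apply: inner2_nrm0 => //; first exact: L2B.
by apply: eq_ae_nrm2B => //; exact: L2_measurable.
Qed.

Definition L2_cvg (u : nat -> R -> R[i]) f :=
  forall e : R, 0 < e -> exists N, forall n, (N <= n)%N ->
    nrm2 (fun t => u n t - f t) <= e.

(** The increments telescope, and an absolutely convergent series converges. Real and imaginary
    parts are treated together as an additive map p bounded by the modulus. *)
Lemma sum_lty_modulus_cvg (v : nat -> R -> R[i]) t :
  (\sum_(0 <= k <oo) (modulus (v k.+1 t - v k t))%:E < +oo)%E ->
  exists z : R[i], Re (v k t) @[k --> \oo] --> Re z /\ Im (v k t) @[k --> \oo] --> Im z.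
Proof.
move=> /nnseries_is_cvg cv.
have key (p : R[i] -> R) : (forall x y, p (x - y) = p x - p y) ->
    (forall x, `|p x| <= modulus x) -> cvgn (fun k => p (v k t)).
  move=> pB pm.
  have cs : cvgn (series (fun k => p (v k.+1 t) - p (v k t))).
    apply: normed_cvg; apply: series_le_cvg (cv _) => n /=; rewrite ?modulus_ge0//.
    by rewrite -pB pm.
  rewrite [X in cvgn X](_ : _ = (fun k => p (v 0%N t) + series (fun k => p (v k.+1 t) - p (v k t)) k)).
    by apply: is_cvgD => //; exact: is_cvg_cst.
  by apply/funext => k; rewrite /series/= telescope_sumr// addrC subrK.
have /cvg_ex[x xv] := key (@complex.Re R) (fun x y => etrans (ReD _ _) (congr1 _ (ReN _)))
  (@normr_Re_le R).
have /cvg_ex[y yv] := key (@complex.Im R) (fun x y => etrans (ImD _ _) (congr1 _ (ImN _)))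
  (@normr_Im_le R).
by exists (x +i* y).
Qed.

(** The inequality y <= 1 + y^2 at y = 2^k d gives d <= 2^-k + 2^k d^2 for the increment d. Since
    2^k 8^-k = 4^-k <= 2^-k, the integral of d is at most 4 pi 2^-k. These bounds are summable, so
    the sum of the increments is integrable, hence finite almost everywhere. *)
Lemma ae_summable_increments (v : nat -> R -> R[i]) : (forall k, L2 (v k)) ->
  (forall k, nrm2 (fun t => v k.+1 t - v k t) <= (8^-1) ^+ k) ->
  {ae mu, forall t, angles t ->
    (\sum_(0 <= k <oo) (modulus (v k.+1 t - v k t))%:E < +oo)%E}.
Proof.
move=> lv v8; pose d k t : R := modulus (v k.+1 t - v k t).
have ld k : L2 (fun t => v k.+1 t - v k t) by exact: L2B.
have md k : measurable_fun angles (d k).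
  by apply: measurable_modulus; exact: L2_measurable.
have d0 k t : (0 <= (d k t)%:E)%E by rewrite lee_fin modulus_ge0.
have intd k : (\int[mu]_(t in angles) (d k t)%:E <= (4 * pi * (2^-1) ^+ k)%:E)%E.
  have /L2P[_ int2] := ld k.
  have ic : mu.-integrable angles (EFin \o (fun=> (2^-1) ^+ k : R)) := integrable_cst_angles _.
  have iz := integrableZl mA (2 ^+ k) int2.
  have ib : mu.-integrable angles (EFin \o (fun t => (2^-1) ^+ k + 2 ^+ k * d k t ^+ 2)).
    exact: integrableD ic iz.
  have dle t : d k t <= (2^-1) ^+ k + 2 ^+ k * d k t ^+ 2.
    have h : (2^-1) ^+ k * 2 ^+ k = 1 :> R by rewrite -exprMn mulVf// expr1n.
    have p2 : 0 < 2 ^+ k :> R by rewrite exprn_gt0.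
    rewrite -(ler_pM2l p2) mulrDr [_ * (2^-1) ^+ k]mulrC h.
    have := sqr_ge0 (2 ^+ k * d k t - 1); have := sqr_ge0 (2 ^+ k * d k t).
    by nra.
  have idk : mu.-integrable angles (EFin \o d k).
    by have := integrable_modulus (L2_L1 (ld k)).
  rewrite -[leLHS]fineK; last exact: integrable_fin_num.
  rewrite lee_fin; apply: le_trans (le_Rintegral _ idk ib _) _ => //.
  rewrite RintegralD// RintegralZl// Rintegral_cst//.
  rewrite [X in fine X]mu_angles/=.
  have -> : \int[mu]_(x in angles) d k x ^+ 2 = 2 * pi * nrm2 (fun t => v k.+1 t - v k t).
    by rewrite nrm2E// Re_circle_mean mulrA mulfV ?mul1r// gt_eqF// twopi_gt0.
  have p0 := pi_gt0 R.
  rewrite [leRHS](_ : _ = (2^-1) ^+ k * (2 * pi) + (2^-1) ^+ k * (2 * pi)); last by ring.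
  rewrite lerD2l mulrCA [leRHS]mulrC ler_wpM2l ?(ltW (twopi_gt0 R))//.
  rewrite (le_trans (ler_wpM2l _ (v8 k))) ?exprn_ge0//.
  rewrite -exprMn; apply: lerXn2r; rewrite ?nnegrE; lra.
have mS : measurable_fun angles (fun t => (\sum_(0 <= k <oo) (d k t)%:E)%E).
  by apply: ge0_emeasurable_sum => // k _; exact/measurable_EFinP.
have S0 t : (0 <= \sum_(0 <= k <oo) (d k t)%:E)%E.
  by apply: nneseries_ge0 => n _ _; exact: d0.
have iS : mu.-integrable angles (fun t => (\sum_(0 <= k <oo) (d k t)%:E)%E).
  apply/integrableP; split => //.
  under eq_integral do rewrite gee0_abs ?S0//.
  rewrite integral_nneseries => //; first last.
  - by move=> k; apply/measurable_EFinP; exact: md.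
  apply: (@le_lt_trans _ _ (\sum_(0 <= k <oo) (4 * pi * (2^-1) ^+ k)%:E)%E).
    apply: lee_nneseries => [k _ _|k _]; last exact: intd.
    by apply: integral_ge0.
  have /= cg := @cvg_geometric_series R (4 * pi) (2^-1) _.
  have /cg {}cg : `|2^-1 : R| < 1 by rewrite ger0_norm; lra.
  rewrite (_ : (\sum_(0 <= k <oo) (4 * pi * 2^-1 ^+ k)%:E)%E =
      limn (EFin \o series (geometric (4 * pi) 2^-1))).
    have /cvg_lim ->// : (EFin \o series (geometric (4 * pi) (2^-1 : R))) @ \oo -->
        (4 * pi / (1 - 2^-1) : R)%:E.
      by apply/fine_cvgP; split => //; exact: nearW.
    by rewrite ltry.
  by congr (limn _); apply/funext => n; rewrite /= sumEFin.
have := integrable_ae mA iS; apply: ae_imp => t /[apply].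
by rewrite ge0_fin_numE.
Qed.

End Completeness.

(** * Completeness of L^2 *)

Section RieszFischer.
Variable R : realType.
Implicit Types (f g h : R -> R[i]) (c : R[i]).

Local Notation mu := (@lebesgue_measure R).
Local Notation angles := (@angles R).

Let mA := @measurable_angles R.
Local Hint Resolve mA : core.

Definition ae_cvg (v : nat -> R -> R[i]) g :=
  {ae mu, forall t, angles t ->
    Re (v k t) @[k --> \oo] --> Re (g t) /\ Im (v k t) @[k --> \oo] --> Im (g t)}.

Lemma ae_cvg_shift (v : nat -> R -> R[i]) g m : ae_cvg v g ->
  ae_cvg (fun k => v (k + m)%N) g.
Proof.
apply: ae_imp => t /[apply] -[cr ci]; split.
- by have := cvg_shiftn m (fun k => Re (v k t)) (nbhs (Re (g t))) => ->.
- by have := cvg_shiftn m (fun k => Im (v k t)) (nbhs (Im (g t))) => ->.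
Qed.

Lemma ae_cvg_measurable_limit (v : nat -> R -> R[i]) :
  (forall k, circle_measurable (v k)) ->
  {ae mu, forall t, angles t -> exists z : R[i],
    Re (v k t) @[k --> \oo] --> Re z /\ Im (v k t) @[k --> \oo] --> Im z} ->
  exists2 g, circle_measurable g & ae_cvg v g.
Proof.
move=> mv [N [mN N0 subN]].
(* Replacing v by 0 on the measurable null set N makes the sequence converge at every angle, so that
   measurability passes to the pointwise limit. *)
pose w k t := if t \in N then 0 else v k t.
have cw t : exists z : R[i], angles t ->
    Re (w k t) @[k --> \oo] --> Re z /\ Im (w k t) @[k --> \oo] --> Im z.
  rewrite /w; have [_|tN] := boolP (t \in N).
    by exists 0 => _; split; exact: cvg_cst.
  have [[z hz]|nz] := pselect (exists z : R[i],
    Re (v k t) @[k --> \oo] --> Re z /\ Im (v k t) @[k --> \oo] --> Im z).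
    by exists z.
  exists 0 => at_; exfalso; move: tN; rewrite notin_setE; apply.
  by apply: subN => /= /(_ at_) /nz.
have [g gP] := choice cw.
have mw k : circle_measurable (w k).
  have -> : w k = (fun t => (\1_(~` N) t)%:C * v k t).
    apply/funext => t; rewrite /w indicE in_setC; case: ifP => _ /=.
      by rewrite mul0r.
    by rewrite mul1r.
  apply: circle_measurableM => //; split => /=; last exact: measurable_cst.
  by apply: measurable_indic; exact: measurableC.
exists g.
  split.
  - apply: (@measurable_fun_cvg _ _ _ _ (fun k t => Re (w k t))).
      by move=> k; case: (mw k).
    by move=> t /gP[].
  - apply: (@measurable_fun_cvg _ _ _ _ (fun k t => Im (w k t))).
      by move=> k; case: (mw k).
    by move=> t /gP[].
exists N; split => // t /= H; apply: contrapT => tN; apply: H => at_.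
by have := gP t at_; rewrite /w memNset.
Qed.

(** Fatou's lemma for |f - v k|^2. The limit g is only known to be measurable; that f - g lies in
    [L2] comes out together with the bound. *)
Lemma fatou_nrm2 (v : nat -> R -> R[i]) f g e : (forall k, L2 (v k)) -> L2 f ->
  circle_measurable g -> ae_cvg v g ->
  (forall k, nrm2 (fun t => f t - v k t) <= e) ->
  L2 (fun t => f t - g t) /\ nrm2 (fun t => f t - g t) <= e.
Proof.
move=> lv lf mg vg fe.
pose F k t := (modulus (f t - v k t) ^+ 2)%:E.
have mF k : measurable_fun angles (F k).
  apply/measurable_EFinP; apply: measurable_sqr_modulus; apply: L2_measurable.
  exact: L2B.
have F0 k t : angles t -> (0 <= F k t)%E by rewrite lee_fin sqr_ge0.
have tp := twopi_gt0 R.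
have intF k : (\int[mu]_(t in angles) F k t <= (2 * pi * e)%:E)%E.
  have lk := L2B lf (lv k).
  have := sqnorm2E lk; rewrite /sqnorm2 => E.
  have : ((2 * pi)%:E * ((2 * pi)^-1%:E * \int[mu]_(t in angles) F k t) <= (2 * pi * e)%:E)%E.
    by rewrite /F E -EFinM lee_fin ler_pM2l.
  by rewrite muleA -EFinM mulfV ?mul1e// gt_eqF.
have mfg : circle_measurable (fun t => f t - g t).
  by apply: circle_measurableB => //; exact: L2_measurable.
have mG : measurable_fun angles (fun t => (modulus (f t - g t) ^+ 2)%:E).
  by apply/measurable_EFinP; exact: measurable_sqr_modulus.
have intG : (\int[mu]_(t in angles) (modulus (f t - g t) ^+ 2)%:E <= (2 * pi * e)%:E)%E.
  rewrite (_ : integral _ _ _ = (\int[mu]_(t in angles) limn_einf (F^~ t))%E).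
    apply: (le_trans (fatou mu mA mF F0)).
    rewrite limn_einf_lim; apply: lime_le; first exact: is_cvg_einfs.
    apply: nearW => k; apply: le_trans (intF k).
    by apply: ereal_inf_lbound; exists k => /=.
  apply: ge0_ae_eq_integral => //.
  (* Measurability of the lower limit is reduced to that of an upper limit by a change of sign. *)
  - rewrite (_ : (fun t => limn_einf _) = (fun t => - limn_esup (fun k => - F k t))%E).
      apply: measurableT_comp => //; apply: (measurable_fun_limn_esup (f := fun k t => - F k t)%E) => k.
      by apply: measurableT_comp (mF k).
    apply/funext => t; rewrite -limn_einfN; congr limn_einf.
    by apply/funext => k; rewrite /= opprK.
  - by move=> t _; rewrite lee_fin sqr_ge0.
  - move=> t at_; rewrite limn_einf_lim; apply: lime_ge; first exact: is_cvg_einfs.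
    by apply: nearW => k; apply: le_ereal_inf_tmp => _ [m _ <-]; exact: F0.
  move: vg; apply: ae_imp => t H at_; have [cr ci] := H at_.
  have /cvg_limn_einf_sup[-> _] // : F k t @[k --> \oo] --> (modulus (f t - g t) ^+ 2)%:E.
  apply/fine_cvgP; split; first exact: nearW.
  rewrite (_ : _ \o _ = fun k => (Re (f t) - Re (v k t)) ^+ 2 + (Im (f t) - Im (v k t)) ^+ 2).
    rewrite sqr_modulus !(ReD, ImD, ReN, ImN).
    by apply: cvgD; rewrite !expr2; apply: cvgM; apply: cvgB => //; exact: cvg_cst.
  by apply/funext => k; rewrite /= sqr_modulus !(ReD, ImD, ReN, ImN).
have nG : (sqnorm2 (fun t => f t - g t)%R <= e%:E)%E.
  rewrite /sqnorm2;
  have -> : e%:E = ((2 * pi)^-1%:E * (2 * pi * e)%:E)%E.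
    by rewrite -EFinM mulrA mulVf ?mul1r// gt_eqF.
  by rewrite lee_pmul2l ?lte_fin ?invr_gt0.
have lG : L2 (fun t => f t - g t) by split => //; apply: le_lt_trans nG _; rewrite ltry.
by split => //; move: nG; rewrite sqnorm2E.
Qed.

(** A rapidly converging subsequence has an almost everywhere limit, and Fatou's lemma turns the
    Cauchy bounds along it into bounds for the distance of the whole sequence to that limit. *)
Theorem L2_complete (u : nat -> R -> R[i]) : (forall n, L2 (u n)) ->
  (forall e : R, 0 < e -> exists N, forall m n, (N <= m)%N -> (N <= n)%N ->
    nrm2 (fun t => u m t - u n t) <= e) ->
  exists2 g, L2 g & L2_cvg u g.
Proof.
move=> lu cu.
have /choice[phi phiP] : forall k, exists N, forall m n, (N <= m)%N -> (N <= n)%N ->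
    nrm2 (fun t => u m t - u n t) <= (8^-1) ^+ k.
  by move=> k; apply: cu; rewrite exprn_gt0// invr_gt0.
(* Summing the thresholds gives an index beyond every [phi j] with j <= k, whether or not [phi] is
   monotone. *)
pose psi k := (\sum_(j < k.+1) phi j)%N.
have psi_phi k j : (j <= k)%N -> (phi j <= psi k)%N.
  move=> jk; rewrite /psi (bigD1 (Ordinal (jk : (j < k.+1)%N)))//=.
  exact: leq_addr.
have lv k : L2 (u (psi k)) by exact: lu.
have v8 k : nrm2 (fun t => u (psi k.+1) t - u (psi k) t) <= (8^-1) ^+ k.
  by apply: phiP; exact: psi_phi.
have := ae_summable_increments lv v8.
move=> /(ae_imp (fun t H at_ => sum_lty_modulus_cvg (v := fun k => u (psi k)) (H at_))).
move=> /ae_cvg_measurable_limit[k|g mg vg]; first exact: L2_measurable.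
(* The subsequence is shifted by k, so that all its indices are at least [phi k] and the Cauchy
   bound holds against each of its terms. *)
have key k n : (phi k <= n)%N -> L2 (fun t => u n t - g t) /\
    nrm2 (fun t => u n t - g t) <= (8^-1) ^+ k.
  move=> kn; apply: (fatou_nrm2 _ _ mg (ae_cvg_shift k vg)) => // j.
  by apply: phiP => //; apply: psi_phi; exact: leq_addl.
exists g.
  have [l0 _] := key 0 _ (leqnn _).
  have := L2B (lu (phi 0)) l0; congr L2; apply/funext => t.
  by rewrite opprB addrC subrK.
move=> e e0.
have [k ke] : exists k, (8^-1 : R) ^+ k <= e.
  have lt1 : `|8^-1 : R| < 1 by rewrite ger0_norm; lra.
  have /cvgrPdist_le/(_ _ e0)[k _ /(_ k (leqnn k))] := cvg_geometric 1 lt1.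
  rewrite /geometric/= sub0r normrN mul1r ger0_norm ?exprn_ge0// => ke.
  by exists k.
by exists (phi k) => n kn; apply: le_trans ke; have [] := key k n kn.
Qed.

End RieszFischer.

(** * Orthonormal sequences and projection onto their closed span *)

Section Orthonormal.
Variable R : realType.
Implicit Types (f g h w : R -> R[i]) (v : nat -> R -> R[i]) (a : nat -> R[i]).

Definition orthonormal v :=
  (forall i, L2 (v i)) /\ forall i j, inner2 (v i) (v j) = (i == j)%:R.

Definition lincomb v a m n : R -> R[i] := fun t => \sum_(m <= i < n) a i * v i t.

Lemma L2_lincomb v a m n : orthonormal v -> L2 (lincomb v a m n).
Proof. by move=> [lv _]; apply: L2_sum => i; exact: L2Z. Qed.

Lemma lincombB v a m n p : (m <= n)%N -> (n <= p)%N ->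
  (fun t => lincomb v a m p t - lincomb v a m n t) = lincomb v a n p.
Proof.
move=> mn np; apply/funext => t.
by rewrite /lincomb (@big_cat_nat _ _ _ n m p)//= addrAC subrr add0r.
Qed.

Lemma inner2_lincombl v a m n w : orthonormal v -> L2 w ->
  inner2 (lincomb v a m n) w = \sum_(m <= i < n) a i * inner2 (v i) w.
Proof.
move=> [lv _] lw; rewrite inner2_suml//; last by move=> i; exact: L2Z.
by apply: eq_bigr => i _; rewrite inner2Zl.
Qed.

Lemma inner2_lincomb_basis v a m n j : orthonormal v -> (m <= j < n)%N ->
  inner2 (lincomb v a m n) (v j) = a j.
Proof.
move=> ov mjn; have [lv vij] := ov.
rewrite inner2_lincombl// (bigD1_seq j) ?mem_index_iota ?iota_uniq//=.
rewrite vij eqxx mulr1 big1 ?addr0// => i ij.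
by rewrite vij (negbTE ij) mulr0.
Qed.

Lemma nrm2_lincomb v a m n : orthonormal v ->
  nrm2 (lincomb v a m n) = \sum_(m <= i < n) modulus (a i) ^+ 2.
Proof.
move=> ov; have [lv vij] := ov; apply: (@complexI R).
rewrite -inner2_self; last exact: L2_lincomb.
rewrite inner2_lincombl//; last exact: L2_lincomb.
rewrite rmorph_sum/= big_nat_cond [RHS]big_nat_cond; apply: eq_bigr => i /andP[imn _].
by rewrite inner2C ?inner2_lincomb_basis -?mulcJ//; exact: L2_lincomb.
Qed.

Lemma bessel v f n : orthonormal v -> L2 f ->
  \sum_(0 <= i < n) modulus (inner2 f (v i)) ^+ 2 <= nrm2 f.
Proof.
move=> ov lf; have [lv vij] := ov; pose a i := inner2 f (v i).
have ls := L2_lincomb a 0 n ov.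
pose S : R := \sum_(0 <= i < n) modulus (a i) ^+ 2.
have e : inner2 f (lincomb v a 0 n) = S%:C.
  rewrite inner2C// inner2_lincombl// rmorph_sum/= rmorph_sum; apply: eq_bigr => i _ /=.
  by rewrite conjcM -inner2C// -/(a i) mulrC mulcJ.
have := nrm2_ge0 (fun t => f t - lincomb v a 0 n t).
rewrite nrm2B// nrm2_lincomb// e -/S -[Re S%:C]/S => S0.
suff : S <= nrm2 f by [].
by move: S0; move: S (nrm2 f) {e} => S N; lra.
Qed.

Lemma orthonormal_coef_cvg v f : orthonormal v -> L2 f ->
  cvgn (series (fun i => modulus (inner2 f (v i)) ^+ 2)).
Proof.
move=> ov lf; apply: nondecreasing_is_cvgn.
  by apply: nondecreasing_series => n _; rewrite sqr_ge0.
by exists (nrm2 f) => _ [n _ <-]; exact: bessel.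
Qed.

Lemma series_cauchy_tail (u : nat -> R) : cvgn (series u) -> forall e, 0 < e ->
  exists N, forall m n, (N <= m)%N -> (m <= n)%N -> `|\sum_(m <= i < n) u i| <= e.
Proof.
move=> /cvg_ex[l ul] e e0; have e2 : 0 < e / 2 by rewrite divr_gt0.
move/cvgrPdist_le : ul => /(_ _ e2)[N _ hN]; exists N => m n Nm mn.
have -> : \sum_(m <= i < n) u i = (l - series u m) - (l - series u n).
  by rewrite /series/= (@big_cat_nat _ _ _ m 0 n)//=; ring.
rewrite (le_trans (ler_normB _ _))// [leRHS]splitr lerD//; apply: hN => //=.
exact: leq_trans mn.
Qed.

(** Bessel's inequality makes the partial sums Cauchy, and their limit g is the orthogonal
    projection of f onto the closed span of [v]. Whether g equals f depends on the system: for Hardy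
    functions and nonnegative frequencies it will, while negative frequencies yield the projection
    onto [H2_minus]. *)
Theorem orthonormal_expansion v f : orthonormal v -> L2 f ->
  exists g, [/\ L2 g, L2_cvg (lincomb v (fun i => inner2 f (v i)) 0) g,
    (forall j, inner2 g (v j) = inner2 f (v j)) &
    (forall w, L2 w -> (forall i, inner2 (v i) w = 0) -> inner2 g w = 0)].
Proof.
move=> ov lf; have [lv vij] := ov; pose a i := inner2 f (v i).
have ls n := L2_lincomb a 0 n ov.
have cu (e : R) : 0 < e -> exists N, forall m n, (N <= m)%N -> (N <= n)%N ->
    nrm2 (fun t => lincomb v a 0 m t - lincomb v a 0 n t) <= e.
  move=> /(series_cauchy_tail (orthonormal_coef_cvg ov lf))[N hN].
  exists N => m n; wlog mn : m n / (m <= n)%N => [H Nm Nn|Nm Nn].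
    case/orP : (leq_total m n) => mn; first exact: H.
    by rewrite nrm2_distC; exact: H.
  rewrite nrm2_distC lincombB// nrm2_lincomb//.
  by rewrite (le_trans (ler_norm _))// hN.
have [g lg ug] := L2_complete ls cu; exists g.
(* Continuity of the inner product: a value taken by all late partial sums is taken by g. The
   denominator [nrm2 w + 1] is there to be nonzero. *)
have key w z : L2 w -> (exists N, forall n, (N <= n)%N -> inner2 (lincomb v a 0 n) w = z) ->
    inner2 g w = z.
  move=> lw [N hN]; apply/eqP; rewrite -subr_eq0; apply/eqP/modulus0_eq0/eqP.
  rewrite -sqrf_eq0 eq_le sqr_ge0 andbT; apply/ler_addgt0Pl => e e0; rewrite addr0.
  have w1 : 0 < nrm2 w + 1 by rewrite ltr_wpDl ?nrm2_ge0.
  have [M hM] := ug (e / (nrm2 w + 1)) (divr_gt0 e0 w1).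
  pose n := maxn M N.
  rewrite -(hN n) ?leq_maxr// -inner2Bl//.
  apply: le_trans (cauchy_schwarz (L2B lg (ls n)) lw) _.
  rewrite nrm2_distC; apply: (@le_trans _ _ (e / (nrm2 w + 1) * nrm2 w)).
    by rewrite ler_wpM2r ?nrm2_ge0// hM// leq_maxl.
  by rewrite -mulrA ler_piMr ?(ltW e0)// mulrC ler_pdivrMr// mul1r lerDl.
split => // [j|w lw vw].
- apply: key => //; exists j.+1 => n jn.
  by rewrite (inner2_lincomb_basis a ov).
- by apply: key => //; exists 0%N => n _; rewrite inner2_lincombl// big1// => i _; rewrite vw mulr0.
Qed.

End Orthonormal.

(** * Fourier series *)

Section FourierBasis.
Variable R : realType.
Implicit Types (f g h w : R -> R[i]) (m n : int).

Local Notation mu := (@lebesgue_measure R).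
Local Notation angles := (@angles R).

Lemma Rintegral_derive (F F' : R -> R) (a b : R) : a < b ->
  (forall x : R, is_derive x (1 : R) F (F' x)) -> continuous F' ->
  \int[mu]_(t in `[a, b]) F' t = F b - F a.
Proof.
move=> ab dF cF'.
have cF : continuous F.
  by move=> x; apply/differentiable_continuous/derivable1_diffP; apply: ex_derive.
rewrite /Rintegral (@continuous_FTC2 _ _ F)//.
- exact: continuous_subspaceT.
- split.
  + by move=> x _; exact: ex_derive.
  + by apply: cvg_at_right_filter; exact: cF.
  + by apply: cvg_at_left_filter; exact: cF.
- by move=> x _; rewrite derive1E; exact: derive_val.
Qed.

Definition fexp n : R -> R[i] := fun t => cis (n%:~R * t).

Lemma fexpD m n t : fexp (m + n) t = fexp m t * fexp n t.
Proof. by rewrite /fexp intrD mulrDl cisD. Qed.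

Lemma fexpJ n t : (fexp n t)^* = fexp (- n) t.
Proof. by rewrite /fexp mulrNz mulNr cisN. Qed.

Lemma fexp_nat (k : nat) t : fexp k t = cis t ^+ k.
Proof. by rewrite cisX. Qed.

Lemma fexp_Posz (k : nat) : fexp k = fun t => cis t ^+ k.
Proof. by apply/funext => t; rewrite fexp_nat. Qed.

Lemma fexp_Negz (k : nat) : fexp (Negz k) = fun t => (cis t ^+ k.+1)^*.
Proof. by apply/funext => t; rewrite NegzE -fexpJ fexp_nat. Qed.

Lemma modulus_fexp n t : modulus (fexp n t) = 1.
Proof. exact: modulus_cis. Qed.

Lemma circle_measurable_fexp n : circle_measurable (fexp n).
Proof.
case: n => k; first by rewrite fexp_Posz; exact/circle_measurableX/circle_measurable_cis.
rewrite fexp_Negz.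
exact/circle_measurableJ/circle_measurableX/circle_measurable_cis.
Qed.

Lemma L2_fexp n : L2 (fexp n).
Proof.
apply: (@L2_bounded _ _ 1); first exact: circle_measurable_fexp.
by move=> t _; rewrite modulus_fexp.
Qed.

Lemma cis2pi : cis (2 * pi) = 1 :> R[i].
Proof. by rewrite /cis mulr_natl cos2pi sin2pi. Qed.

Lemma cis_mul_nat2pi (k : nat) : cis (k%:R * (2 * pi)) = 1 :> R[i].
Proof. by rewrite -cisX cis2pi expr1n. Qed.

Lemma is_derive_mull (k x : R) : is_derive x (1 : R) (fun t : R => k * t) k.
Proof.
by apply: is_derive_eq (is_deriveZ k (is_derive_id x (1 : R))) _; rewrite /GRing.scale/= mulr1.
Qed.

Lemma circle_mean_cisX (k : nat) : (0 < k)%N ->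
  circle_mean (fun t => cis t ^+ k) = 0 :> R[i].
Proof.
move=> k0; have kr : k%:R != 0 :> R by rewrite pnatr_eq0 -lt0n.
have tp := twopi_gt0 R.
have ck : continuous (fun t : R => k%:R * t).
  by move=> t; apply: cvgM; [exact: cvg_cst|exact: cvg_id].
apply: eq_ReIm.
- rewrite Re_circle_mean.
  under eq_Rintegral do rewrite cisX /cis/=.
  have d (x : R) : is_derive x (1 : R) (fun t => k%:R^-1 * sin (k%:R * t)) (cos (k%:R * x)).
    apply: is_derive_eq (is_deriveZ k%:R^-1
      (is_derive1_comp (is_derive_sin (k%:R * x)) (is_derive_mull k%:R x))) _.
    by rewrite /GRing.scale/= mulrCA mulVf// mulr1.
  rewrite (@Rintegral_derive _ _ _ _ tp d).
    have := cis_mul_nat2pi k; rewrite /cis => -[_ ->].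
    by rewrite !mulr0 sin0 mulr0 subr0 mulr0.
  by move=> x; apply: continuous_comp; [exact: ck|exact: continuous_cos].
- rewrite Im_circle_mean.
  under eq_Rintegral do rewrite cisX /cis/=.
  have d (x : R) : is_derive x (1 : R) (fun t => - k%:R^-1 * cos (k%:R * t)) (sin (k%:R * x)).
    apply: is_derive_eq (is_deriveZ (- k%:R^-1)
      (is_derive1_comp (is_derive_cos (k%:R * x)) (is_derive_mull k%:R x))) _.
    by rewrite /GRing.scale/=; field.
  rewrite (@Rintegral_derive _ _ _ _ tp d).
    have := cis_mul_nat2pi k; rewrite /cis => -[-> _].
    by rewrite !mulr0 cos0 mulr1 subrr mulr0.
  by move=> x; apply: continuous_comp; [exact: ck|exact: continuous_sin].
Qed.

Lemma circle_mean_fexp n : circle_mean (fexp n) = (n == 0)%:R.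
Proof.
case: n => k.
  rewrite fexp_Posz; case: k => [|k]; last by rewrite circle_mean_cisX.
  by rewrite -[RHS]circle_mean_cst; under eq_fun do rewrite expr0.
rewrite fexp_Negz circle_meanJ.
  by rewrite circle_mean_cisX//; exact: conjc0.
by apply: L2_L1; rewrite -fexp_Posz; exact: L2_fexp.
Qed.

Lemma inner2_fexp m n : inner2 (fexp m) (fexp n) = (m == n)%:R.
Proof.
rewrite -subr_eq0 -circle_mean_fexp; congr circle_mean; apply/funext => t.
by rewrite fexpJ fexpD.
Qed.

Lemma orthonormal_fexp (s : nat -> int) : injective s ->
  orthonormal (fun k => fexp (s k)).
Proof.
move=> si; split=> [k|i j]; first exact: L2_fexp.
by rewrite inner2_fexp (inj_eq si).
Qed.

End FourierBasis.

(** * Abel means of the sawtooth function *)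

Section Sawtooth.
Variable R : realType.
Implicit Types (r s t x : R).

(** This is the imaginary part of -log (1 - r e^(it)), that is, the sum of r^k sin (k t) / k over k
    >= 1. The closed form with [atan] gives the bound pi / 2 uniformly in r. *)
Definition saw r t : R := atan (r * sin t / (1 - r * cos t)).

Definition saw_partial (N : nat) r t : R :=
  \sum_(k < N) r ^+ k.+1 * (sin (k.+1%:R * t) / k.+1%:R).

Lemma one_sub_mul_cos_gt0 r t : 0 <= r -> r < 1 -> 0 < 1 - r * cos t.
Proof.
by move=> r0 r1; have := cos_le1 t; nra.
Qed.

Lemma saw_denom_ge r t : 0 <= r -> (1 - r) ^+ 2 <= 1 - 2 * r * cos t + r ^+ 2.
Proof. by move=> r0; have := cos_le1 t; nra. Qed.

Lemma is_derive_saw r t : 0 <= r -> r < 1 ->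
  is_derive r (1 : R) (saw ^~ t) (sin t / (1 - 2 * r * cos t + r ^+ 2)).
Proof.
move=> r0 r1; have c0 := one_sub_mul_cos_gt0 t r0 r1.
have cn : 1 - r * cos t != 0 by rewrite gt_eqF.
have dn : is_derive r (1 : R) (fun r : R => r * sin t) (sin t).
  rewrite (_ : (fun r : R => r * sin t) = (fun r => sin t * r)).
    exact: is_derive_mull.
  by apply/funext => y; rewrite mulrC.
have dd : is_derive r (1 : R) (fun r : R => 1 - r * cos t) (- cos t).
  have dc : is_derive r (1 : R) (fun r : R => cos t * r) (cos t) by exact: is_derive_mull.
  have := is_deriveB (is_derive_cst (1 : R) r (1 : R)) dc.
  rewrite sub0r; congr (is_derive _ _ _ _); apply/funext => y.
  by rewrite /= mulrC.
have di := @is_deriveV _ (fun r => 1 - r * cos t) r _ _ cn dd.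
have dq := is_deriveM dn di.
have da := @is_derive1_comp R atan (fun r => r * sin t / (1 - r * cos t)) r _ _ (is_derive1_atan _) dq.
apply: is_derive_eq da _.
have q0 : (1 - r * cos t) ^+ 2 + (r * sin t) ^+ 2 = 1 - 2 * r * cos t + r ^+ 2.
  by rewrite exprMn sin2cos2; ring.
have qn : 1 - 2 * r * cos t + r ^+ 2 != 0.
  by rewrite -q0 gt_eqF// ltr_pwDl ?sqr_ge0// exprn_gt0.
rewrite /GRing.scale/= -q0.
field; by rewrite q0 qn cn.
Qed.

Lemma is_derive_exprS N r :
  is_derive r (1 : R) (fun r : R => r ^+ N.+1) (N.+1%:R * r ^+ N).
Proof.
rewrite (_ : (fun r : R => r ^+ N.+1) = (@id R) ^+ N.+1).
  apply: is_derive_eq (is_deriveX N.+1 (is_derive_id r (1 : R))) _.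
  by rewrite /GRing.scale/= mulr1.
by apply/funext => y; rewrite exprfctE.
Qed.

Lemma is_derive_saw_partial N r t :
  is_derive r (1 : R) (saw_partial N ^~ t) (\sum_(k < N) r ^+ k * sin (k.+1%:R * t)).
Proof.
elim: N => [|N ih].
  rewrite big_ord0 (_ : saw_partial 0 ^~ t = cst 0); first exact: is_derive_cst.
  by apply/funext => y; rewrite /saw_partial big_ord0.
rewrite big_ord_recr/= (_ : saw_partial N.+1 ^~ t =
    saw_partial N ^~ t + (fun r => (sin (N.+1%:R * t) / N.+1%:R) * r ^+ N.+1)); last first.
  by apply/funext => y; rewrite /saw_partial big_ord_recr/= [X in _ + X]mulrC.
apply: is_deriveD => //.
apply: is_derive_eq (is_deriveZ (sin (N.+1%:R * t) / N.+1%:R) (is_derive_exprS N r)) _.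
by rewrite /GRing.scale/= mulrA divfK ?pnatr_eq0// mulrC.
Qed.

(** Imaginary part of the finite geometric sum of r^k e^(i(k+1)t). The induction stays real by means
    of sin ((N+2) t) = 2 cos t sin ((N+1) t) - sin (N t). *)
Lemma saw_derivative_remainder N r t : 0 <= r -> r < 1 ->
  sin t / (1 - 2 * r * cos t + r ^+ 2) - \sum_(k < N) r ^+ k * sin (k.+1%:R * t) =
  r ^+ N * (sin (N.+1%:R * t) - r * sin (N%:R * t)) / (1 - 2 * r * cos t + r ^+ 2).
Proof.
move=> r0 r1; set Q := 1 - 2 * r * cos t + r ^+ 2.
have Qn : Q != 0.
  by rewrite gt_eqF// (lt_le_trans _ (saw_denom_ge t r0))// exprn_gt0// subr_gt0.
elim: N => [|N ih].
  by rewrite big_ord0 subr0 expr0 !mul1r mul0r sin0 mulr0 subr0.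
rewrite big_ord_recr/= opprD addrA ih.
have s2 : sin (N.+2%:R * t) = 2 * cos t * sin (N.+1%:R * t) - sin (N%:R * t).
  have -> : N.+2%:R * t = N.+1%:R * t + t by rewrite -natr1 mulrDl mul1r.
  have -> : N%:R * t = N.+1%:R * t - t by rewrite -natr1 mulrDl mul1r addrK.
  by rewrite sinD sinB; ring.
apply: (mulIf Qn); by rewrite mulrBl !divfK// s2 /Q (exprS r N); ring.
Qed.

(** Both functions vanish at r = 0, so the mean value theorem in the variable r reduces the claim to
    the remainder of the derivative, whose numerator is at most 2 r^N and whose denominator is at
    least (1 - r)^2. The bound is uniform in t. *)
Lemma saw_partial_approx N r t : 0 <= r -> r < 1 ->
  `|saw r t - saw_partial N r t| <= 2 / (1 - r) ^+ 2 * r ^+ N.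
Proof.
move=> r0 r1.
have r1p : 0 < (1 - r) ^+ 2 by rewrite exprn_gt0// subr_gt0.
pose D (s : R) := saw s t - saw_partial N s t.
have dD (s : R) : 0 <= s -> s <= r -> is_derive s (1 : R) D
    (s ^+ N * (sin (N.+1%:R * t) - s * sin (N%:R * t)) / (1 - 2 * s * cos t + s ^+ 2)).
  move=> s0 sr; have s1 := le_lt_trans sr r1.
  rewrite -saw_derivative_remainder//.
  by apply: is_deriveB; [exact: is_derive_saw|exact: is_derive_saw_partial].
have [||c] := @MVT_segment R D (fun s => s ^+ N * (sin (N.+1%:R * t) - s * sin (N%:R * t)) /
   (1 - 2 * s * cos t + s ^+ 2)) 0 r r0.
- by move=> s; rewrite in_itv/= => /andP[c0 cr]; apply: dD; exact: ltW.
- apply: continuous_in_subspaceT => s; rewrite inE/= in_itv/= => /andP[s0 sr].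
  by apply/differentiable_continuous/derivable1_diffP; have [] := dD s s0 sr.
rewrite in_itv/= => /andP[c0 cr].
have -> : D 0 = 0.
  rewrite /D /saw mul0r mul0r atan0 sub0r /saw_partial big1 ?oppr0// => k _.
  by rewrite expr0n/= mul0r.
rewrite !subr0 -[saw r t - _]/(D r) => ->.
have c1 := le_lt_trans cr r1.
have Qc := saw_denom_ge t c0.
have Qp : 0 < 1 - 2 * c * cos t + c ^+ 2.
  by rewrite (lt_le_trans _ Qc)// exprn_gt0// subr_gt0.
have num : `|sin (N.+1%:R * t) - c * sin (N%:R * t)| <= 2.
  rewrite (le_trans (ler_normB _ _))// normrM (ger0_norm c0).
  have := sin_geN1 (N.+1%:R * t); have := sin_le1 (N.+1%:R * t).
  have := sin_geN1 (N%:R * t); have := sin_le1 (N%:R * t) => a1 a2 a3 a4.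
  have b1 : `|sin (N%:R * t)| <= 1 by rewrite ler_norml a1 a2.
  have b2 : `|sin (N.+1%:R * t)| <= 1 by rewrite ler_norml a3 a4.
  have := normr_ge0 (sin (N%:R * t)); nra.
rewrite !normrM normfV (ger0_norm (ltW Qp)) (ger0_norm r0) (ger0_norm (exprn_ge0 N c0)).
rewrite -(mulr1 (2 / _ * _)); apply: ler_pM => //; last exact: ltW.
  by rewrite mulr_ge0 ?invr_ge0 ?(ltW Qp)// mulr_ge0// exprn_ge0.
rewrite mulrAC [leRHS]mulrAC [X in _ <= X / _]mulrC -mulrA -[leRHS]mulrA.
apply: ler_pM; rewrite ?exprn_ge0 ?lerXn2r// ?nnegrE//.
  by rewrite mulr_ge0// invr_ge0 ltW.
rewrite mulrC; apply: ler_pM => //; first by rewrite invr_ge0 ltW.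
rewrite lef_pV2 ?posrE//; apply: le_trans Qc.
by rewrite lerXn2r ?nnegrE ?subr_ge0 ?(ltW r1) ?(ltW c1)// lerB.
Qed.

Lemma saw_bounded r t : `|saw r t| <= pi / 2.
Proof. by rewrite ler_norml ltW ?atan_gtNpi2// ltW// atan_ltpi2. Qed.

Lemma saw_period r t : saw r (t + 2 * pi) = saw r t.
Proof. by rewrite /saw mulr_natl sinD2pi cosD2pi. Qed.

Lemma continuous_saw r : 0 <= r -> r < 1 -> continuous (saw r).
Proof.
move=> r0 r1 t; apply: continuous_comp; last exact: continuous_atan.
apply: cvgM; first by apply: cvgM; [exact: cvg_cst|exact: continuous_sin].
apply: cvgV; first by rewrite gt_eqF// one_sub_mul_cos_gt0.
by apply: cvgB; [exact: cvg_cst|apply: cvgM; [exact: cvg_cst|exact: continuous_cos]].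
Qed.

(** A sequence of radii tending to 1, because dominated convergence is applied to sequences. *)
Definition radius (j : nat) : R := 1 - j.+1%:R^-1.

Lemma radius_ge0 j : 0 <= radius j.
Proof. by rewrite subr_ge0 invf_le1// ler1n. Qed.

Lemma radius_lt1 j : radius j < 1.
Proof. by rewrite ltrBlDr ltrDl invr_gt0. Qed.

Lemma cvg_radius : radius j @[j --> \oo] --> (1 : R).
Proof.
rewrite -[X in _ --> X]subr0; apply: cvgB; first exact: cvg_cst.
exact: cvg_harmonic.
Qed.

Lemma cvg_saw t : 0 < t -> t < 2 * pi ->
  saw (radius j) t @[j --> \oo] --> (pi - t) / 2.
Proof.
move=> t0 t2.
have sp : 0 < sin (t / 2) by apply: sin_gt0_pi; apply/andP; lra.
have e2 : t = t / 2 + t / 2 by rewrite -splitr.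
have cE : 1 - cos t = 2 * sin (t / 2) ^+ 2.
  by rewrite {1}e2 cosD -!expr2 sin2cos2; ring.
have sE : sin t = 2 * sin (t / 2) * cos (t / 2) by rewrite {1}e2 sinD; ring.
have c0 : 1 - cos t != 0 by rewrite cE mulf_neq0// expf_neq0// gt_eqF.
(* At r = 1 the quotient is cot (t / 2) = tan ((pi - t) / 2), and (pi - t) / 2 lies strictly between
   -pi / 2 and pi / 2, where [atan] inverts [tan]. *)
have -> : (pi - t) / 2 = atan (1 * sin t / (1 - 1 * cos t)).
  have -> : 1 * sin t / (1 - 1 * cos t) = tan ((pi - t) / 2).
    rewrite !mul1r cE sE /tan mulrBl sinB cosB sin_pihalf cos_pihalf.
    by field; rewrite gt_eqF.
  by rewrite tanK// in_itv/=; apply/andP; lra.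
apply: continuous_cvg; first exact: continuous_atan.
apply: cvgM; first by apply: cvgM; [exact: cvg_radius|exact: cvg_cst].
apply: cvgV; first by rewrite mul1r.
by apply: cvgB; [exact: cvg_cst|apply: cvgM; [exact: cvg_radius|exact: cvg_cst]].
Qed.

Lemma cvg_saw_neg t : - (2 * pi) < t -> t < 0 ->
  saw (radius j) t @[j --> \oo] --> (- pi - t) / 2.
Proof.
move=> t2 t0; have -> : (- pi - t) / 2 = (pi - (t + 2 * pi)) / 2 by field.
under eq_cvg do rewrite -saw_period.
by apply: cvg_saw; lra.
Qed.

End Sawtooth.

(** * Uniqueness theorem for Fourier coefficients *)

Section FourierUniqueness.
Variable R : realType.
Implicit Types (f g h w : R -> R[i]) (p : R -> R) (n : int) (r t x : R).

Local Notation mu := (@lebesgue_measure R).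
Local Notation angles := (@angles R).
Let mA := @measurable_angles R.
Local Hint Resolve mA : core.

Lemma Re_realM (c : R) (z : R[i]) : Re (c%:C * z) = c * Re z.
Proof. by rewrite ReM/= mul0r subr0. Qed.

Lemma Im_realM (c : R) (z : R[i]) : Im (c%:C * z) = c * Im z.
Proof. by rewrite ImM/= mul0r addr0. Qed.

Lemma sin_fexp (m : nat) x t : (sin (m%:R * (t - x)))%:C =
  ((0 -i* 2^-1) * cis (- (m%:R * x))) * fexp m t +
  ((0 +i* 2^-1) * cis (m%:R * x)) * fexp (- (m%:Z)) t :> R[i].
Proof.
rewrite -!mulrA.
have -> : cis (- (m%:R * x)) * fexp m t = cis (m%:R * (t - x)).
  by rewrite /fexp -cisD mulrBr addrC.
have -> : cis (m%:R * x) * fexp (- (m%:Z)) t = (cis (m%:R * (t - x)))^*.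
  by rewrite /fexp -cisD -cisN mulrNz mulrBr opprB mulNr.
rewrite /cis; set y := m%:R * (t - x).
by simpc; congr (_ +i* _); field.
Qed.

(** Partial sums of the sawtooth series are finite combinations of characters, so f is orthogonal to
    them. They converge uniformly in t for fixed r < 1, which is enough against an integrable f. *)
Lemma circle_mean_saw f r x : L1 f -> 0 <= r -> r < 1 ->
  (forall n, circle_mean (fun t => f t * fexp n t) = 0) ->
  circle_mean (fun t => f t * (saw r (t - x))%:C) = 0.
Proof.
move=> lf r0 r1 f0.
have lfe c n : L1 (fun t => c * (f t * fexp n t)).
  apply: L1Z; under eq_fun do rewrite mulrC.
  apply: (L1Mr_bounded (k := 1)) => //; first exact: circle_measurable_fexp.
  by move=> t _; rewrite modulus_fexp.
have fsin (m : nat) : L1 (fun t => f t * (sin (m%:R * (t - x)))%:C) /\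
    circle_mean (fun t => f t * (sin (m%:R * (t - x)))%:C) = 0.
  pose a := (0 -i* 2^-1) * cis (- (m%:R * x)).
  pose b := (0 +i* 2^-1) * cis (m%:R * x).
  rewrite (_ : (fun t => _) = (fun t => a * (f t * fexp m t) + b * (f t * fexp (- (m%:Z)) t))).
    split; first by apply: L1D; exact: lfe.
    have lfe1 n : L1 (fun t => f t * fexp n t).
      by have := lfe 1 n; under eq_fun do rewrite mul1r.
    rewrite circle_meanD; [|exact: lfe..].
    by rewrite !circle_meanZ// !f0 !mulr0 addr0.
  by apply/funext => t; rewrite sin_fexp mulrDr; congr (_ + _); rewrite mulrCA.
have fpart N : L1 (fun t => f t * (saw_partial N r (t - x))%:C) /\
    circle_mean (fun t => f t * (saw_partial N r (t - x))%:C) = 0.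
  pose c (k : 'I_N) := (r ^+ k.+1 / k.+1%:R)%:C.
  rewrite (_ : (fun t => _) = (fun t => \sum_(k < N) c k * (f t * (sin (k.+1%:R * (t - x)))%:C))).
    split; first by apply: L1_sum => k; apply: L1Z; exact: (fsin k.+1).1.
    rewrite circle_mean_sum; last by move=> k; apply: L1Z; exact: (fsin k.+1).1.
    rewrite big1// => k _; rewrite circle_meanZ; last exact: (fsin k.+1).1.
    by rewrite (fsin k.+1).2 mulr0.
  apply/funext => t; rewrite /saw_partial rmorph_sum/= mulr_sumr.
  apply: eq_bigr => k _; rewrite [RHS]mulrCA; congr (_ * _).
  by rewrite /c -realCM; congr (_%:C); rewrite mulrA mulrAC.
have msaw : circle_measurable (fun t => (saw r (t - x))%:C).
  split => /=; last exact: measurable_cst.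
  apply: measurable_funTS; apply: continuous_measurable_fun => t.
  apply: continuous_comp; last exact: continuous_saw.
  by apply: cvgB; [exact: cvg_id|exact: cvg_cst].
have lsaw : L1 (fun t => f t * (saw r (t - x))%:C).
  under eq_fun do rewrite mulrC.
  apply: (L1Mr_bounded (k := pi / 2)) => // t _.
  by rewrite modulus_real saw_bounded.
set C := 2 / (1 - r) ^+ 2.
pose m := Re (circle_mean (fun t => (modulus (f t))%:C)).
have key N : modulus (circle_mean (fun t => f t * (saw r (t - x))%:C)) <= (C * m) * r ^+ N.
  have -> : circle_mean (fun t => f t * (saw r (t - x))%:C) =
      circle_mean (fun t => f t * (saw r (t - x))%:C - f t * (saw_partial N r (t - x))%:C).
    by rewrite circle_meanB ?(fpart N).2 ?subr0//; exact: (fpart N).1.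
  have im := integrableZl mA (C * r ^+ N) (integrable_modulus lf).
  apply: le_trans (@modulus_circle_mean_le _ _ (fun t => C * r ^+ N * modulus (f t)) _ im _) _.
  - by apply: L1B => //; exact: (fpart N).1.
  - move=> t _; rewrite -mulrBr modulusM mulrC -realCB modulus_real.
    by rewrite ler_wpM2r ?modulus_ge0// saw_partial_approx.
  under [X in circle_mean X]eq_fun do rewrite realCM.
  rewrite circle_meanZ; last first.
    by split; [exact: integrable_modulus|exact: integrable_cst_angles].
  by rewrite Re_realM -/m mulrAC.
apply: modulus0_eq0; apply/eqP; rewrite eq_le modulus_ge0 andbT.
have cr : (C * m) * r ^+ N @[N --> \oo] --> (0 : R).
  by apply: cvg_geometric; rewrite ger0_norm.
by apply: (cvgr_to_ge cr); exact: nearW.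
Qed.

(* (saw (t - x) - saw t - x / 2) tends boundedly to - pi on [0, x[ and to 0 on
   ]x, 2 pi]. *)
Lemma Rintegral_prefix_eq0 p x : mu.-integrable angles (EFin \o p) ->
  \int[mu]_(t in angles) p t = 0 ->
  (forall r y, 0 <= r -> r < 1 -> \int[mu]_(t in angles) (p t * saw r (t - y)) = 0) ->
  0 < x -> x < 2 * pi -> \int[mu]_(t in `[0, x]) p t = 0.
Proof.
move=> ip p0 ps x0 x2.
have mp : measurable_fun angles p by move: ip => /measurable_int/measurable_EFinP.
pose B j t := saw (radius R j) (t - x) - saw (radius R j) t - x / 2.
have msaw j y : measurable_fun angles (fun t => saw (radius R j) (t - y)).
  apply: measurable_funTS; apply: continuous_measurable_fun => t.
  apply: continuous_comp; first by apply: cvgB; [exact: cvg_id|exact: cvg_cst].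
  by apply: continuous_saw; [exact: radius_ge0|exact: radius_lt1].
have msaw0 j : measurable_fun angles (saw (radius R j)).
  by have := msaw j 0; under eq_fun do rewrite subr0.
have mB j : measurable_fun angles (B j).
  by apply: measurable_funB => //; apply: measurable_funB => //; exact: msaw.
have ips j y : mu.-integrable angles (EFin \o (fun t => p t * saw (radius R j) (t - y))).
  have iq := integrableZl mA (pi / 2) (integrable_norm ip).
  apply: le_integrable iq => //.
    by apply/measurable_EFinP; apply: measurable_funM => //; exact: msaw.
  move=> t _; rewrite /= lee_fin normrM [leRHS]normrM normr_id mulrC ler_wpM2r//.
  by rewrite (le_trans (saw_bounded _ _))// ler_norm.
(* The constant x / 2 in [B] contributes nothing because p has integral 0. *)
have pB j : \int[mu]_(t in angles) (p t * B j t) = 0.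
  transitivity (\int[mu]_(t in angles)
     (p t * saw (radius R j) (t - x) - p t * saw (radius R j) (t - 0) - (x / 2) * p t)).
    by apply: eq_Rintegral => t _; rewrite /B subr0; ring.
  have ixp := integrableZl mA (x / 2) ip.
  have ii := integrableB mA (ips j x) (ips j 0).
  rewrite RintegralB// RintegralB// RintegralZl// p0 mulr0.
  by rewrite !ps ?radius_ge0 ?radius_lt1// !subr0.
pose G t := - pi * (\1_`[0, x] t : R).
have mG : measurable_fun angles G.
  apply: measurable_funM => //; apply: measurable_indic; exact: measurable_itv.
have BG t : angles t -> t != 0 -> t != x -> t != 2 * pi ->
    B j t @[j --> \oo] --> G t.
  rewrite /angles/= in_itv/= => /andP[t0 t2] tn0 tnx tn2.
  have tp : 0 < t by rewrite lt_neqAle eq_sym tn0.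
  have tl : t < 2 * pi by rewrite lt_neqAle tn2.
  have c0 := cvg_saw tp tl.
  rewrite /G indicE; have [tx|tx|tx] := ltgtP t x; last by rewrite tx eqxx in tnx.
    rewrite mem_set/=; last by rewrite in_itv/= (ltW tp) (ltW tx).
    have -> : - pi * 1%:R = (- pi - (t - x)) / 2 - (pi - t) / 2 - x / 2 by field.
    apply: cvgB; last exact: cvg_cst.
    by apply: cvgB => //; apply: cvg_saw_neg; lra.
  rewrite memNset/=; last by rewrite in_itv/= (ltW tp) /= leNgt tx.
  have -> : - pi * 0%:R = (pi - (t - x)) / 2 - (pi - t) / 2 - x / 2 by field.
  apply: cvgB; last exact: cvg_cst.
  by apply: cvgB => //; apply: cvg_saw; lra.
have Bb j t : `|B j t| <= 2 * pi.
  have := saw_bounded (radius R j) (t - x); have := saw_bounded (radius R j) t.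
  rewrite !ler_norml /B => /andP[a1 a2] /andP[b1 b2]; apply/andP; lra.
have mfB j : measurable_fun angles (fun t => (p t * B j t)%:E).
  by apply/measurable_EFinP; apply: measurable_funM => //; exact: mB.
have mfG : measurable_fun angles (fun t => (p t * G t)%:E).
  by apply/measurable_EFinP; exact: measurable_funM.
have iq : mu.-integrable angles (fun t => (2 * pi * `|p t|)%:E).
  by have := integrableZl mA (2 * pi) (integrable_norm ip).
have aeG : {ae mu, forall t, angles t -> (p t * B j t)%:E @[j --> \oo] --> (p t * G t)%:E}.
  (* These are the points at which one of the two sawtooth functions jumps. *)
  exists [set 0; x; 2 * pi]; split.
  - by do 2!apply: measurableU => //.
  - by apply: countable_lebesgue_measure0; apply: finite_set_countable.
  move=> t /= H; apply: contrapT => tn; apply: H => at_.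
  apply/fine_cvgP; split; first exact: nearW.
  apply: cvgM; first exact: cvg_cst.
  by apply: BG => //; apply/eqP => te; apply: tn; rewrite te; [left; left|left; right|right].
have aeb : {ae mu, forall t (k : nat), angles t -> (`|(p t * B k t)%:E| <= (2 * pi * `|p t|)%:E)%E}.
  by apply: aeW => t j _; rewrite lee_fin normrM mulrC ler_wpM2r.
have [ipG _] := dominated_convergence mA mfB mfG aeG iq aeb.
have ipB j : mu.-integrable angles (fun t => (p t * B j t)%:E).
  apply: le_integrable iq => //; first exact: mfB.
  move=> t _; rewrite lee_fin normrM mulrC.
  by rewrite (le_trans _ (ler_norm _))// ler_wpM2r.
rewrite (_ : [sequence _]_n = fun=> 0%E); last first.
  apply/funext => j /=; rewrite -[LHS]fineK; last exact: integrable_fin_num.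
  by congr (_%:E); exact: pB.
move=> /(cvg_unique (@ereal_hausdorff R) (cvg_cst _)) pG0.
have : \int[mu]_(t in angles) (p t * G t) = 0 by rewrite /Rintegral -pG0.
have ip1 : mu.-integrable angles (EFin \o (fun t => p t * \1_`[0, x] t)).
  apply: le_integrable ip => //.
    by apply/measurable_EFinP; apply: measurable_funM => //; apply: measurable_indic; exact: measurable_itv.
  move=> t _; rewrite /= lee_fin normrM indicE.
  by case: (_ \in _); rewrite ?normr1 ?mulr1// normr0 mulr0.
under eq_Rintegral do rewrite /G mulrCA.
rewrite RintegralZl// => /eqP; rewrite mulf_eq0 oppr_eq0 (gt_eqF (pi_gt0 R))/= => /eqP e0.
rewrite -[RHS]e0.
rewrite [LHS](_ : _ = \int[mu]_(t in angles `&` `[0, x]) p t).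
  rewrite Rintegral_mkcondr; apply: eq_Rintegral => t _; rewrite patchE indicE.
  by case: (_ \in _); rewrite ?mulr1 ?mulr0.
congr (Rintegral _ _ _); apply/seteqP; split => t; rewrite /angles/= !in_itv/=.
  by move=> /andP[s0 tx]; rewrite s0 tx (le_trans tx (ltW x2)).
by case.
Qed.

(** By Lebesgue differentiation the primitive of p, extended by 0, has derivative p almost
    everywhere; but this primitive is constant on the open interval. *)
Lemma ae_eq0_of_prefix p : mu.-integrable angles (EFin \o p) ->
  (forall x, 0 < x -> x < 2 * pi -> \int[mu]_(t in `[0, x]) p t = 0) ->
  {ae mu, forall t, angles t -> p t = 0}.
Proof.
move=> ip p0; pose q := p \_ angles.
have iq : mu.-integrable setT (EFin \o q).
  rewrite -restrict_EFin; have [H _] := @integrable_mkcond _ _ _ mu _ (EFin \o p) mA.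
  exact: H.
have lq : locally_integrable setT q by apply: open_integrable_locally => //; exact: openT.
have iqy (y : R) : mu.-integrable [set` Interval (BLeft 0) (BRight y)] (EFin \o q).
  by apply: integrableS iq => //; exact: measurable_itv.
have := FTC1 iqy lq; set F := fun y => _ => H.
(* The endpoints are discarded because the primitive is known to vanish near t only for interior
   t. *)
have aen : {ae mu, forall t, t != 0 /\ t != 2 * pi}.
  exists [set 0; 2 * pi]; split.
  - by apply: measurableU.
  - by apply: countable_lebesgue_measure0; apply: finite_set_countable.
  move=> t /= tn; apply: contrapT => tn'; apply: tn.
  by split; apply/eqP => te; apply: tn'; rewrite te; [left|right].
apply: ae_imp2 H aen => t Ft [t0 t2] at_.
have := at_; rewrite /angles/= in_itv/= => /andP[t0' t2'].
have tp : 0 < t by rewrite lt_neqAle eq_sym t0.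
have tl : t < 2 * pi by rewrite lt_neqAle t2.
have [_] : derivable F t 1 /\ F^`()%classic t = q t by apply: Ft; rewrite /Order.lt/=.
rewrite /q patchE mem_set// => <-.
rewrite derive1E (@near_eq_derive _ _ _ _ (cst 0)) ?derive_cst//.
have : \forall y \near t, y \in `]0, 2 * pi[ by apply: near_in_itvoo; rewrite in_itv/= tp.
apply: filterS => y; rewrite in_itv/= => /andP[y0 y2].
rewrite -[RHS](p0 y y0 y2); apply: eq_Rintegral => s; rewrite inE/= in_itv/= => /andP[s0 sy].
by rewrite /q patchE mem_set// /angles/= in_itv/= s0 (le_trans sy)// ltW.
Qed.

(** The sawtooth kernels are real, so orthogonality to them passes to the real and imaginary parts
    of f separately, and the real-variable lemmas apply to each. *)
Theorem fourier_uniqueness f : L1 f ->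
  (forall n, circle_mean (fun t => f t * fexp n t) = 0) -> eq_ae f (fun=> 0).
Proof.
move=> lf f0; have [f1 f2] := lf; have tp := twopi_gt0 R.
have rint0 (q : R[i] -> R) r y : 0 <= r -> r < 1 ->
    Re (circle_mean (fun t => f t * (saw r (t - y))%:C)) = 0 /\
    Im (circle_mean (fun t => f t * (saw r (t - y))%:C)) = 0.
  by move=> r0 r1; rewrite circle_mean_saw.
have m0 : circle_mean f = 0.
  by rewrite -(f0 0); congr circle_mean; apply/funext => t; rewrite fexp_nat expr0 mulr1.
have tpn : (2 * pi)^-1 != 0 :> R by rewrite invr_eq0 gt_eqF.
have re0 : {ae mu, forall t, angles t -> Re (f t) = 0}.
  apply: ae_eq0_of_prefix => // x x0 x2; apply: Rintegral_prefix_eq0 => //.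
    by apply: (mulfI tpn); rewrite -Re_circle_mean m0 mulr0.
  move=> r y r0 r1; apply: (mulfI tpn).
  have <- : Re (circle_mean (fun t => f t * (saw r (t - y))%:C)) =
      (2 * pi)^-1 * \int[mu]_(t in angles) (Re (f t) * saw r (t - y)).
    rewrite Re_circle_mean; congr (_ * _); apply: eq_Rintegral => t _.
    by rewrite mulrC Re_realM mulrC.
  by rewrite circle_mean_saw// mulr0.
have im0 : {ae mu, forall t, angles t -> Im (f t) = 0}.
  apply: ae_eq0_of_prefix => // x x0 x2; apply: Rintegral_prefix_eq0 => //.
    by apply: (mulfI tpn); rewrite -Im_circle_mean m0 mulr0.
  move=> r y r0 r1; apply: (mulfI tpn).
  have <- : Im (circle_mean (fun t => f t * (saw r (t - y))%:C)) =
      (2 * pi)^-1 * \int[mu]_(t in angles) (Im (f t) * saw r (t - y)).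
    rewrite Im_circle_mean; congr (_ * _); apply: eq_Rintegral => t _.
    by rewrite mulrC Im_realM mulrC.
  by rewrite circle_mean_saw// mulr0.
by apply: ae_imp2 re0 im0 => t a b at_; apply: eq_ReIm; rewrite ?a ?b.
Qed.

End FourierUniqueness.

(** * Disc algebra and Hardy space *)

Section DiscAlgebra.
Variable R : realType.
Implicit Types (f g h w : R -> R[i]) (p q : {poly R[i]}) (n : int) (r t x : R).

(** Boundary values of the disc algebra, encoded by uniform polynomial approximation. In this form
    multiplication and the value at the centre reduce to polynomials. *)
Definition disc_alg g : Prop := forall e : R, 0 < e ->
  exists p : {poly R[i]}, forall t, modulus (g t - p.[cis t]) <= e.

(** Working form of [H2_plus]. [Negz k] is -(k+1), so k runs through all negative frequencies. *)
Definition hardy f : Prop := L2 f /\ forall k, inner2 f (fexp (Negz k)) = 0.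

Lemma modulus_sum (I : Type) (s : seq I) (F : I -> R[i]) :
  modulus (\sum_(i <- s) F i) <= \sum_(i <- s) modulus (F i).
Proof.
elim/big_rec2: _ => [|i x y _ h]; first by rewrite modulus0.
by rewrite (le_trans (modulusD _ _))// lerD2l.
Qed.

Lemma modulus_horner_cis p t : modulus p.[cis t] <= \sum_(i < size p) modulus p`_i.
Proof.
rewrite horner_coef (le_trans (modulus_sum _ _))// ler_sum// => i _.
by rewrite modulusM modulusX modulus_cis expr1n mulr1.
Qed.

Lemma disc_alg_poly p : disc_alg (fun t => p.[cis t]).
Proof. by move=> e e0; exists p => t; rewrite subrr modulus0 ltW. Qed.

Lemma eq_disc_alg g h : g =1 h -> disc_alg g -> disc_alg h.
Proof. by move=> /funext ->. Qed.

Lemma disc_alg_cst (c : R[i]) : disc_alg (fun=> c).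
Proof. by apply: eq_disc_alg (disc_alg_poly c%:P) => t; rewrite hornerC. Qed.

Lemma disc_alg_bounded g : disc_alg g -> exists2 k : R, 0 <= k & forall t, modulus (g t) <= k.
Proof.
move=> /(_ 1 ltr01)[p pg]; exists (1 + \sum_(i < size p) modulus p`_i).
  by rewrite addr_ge0// sumr_ge0// => i _; exact: modulus_ge0.
move=> t; rewrite -(subrK p.[cis t] (g t)) (le_trans (modulusD _ _))// lerD//.
exact: modulus_horner_cis.
Qed.

Lemma disc_algD g h : disc_alg g -> disc_alg h -> disc_alg (fun t => g t + h t).
Proof.
move=> dg dh e e0; have e2 : 0 < e / 2 by rewrite divr_gt0.
have [p pg] := dg _ e2; have [q qh] := dh _ e2; exists (p + q) => t.
by rewrite hornerD opprD addrACA (le_trans (modulusD _ _))// [leRHS]splitr lerD.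
Qed.

Lemma disc_algM g h : disc_alg g -> disc_alg h -> disc_alg (fun t => g t * h t).
Proof.
move=> dg dh e e0.
have [k k0 gk] := disc_alg_bounded dg; have [l l0 hl] := disc_alg_bounded dh.
have ek : 0 < e / (2 * (k + 1)) by rewrite divr_gt0// mulr_gt0// ltr_wpDl.
have [q qh] := dh _ ek.
pose m := \sum_(i < size q) modulus q`_i.
have m0 : 0 <= m by apply: sumr_ge0 => i _; exact: modulus_ge0.
(* The approximant of g is chosen after q, because its error gets multiplied by the coefficient
   bound m of q. *)
have em : 0 < e / (2 * (m + 1)) by rewrite divr_gt0// mulr_gt0// ltr_wpDl.
have [p pg] := dg _ em; exists (p * q) => t.
rewrite hornerM (_ : _ - _ = g t * (h t - q.[cis t]) + (g t - p.[cis t]) * q.[cis t]); last by ring.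
rewrite (le_trans (modulusD _ _))// !modulusM [leRHS]splitr lerD//.
  apply: (@le_trans _ _ (k * (e / (2 * (k + 1))))).
    by apply: ler_pM; rewrite ?modulus_ge0.
  rewrite mulrA ler_pdivrMr ?mulr_gt0 ?ltr_wpDl//.
  have : 0 <= e * k by rewrite mulr_ge0// ltW.
  by lra.
apply: (@le_trans _ _ (e / (2 * (m + 1)) * m)).
  by apply: ler_pM; rewrite ?modulus_ge0// modulus_horner_cis.
rewrite mulrAC ler_pdivrMr ?mulr_gt0 ?ltr_wpDl//.
have : 0 <= e * m by rewrite mulr_ge0// ltW.
by lra.
Qed.

Lemma disc_algX g m : disc_alg g -> disc_alg (fun t => g t ^+ m).
Proof.
move=> dg; elim: m => [|m ih]; first by apply: eq_disc_alg (disc_alg_cst 1).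
apply: (@eq_disc_alg (fun t => g t * g t ^+ m)); last exact: disc_algM.
by move=> t; rewrite exprS.
Qed.

Lemma disc_algZ c g : disc_alg g -> disc_alg (fun t => c * g t).
Proof. by apply: disc_algM; exact: disc_alg_cst. Qed.

Lemma disc_alg_uniform_limit g :
  (forall e : R, 0 < e -> exists2 h, disc_alg h & forall t, modulus (g t - h t) <= e) -> disc_alg g.
Proof.
move=> gh e e0; have e2 : 0 < e / 2 by rewrite divr_gt0.
have [h dh hg] := gh _ e2; have [p ph] := dh _ e2; exists p => t.
rewrite -(subrK (h t) (g t)) -addrA (le_trans (modulusD _ _))// [leRHS]splitr lerD//.
Qed.

Lemma horner_cisE p t : p.[cis t] = \sum_(i < size p) p`_i * fexp i t.
Proof. by rewrite horner_coef; apply: eq_bigr => i _; rewrite fexp_nat. Qed.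

Lemma L2_horner_cis p : L2 (fun t => p.[cis t]).
Proof.
under eq_fun do rewrite horner_cisE.
by apply: L2_sum => i; apply: L2Z; exact: L2_fexp.
Qed.

Lemma modulus_cvg0_ReIm (u : nat -> R[i]) (z : R[i]) (b : nat -> R) :
  (forall j, modulus (u j - z) <= b j) -> b j @[j --> \oo] --> (0 : R) ->
  Re (u j) @[j --> \oo] --> Re z /\ Im (u j) @[j --> \oo] --> Im z.
Proof.
move=> ub b0; split; apply/cvgrPdist_le => e e0;
  move/cvgrPdist_le : b0 => /(_ _ e0)[N _ hN]; exists N => // j Nj;
  rewrite distrC (le_trans _ (hN j Nj))// sub0r normrN (le_trans _ (ler_norm _))//
    (le_trans _ (ub j))//.
  by rewrite -ReN -ReD normr_Re_le.
by rewrite -ImN -ImD normr_Im_le.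
Qed.

Lemma disc_alg_measurable g : disc_alg g -> circle_measurable g.
Proof.
move=> dg; have /choice[p pP] : forall j : nat, exists p : {poly R[i]}, forall t,
    modulus (g t - p.[cis t]) <= j.+1%:R^-1.
  by move=> j; apply: dg; rewrite invr_gt0.
have c t := @modulus_cvg0_ReIm (fun j => (p j).[cis t]) (g t) _
  (fun j => eq_rect _ (fun x => x <= j.+1%:R^-1) (pP j t) _ (modulus_distC _ _)) (@cvg_harmonic R).
split.
- apply: (@measurable_fun_cvg _ _ _ _ (fun j t => Re (p j).[cis t])) => [j|t _].
    by case: (L2_measurable (L2_horner_cis (p j))).
  by case: (c t).
- apply: (@measurable_fun_cvg _ _ _ _ (fun j t => Im (p j).[cis t])) => [j|t _].
    by case: (L2_measurable (L2_horner_cis (p j))).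
  by case: (c t).
Qed.

Lemma disc_alg_L2 g : disc_alg g -> L2 g.
Proof.
move=> dg; have [k _ gk] := disc_alg_bounded dg.
by apply: (L2_bounded (k := k)) => //; exact: disc_alg_measurable.
Qed.

Lemma disc_alg_L1 g : disc_alg g -> L1 g.
Proof. by move/disc_alg_L2/L2_L1. Qed.

Lemma inner2_fexpE f n : inner2 f (fexp n) = circle_mean (fun t => f t * fexp (- n) t).
Proof. by congr circle_mean; apply/funext => t; rewrite fexpJ. Qed.

Lemma hardy1 : hardy (fun=> 1).
Proof.
split=> [|k]; first exact: L2_cst.
by rewrite inner2_fexpE -[RHS](circle_mean_fexp R (- Negz k)); under eq_fun do rewrite mul1r.
Qed.

Lemma hardy_horner p h : hardy h -> hardy (fun t => p.[cis t] * h t).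
Proof.
move=> [lh h0]; split.
  apply: (L2M_bounded (k := \sum_(i < size p) modulus p`_i)) => //.
    exact/L2_measurable/L2_horner_cis.
  by move=> t _; exact: modulus_horner_cis.
move=> k; have lhe i : L2 (fun t => fexp i t * h t).
  apply: (L2M_bounded (k := 1)) => //; first exact: circle_measurable_fexp.
  by move=> t _; rewrite modulus_fexp.
rewrite (_ : (fun t => _) = fun t => \sum_(i < size p) p`_i * (fexp i t * h t)); last first.
  by apply/funext => t; rewrite horner_cisE mulr_suml; apply: eq_bigr => i _; rewrite mulrA.
rewrite inner2_suml; last exact: L2_fexp.
  rewrite big1// => i _; rewrite inner2Zl; [|exact: lhe|exact: L2_fexp].
  (* Multiplication by the i-th power shifts frequencies up: the coefficient at -(k+1) is that of h
     at -(k+i+1), still negative. *)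
  rewrite -[RHS](mulr0 (p`_i)) -(h0 (k + i)%N); congr (_ * _).
  rewrite !inner2_fexpE; congr circle_mean; apply/funext => t.
  rewrite -mulrA mulrCA -fexpD; congr (_ * fexp _ t).
  by rewrite !NegzE !opprK -PoszD addnS addnC.
by move=> i; apply: L2Z; exact: lhe.
Qed.

(** Each Fourier coefficient is continuous in L^2 by Cauchy-Schwarz against a unit vector. *)
Lemma hardy_limit f : L2 f ->
  (forall e : R, 0 < e -> exists2 g, hardy g & nrm2 (fun t => f t - g t) <= e) -> hardy f.
Proof.
move=> lf fg; split=> // k; apply/modulus0_eq0/eqP.
rewrite -sqrf_eq0 eq_le sqr_ge0 andbT; apply/ler_addgt0Pl => e e0; rewrite addr0.
have [g [lg g0] ge] := fg e e0; have le := L2_fexp R (Negz k).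
rewrite -[inner2 f _]subr0 -(g0 k) -inner2Bl//.
rewrite (le_trans (cauchy_schwarz _ _))//; first exact: L2B.
suff -> : nrm2 (fexp (Negz k) : R -> R[i]) = 1 by rewrite mulr1.
by apply: (@complexI R); rewrite -inner2_self// inner2_fexp eqxx.
Qed.

Lemma hardy_disc_algM g h : disc_alg g -> hardy h -> hardy (fun t => g t * h t).
Proof.
move=> dg hh; have [lh h0] := hh; have [k k0 gk] := disc_alg_bounded dg.
have mg := disc_alg_measurable dg.
apply: hardy_limit => [|e e0]; first exact: (L2M_bounded (k := k)).
(* A square root, because the uniform error enters [nrm2] squared. *)
have d0 : 0 < Num.sqrt (e / (nrm2 h + 1)).
  by rewrite sqrtr_gt0 divr_gt0// ltr_wpDl ?nrm2_ge0.
have [p pg] := dg _ d0; exists (fun t => p.[cis t] * h t); first exact: hardy_horner.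
have mp := L2_measurable (L2_horner_cis p).
rewrite (_ : (fun t => _ - _) = fun t => (g t - p.[cis t]) * h t); last first.
  by apply/funext => t; rewrite mulrBl.
apply: le_trans (nrm2M_bounded lh (circle_measurableB mg mp) (fun t _ => pg t)) _.
have n1 : 0 < nrm2 h + 1 by rewrite ltr_wpDl ?nrm2_ge0.
rewrite sqr_sqrtr; last by rewrite divr_ge0// ltW.
rewrite mulrAC ler_pdivrMr// ler_wpM2l ?(ltW e0)// lerDl//.
Qed.

Lemma disc_alg_hardy g : disc_alg g -> hardy g.
Proof. by move=> /hardy_disc_algM /(_ hardy1); under eq_fun do rewrite mulr1. Qed.

Lemma circle_mean_horner p : circle_mean (fun t => p.[cis t]) = p.[0].
Proof.
rewrite horner_coef0 (_ : (fun t => _) = fun t => \sum_(i < size p) p`_i * fexp i t); last first.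
  by apply/funext => t; rewrite horner_cisE.
have le i : L1 (fexp i : R -> R[i]) by apply: L2_L1; exact: L2_fexp.
rewrite circle_mean_sum; last by move=> i; exact: L1Z.
under eq_bigr do rewrite circle_meanZ// circle_mean_fexp.
have [->|p0] := eqVneq p 0; first by rewrite size_poly0 big_ord0 coef0.
have sp : (0 < size p)%N by rewrite size_poly_gt0.
rewrite (bigD1 (Ordinal sp))//= mulr1 big1 ?addr0// => i i0.
by rewrite eqz_nat (negbTE i0 : (i == 0 :> nat) = false) mulr0.
Qed.

Lemma circle_mean_dist g h (e : R) : L1 g -> L1 h -> (forall t, modulus (g t - h t) <= e) ->
  modulus (circle_mean g - circle_mean h) <= e.
Proof.
move=> lg lh gh; rewrite -circle_meanB//.
by apply: modulus_circle_mean_bounded => //; exact: L1B.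
Qed.

Lemma modulus_le_eps (z : R[i]) : (forall e : R, 0 < e -> modulus z <= e) -> z = 0.
Proof.
move=> ze; apply/modulus0_eq0/eqP; rewrite eq_le modulus_ge0 andbT.
by apply/ler_addgt0Pl => e e0; rewrite addr0; exact: ze.
Qed.

(** The mean of an analytic polynomial is its value at 0, which is multiplicative. Only h is
    approximated here; the other factor follows in [circle_meanM]. *)
Lemma circle_mean_hornerM p h : disc_alg h ->
  circle_mean (fun t => p.[cis t] * h t) = p.[0] * circle_mean h.
Proof.
move=> dh; apply/eqP; rewrite -subr_eq0; apply/eqP/modulus_le_eps => e e0.
pose m := \sum_(i < size p) modulus p`_i.
have m0 : 0 <= m by apply: sumr_ge0 => i _; exact: modulus_ge0.
pose M := m + modulus p.[0] + 1.
have M0 : 0 < M by rewrite ltr_wpDl ?addr_ge0 ?modulus_ge0.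
have [q qh] := dh _ (divr_gt0 e0 M0).
have -> : circle_mean (fun t => p.[cis t] * h t) - p.[0] * circle_mean h =
  (circle_mean (fun t => p.[cis t] * h t) - circle_mean (fun t => (p * q).[cis t])) -
  p.[0] * (circle_mean h - circle_mean (fun t => q.[cis t])).
  by rewrite !circle_mean_horner hornerM; ring.
have a1 : modulus (circle_mean (fun t => p.[cis t] * h t) -
    circle_mean (fun t => (p * q).[cis t])) <= m * (e / M).
  apply: circle_mean_dist => [||t].
  - exact/disc_alg_L1/disc_algM/dh/disc_alg_poly.
  - exact/disc_alg_L1/disc_alg_poly.
  - rewrite hornerM -mulrBr modulusM; apply: ler_pM; rewrite ?modulus_ge0//.
    exact: modulus_horner_cis.
have a2 : modulus (circle_mean h - circle_mean (fun t => q.[cis t])) <= e / M.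
  by apply: circle_mean_dist => //; [exact: disc_alg_L1|exact/disc_alg_L1/disc_alg_poly].
rewrite (le_trans (modulusB _ _))// modulusM.
apply: le_trans (lerD a1 (ler_wpM2l (modulus_ge0 _) a2)) _.
rewrite -mulrDl mulrA ler_pdivrMr// mulrC ler_wpM2l ?(ltW e0)// /M.
by rewrite lerDl.
Qed.

Lemma circle_meanM g h : disc_alg g -> disc_alg h ->
  circle_mean (fun t => g t * h t) = circle_mean g * circle_mean h.
Proof.
move=> dg dh; apply/eqP; rewrite -subr_eq0; apply/eqP/modulus_le_eps => e e0.
have [k k0 hk] := disc_alg_bounded dh.
pose M := k + modulus (circle_mean h) + 1.
have M0 : 0 < M by rewrite ltr_wpDl ?addr_ge0 ?modulus_ge0.
have [p pg] := dg _ (divr_gt0 e0 M0).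
have -> : circle_mean (fun t => g t * h t) - circle_mean g * circle_mean h =
  (circle_mean (fun t => g t * h t) - circle_mean (fun t => p.[cis t] * h t)) -
  (circle_mean g - circle_mean (fun t => p.[cis t])) * circle_mean h.
  by rewrite circle_mean_hornerM// circle_mean_horner; ring.
have a1 : modulus (circle_mean (fun t => g t * h t) -
    circle_mean (fun t => p.[cis t] * h t)) <= (e / M) * k.
  apply: circle_mean_dist => [||t].
  - exact/disc_alg_L1/disc_algM.
  - exact/disc_alg_L1/disc_algM/dh/disc_alg_poly.
  - by rewrite -mulrBl modulusM; apply: ler_pM; rewrite ?modulus_ge0.
have a2 : modulus (circle_mean g - circle_mean (fun t => p.[cis t])) <= e / M.
  by apply: circle_mean_dist => //; [exact: disc_alg_L1|exact/disc_alg_L1/disc_alg_poly].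
rewrite (le_trans (modulusB _ _))// modulusM.
apply: le_trans (lerD a1 (ler_wpM2r (modulus_ge0 _) a2)) _.
rewrite -mulrDr mulrAC ler_pdivrMr// ler_wpM2l ?(ltW e0)// /M.
by rewrite lerDl.
Qed.

Lemma circle_meanX g m : disc_alg g ->
  circle_mean (fun t => g t ^+ m) = circle_mean g ^+ m.
Proof.
move=> dg; elim: m => [|m ih].
  by rewrite expr0 -[RHS](circle_mean_cst 1); under eq_fun do rewrite expr0.
rewrite exprS -ih -circle_meanM//; last exact: disc_algX.
by under [in LHS]eq_fun do rewrite exprS.
Qed.

End DiscAlgebra.

(** * The complex exponential as a uniform limit of Euler powers *)

Section ComplexExponential.
Variable R : realType.
Implicit Types (x y : R) (z w a b : R[i]) (g : R -> R[i]).

Lemma cexpD z w : cexp (z + w) = cexp z * cexp w.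
Proof. by rewrite /cexp ReD ImD expRD cisD realCM mulrACA. Qed.

Lemma cexp0 : cexp (0 : R[i]) = 1.
Proof. by rewrite /cexp expR0 cis0 mulr1. Qed.

Lemma cexpX z m : cexp z ^+ m = cexp (m%:R * z).
Proof.
elim: m => [|m ih]; first by rewrite mul0r cexp0.
by rewrite exprS ih -cexpD -natr1 mulrDl mul1r addrC.
Qed.

Lemma modulus_cexp z : modulus (cexp z) = expR (Re z).
Proof. by rewrite modulusM modulus_cis mulr1 modulus_real ger0_norm// expR_ge0. Qed.

Lemma normr_sin_le y : `|sin y| <= `|y|.
Proof.
wlog y0 : y / 0 <= y => [h|].
  have [y0|y0] := leP 0 y; first exact: h.
  by rewrite -normrN -sinN -[leRHS]normrN h// oppr_ge0 ltW.
have [|c _] := @MVT_segment R sin cos 0 y y0.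
  by apply: continuous_subspaceT; exact: continuous_sin.
rewrite sin0 !subr0 => ->; rewrite normrM ler_piMl// ler_norml cos_le1.
by rewrite cos_geN1.
Qed.

Lemma one_sub_cos_le y : 0 <= 1 - cos y <= y ^+ 2 / 2.
Proof.
have e : 1 - cos y = 2 * sin (y / 2) ^+ 2.
  by rewrite {1}[y]splitr cosD -!expr2 sin2cos2; ring.
have := normr_sin_le (y / 2); rewrite -ler_sqr ?nnegrE// !real_normK ?num_real// => h.
by rewrite e; apply/andP; split; [rewrite mulr_ge0// sqr_ge0|lra].
Qed.

Lemma sin_sub_le y : `|y| <= 1 -> `|sin y - y| <= y ^+ 2.
Proof.
wlog y0 : y / 0 <= y => [h|].
  have [y0|y0] := leP 0 y; first exact: h.
  have := h (- y); rewrite sinN sqrrN normrN oppr_ge0 opprK => /(_ (ltW y0)).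
  by move=> h' y1; rewrite -[sin y - y]opprB normrN addrC h'.
rewrite ger0_norm// => y1.
have [|c] := @MVT_segment R sin cos 0 y y0.
  by apply: continuous_subspaceT; exact: continuous_sin.
rewrite in_itv/= => /andP[c0 cy]; rewrite sin0 !subr0 => ->.
have /andP[a1 a2] := one_sub_cos_le c.
rewrite -[X in _ - X]mul1r -mulrBl -normrN -mulNr opprB normrM (ger0_norm a1) (ger0_norm y0).
by nra.
Qed.

Lemma expR_approx x : `|x| <= 2^-1 -> `|expR x - 1 - x| <= 2 * x ^+ 2.
Proof.
rewrite ler_norml => /andP[x1 x2]; have h1 := expR_ge1Dx x; have h2 := expR_ge1Dx (- x).
rewrite ger0_norm; last by lra.
have e : expR x * expR (- x) = 1 by rewrite -expRD subrr expR0.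
have ex := expR_gt0 x.
have : expR x * (1 - x) <= 1 by rewrite -[leRHS]e ler_wpM2l// (ltW ex).
nra.
Qed.

(** Second-order bounds for [expR], [cos] and [sin] are combined by coordinates; the constant 10 is
    generous. *)
Lemma cexp_approx z : modulus z <= 2^-1 ->
  modulus (cexp z - 1 - z) <= 10 * modulus z ^+ 2.
Proof.
move=> z2; have rz := le_trans (normr_Re_le z) z2; have iz := le_trans (normr_Im_le z) z2.
rewrite (le_trans (modulus_le _))// sqr_modulus.
have e1 := expR_approx rz; have /andP[c1 c2] := one_sub_cos_le (Im z).
have iz1 : `|Im z| <= 1 by rewrite (le_trans iz)//; lra.
have s1 := sin_sub_le iz1; have s2 := normr_sin_le (Im z).
have ReE : Re (cexp z - 1 - z) = (expR (Re z) - 1 - Re z) - expR (Re z) * (1 - cos (Im z)).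
  by rewrite !(ReD, ReN) /cexp Re_realM/=; ring.
have ImE : Im (cexp z - 1 - z) = (sin (Im z) - Im z) +
    (expR (Re z) - 1 - Re z) * sin (Im z) + Re z * sin (Im z).
  by rewrite !(ImD, ImN) /cexp Im_realM/=; ring.
rewrite ReE ImE.
set x := Re z in rz e1 *; set y := Im z in iz iz1 c1 c2 s1 s2 *.
have ex3 : expR x <= 3.
  by move: e1 rz; rewrite !ler_norml => /andP[_ h] /andP[h1 h2]; nra.
have ex0 := expR_gt0 x.
have b1 : `|expR x - 1 - x - expR x * (1 - cos y)| <= 2 * x ^+ 2 + 3 * (y ^+ 2 / 2).
  rewrite (le_trans (ler_normB _ _))// lerD// normrM (ger0_norm c1) (ger0_norm (ltW ex0)).
  by apply: ler_pM => //; exact: ltW.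
have b2 : `|(expR x - 1 - x) * sin y| <= x ^+ 2.
  rewrite normrM; apply: (@le_trans _ _ (2 * x ^+ 2 * 2^-1)).
    by apply: ler_pM => //; exact: le_trans iz.
  by lra.
have b3 : `|x * sin y| <= x ^+ 2 + y ^+ 2.
  rewrite normrM; apply: (@le_trans _ _ (`|x| * `|y|)); first exact: ler_wpM2l.
  by rewrite -[x ^+ 2]real_normK ?num_real// -[y ^+ 2]real_normK ?num_real// mulr_le_sqrD.
have b4 := le_trans
  (ler_normD (sin y - y + (expR x - 1 - x) * sin y) (x * sin y))
  (lerD (le_trans (ler_normD _ _) (lerD s1 b2)) b3).
apply: le_trans (lerD b1 b4) _.
by have := sqr_ge0 x; have := sqr_ge0 y; lra.
Qed.

(** Telescoping of a^m - b^m. Since 1 <= M, the exponent m may replace m - 1, which avoids a case m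
    = 0. *)
Lemma modulus_exprB_le a b (M : R) m : 1 <= M -> modulus a <= M -> modulus b <= M ->
  modulus (a ^+ m - b ^+ m) <= m%:R * modulus (a - b) * M ^+ m.
Proof.
move=> M1 aM bM; have M0 : 0 <= M by rewrite (le_trans ler01).
elim: m => [|m ih]; first by rewrite subrr modulus0 !mul0r.
rewrite !exprS (_ : _ - _ = a * (a ^+ m - b ^+ m) + (a - b) * b ^+ m); last by ring.
rewrite (le_trans (modulusD _ _))// !modulusM modulusX -natr1.
have h1 : modulus a * modulus (a ^+ m - b ^+ m) <= M * (m%:R * modulus (a - b) * M ^+ m).
  by apply: ler_pM; rewrite ?modulus_ge0.
have h2 : modulus (a - b) * modulus b ^+ m <= modulus (a - b) * (M * M ^+ m).
  rewrite ler_wpM2l ?modulus_ge0//.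
  apply: (@le_trans _ _ (1 * M ^+ m)).
    by rewrite mul1r lerXn2r ?nnegrE ?modulus_ge0.
  by rewrite ler_wpM2r ?exprn_ge0.
by apply: le_trans (lerD h1 h2) _; rewrite le_eqVlt; apply/orP; left; apply/eqP; ring.
Qed.

(** Both sides are m-th powers, as exp z = exp (z/m)^m. The bases differ by at most 10 (K/m)^2, and
    m such errors, amplified by at most e^K, give the bound. The condition 2 K <= m brings z/m into
    the range of [cexp_approx]. *)
Lemma cexp_euler z (K : R) m : (0 < m)%N -> modulus z <= K -> 2 * K <= m%:R ->
  modulus (cexp z - (1 + z / m%:R) ^+ m) <= 10 * K ^+ 2 * expR K / m%:R.
Proof.
move=> m0 zK Km; have K0 := le_trans (modulus_ge0 z) zK.
have mr : 0 < m%:R :> R by rewrite ltr0n.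
have mc : m%:R != 0 :> R[i] by rewrite pnatr_eq0 -lt0n.
have mn : modulus (z / m%:R) = modulus z / m%:R.
  rewrite modulusM modulusV; congr (_ / _).
  by rewrite -(rmorph_nat (real_complex R)) modulus_real ger0_norm.
have zm : modulus (z / m%:R) <= K / m%:R by rewrite mn ler_pM2r ?invr_gt0.
have e : cexp z = cexp (z / m%:R) ^+ m by rewrite cexpX mulrC divfK.
rewrite e; have small : modulus (z / m%:R) <= 2^-1.
  by rewrite (le_trans zm)// ler_pdivrMr// mulrC ler_pdivlMr// mulrC.
have M1 : 1 <= expR (K / m%:R) by rewrite -expR0 ler_expR divr_ge0// ltW.
have A : modulus (cexp (z / m%:R)) <= expR (K / m%:R).
  by rewrite modulus_cexp ler_expR (le_trans _ zm)// (le_trans (ler_norm _))// normr_Re_le.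
have B : modulus (1 + z / m%:R) <= expR (K / m%:R).
  rewrite (le_trans (modulusD _ _))// modulus1 (le_trans _ (expR_ge1Dx _))// lerD2l//.
apply: le_trans (modulus_exprB_le m M1 A B) _.
have eM : expR (K / m%:R) ^+ m = expR K by rewrite -expRM_natl mulrC divfK// gt_eqF.
rewrite eM opprD addrA [leRHS]mulrAC ler_wpM2r ?expR_ge0//.
have := cexp_approx small => h.
apply: le_trans (ler_wpM2l (ltW mr) h) _.
rewrite mulrCA -[leRHS]mulrA ler_wpM2l//.
have z2 : modulus (z / m%:R) ^+ 2 <= (K / m%:R) ^+ 2.
  by rewrite lerXn2r ?nnegrE ?modulus_ge0 ?divr_ge0// ltW.
apply: le_trans (ler_wpM2l (ltW mr) z2) _.
rewrite le_eqVlt; apply/orP; left; apply/eqP; field.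
by rewrite gt_eqF.
Qed.

Lemma disc_alg_euler g m : disc_alg g -> disc_alg (fun t => (1 + g t / m%:R) ^+ m).
Proof.
move=> dg; apply: disc_algX; apply: disc_algD; first exact: disc_alg_cst.
by apply: disc_algM => //; exact: disc_alg_cst.
Qed.

Lemma cexp_euler_uniform (K e : R) : 0 <= K -> 0 < e -> exists2 m, (0 < m)%N &
  forall z, modulus z <= K -> modulus (cexp z - (1 + z / m%:R) ^+ m) <= e.
Proof.
move=> K0 e0; pose c : R := 2 * K + 10 * K ^+ 2 * expR K / e.
have c0 : 0 <= 10 * K ^+ 2 * expR K / e.
  by rewrite divr_ge0 ?mulr_ge0 ?exprn_ge0 ?expR_ge0// ltW.
have Kc : 2 * K <= c by rewrite lerDl.
have [m hm] : exists m : nat, c <= m.+1%:R :> R.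
  by exists (Num.trunc c); rewrite ltW// truncnS_gt.
have Km : 2 * K <= m.+1%:R := le_trans Kc hm.
exists m.+1 => // z zK; apply: le_trans (cexp_euler (ltn0Sn m) zK Km) _.
rewrite ler_pdivrMr ?ltr0n// [leRHS]mulrC -ler_pdivrMr// (le_trans _ hm)//.
by rewrite lerDr mulr_ge0.
Qed.

(** Euler powers of g are polynomials in g, and on the bounded range of g they approximate the
    exponential uniformly. *)
Theorem disc_alg_cexp g : disc_alg g -> disc_alg (fun t => cexp (g t)).
Proof.
move=> dg; have [K K0 gK] := disc_alg_bounded dg.
apply: disc_alg_uniform_limit => e e0.
have [m m0 hm] := cexp_euler_uniform K0 e0.
by exists (fun t => (1 + g t / m%:R) ^+ m) => [|t]; [exact: disc_alg_euler|exact: hm].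
Qed.

(** The mean is multiplicative, so it commutes with Euler powers, and both sides are limits of
    these. *)
Theorem circle_mean_cexp g : disc_alg g ->
  circle_mean (fun t => cexp (g t)) = cexp (circle_mean g).
Proof.
move=> dg; have [K K0 gK] := disc_alg_bounded dg.
apply/eqP; rewrite -subr_eq0; apply/eqP/modulus_le_eps => e e0.
have e2 : 0 < e / 2 by rewrite divr_gt0.
have [m m0 hm] := cexp_euler_uniform K0 e2.
have lg := disc_alg_L1 dg.
have mE : circle_mean (fun t => (1 + g t / m%:R) ^+ m) = (1 + circle_mean g / m%:R) ^+ m.
  have dq : disc_alg (fun t => g t / m%:R) by apply: disc_algM => //; exact: disc_alg_cst.
  rewrite circle_meanX; last by apply: disc_algD => //; exact: disc_alg_cst.
  rewrite circle_meanD; [|exact: L1_cst|exact: disc_alg_L1].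
  rewrite circle_mean_cst; congr ((_ + _) ^+ _).
  by rewrite mulrC -circle_meanZ//; congr circle_mean; apply/funext => t; rewrite mulrC.
rewrite -(subrK (circle_mean (fun t => (1 + g t / m%:R) ^+ m)) (circle_mean _)) -addrA.
rewrite (le_trans (modulusD _ _))// [leRHS]splitr lerD//.
  apply: circle_mean_dist => [||t];
    [exact/disc_alg_L1/disc_alg_cexp|exact/disc_alg_L1/disc_alg_euler|exact: hm].
rewrite mE modulus_distC hm//.
exact: modulus_circle_mean_bounded.
Qed.

End ComplexExponential.

(** * Power series in the disk, their dilations and boundary functions *)

Section HardySpace.
Variable R : realType.
Implicit Types (f g h : R -> R[i]) (F : R[i] -> R[i]) (c : nat -> R[i]) (z l : R[i]) (r t e : R).

Lemma cvg_complexP (u : nat -> R[i]) l :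
  (u : nat -> R[i]^o) @ \oo --> (l : R[i]^o) <->
  (forall e, 0 < e -> exists N, forall n, (N <= n)%N -> modulus (l - u n) <= e).
Proof.
split=> [ul e e0|H].
  have ec : 0 < e%:C by rewrite ltcR.
  have /cvgrPdist_le/(_ _ ec)[N _ hN] := ul.
  by exists N => n Nn; have := hN n Nn; rewrite normc_modulus lecR.
(* Here epsilon ranges over [R[i]], where being positive means having zero imaginary part and
   positive real part. *)
apply/cvgrPdist_le => e; case: e => e e'; rewrite ltcE/= => /andP[/eqP -> e0].
have [N hN] := H _ e0; exists N => // n /= Nn.
by rewrite normc_modulus lecR hN.
Qed.

Lemma geometric_sum_le (x : R) m n : 0 <= x -> x < 1 ->
  \sum_(m <= i < n) x ^+ i <= x ^+ m / (1 - x).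
Proof.
move=> x0 x1; have x1' : 0 < 1 - x by rewrite subr_gt0.
rewrite ler_pdivlMr// mulr_suml.
have [mn|nm] := leqP m n; last by rewrite big_geq ?exprn_ge0// ltnW.
under eq_bigr do rewrite mulrBr mulr1 -exprSr.
rewrite -[leLHS]opprK -sumrN.
under eq_bigr do rewrite opprB.
by rewrite telescope_sumr// opprB gerDl oppr_le0 exprn_ge0.
Qed.

Lemma power_series_tail_le c (C : R) z m n : (forall i, modulus (c i) <= C) ->
  modulus z < 1 ->
  modulus (\sum_(m <= i < n) c i * z ^+ i) <= C * (modulus z ^+ m / (1 - modulus z)).
Proof.
move=> cC z1; have C0 : 0 <= C := le_trans (modulus_ge0 _) (cC 0%N).
rewrite (le_trans (modulus_sum _ _))//.
apply: le_trans (ler_wpM2l C0 (geometric_sum_le m n (modulus_ge0 z) z1)).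
rewrite mulr_sumr ler_sum// => i _.
by rewrite modulusM modulusX ler_wpM2r ?exprn_ge0 ?modulus_ge0.
Qed.

Lemma geometric_eventually (x K e : R) : 0 <= x -> x < 1 -> 0 < e ->
  exists N, forall n, (N <= n)%N -> K * x ^+ n <= e.
Proof.
move=> x0 x1 e0; have x1' : `|x| < 1 by rewrite ger0_norm.
have /cvgrPdist_le/(_ _ e0)[N _ hN] := cvg_geometric K x1'.
exists N => n Nn; have := hN n Nn; rewrite sub0r normrN.
by apply: le_trans; exact: ler_norm.
Qed.

Lemma power_series_cvg c (C : R) z : (forall i, modulus (c i) <= C) -> modulus z < 1 ->
  exists l, series (fun n => c n * z ^+ n : R[i]^o) @ \oo --> (l : R[i]^o).
Proof.
move=> cC z1; have C0 : 0 <= C := le_trans (modulus_ge0 _) (cC 0%N).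
have key (q : R[i] -> R) : (forall x y, q (x + y) = q x + q y) -> q 0 = 0 ->
    (forall x, `|q x| <= modulus x) -> cvgn (series (fun n => q (c n * z ^+ n))).
  move=> qD q0 qm; apply: normed_cvg.
  apply: (@series_le_cvg _ _ (geometric C (modulus z))).
  - by move=> n; exact: normr_ge0.
  - by move=> n; rewrite /= mulr_ge0// exprn_ge0// modulus_ge0.
  - move=> n; rewrite /= (le_trans (qm _))// modulusM modulusX.
    by rewrite ler_wpM2r ?exprn_ge0 ?modulus_ge0.
  - by apply: is_cvg_geometric_series; rewrite ger0_norm ?modulus_ge0.
have sumq (q : R[i] -> R) n : (forall x y, q (x + y) = q x + q y) -> q 0 = 0 ->
    series (fun n => q (c n * z ^+ n)) n = q (series (fun n => c n * z ^+ n) n).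
  move=> qD q0; rewrite /series/=; elim: n => [|n ih]; first by rewrite !big_geq.
  by rewrite !big_nat_recr//= ih qD.
have /cvg_ex[a ca] := key (@complex.Re R) (@ReD R) erefl (@normr_Re_le R).
have /cvg_ex[b cb] := key (@complex.Im R) (@ImD R) erefl (@normr_Im_le R).
exists (a +i* b); apply/cvg_complexP => e e0.
have e2 : 0 < e / 2 by rewrite divr_gt0.
move/cvgrPdist_le : ca => /(_ _ e2)[N _ hN].
move/cvgrPdist_le : cb => /(_ _ e2)[M _ hM].
exists (maxn N M) => n; rewrite geq_max => /andP[Nn Mn].
rewrite (le_trans (modulus_le _))// [leRHS]splitr lerD//.
  by rewrite ReD ReN -(sumq _ _ (@ReD R))// hN.
by rewrite ImD ImN -(sumq _ _ (@ImD R))// hM.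
Qed.

Lemma power_series_approx c (C : R) z l N : (forall i, modulus (c i) <= C) ->
  modulus z < 1 -> series (fun n => c n * z ^+ n : R[i]^o) @ \oo --> (l : R[i]^o) ->
  modulus (l - \sum_(0 <= i < N) c i * z ^+ i) <= C * (modulus z ^+ N / (1 - modulus z)).
Proof.
move=> cC z1 /cvg_complexP cl; apply/ler_addgt0Pl => e e0.
have [M hM] := cl _ e0; have := hM (maxn M N) (leq_maxl _ _).
rewrite /series/= (@big_cat_nat _ _ _ N)//=; last exact: leq_maxr.
set a := \sum_(0 <= i < N) _; set b := \sum_(N <= i < _) _ => h.
rewrite (_ : l - a = (l - (a + b)) + b); last by ring.
by rewrite (le_trans (modulusD _ _))// lerD// power_series_tail_le.
Qed.

Definition power_series_on_disk c F := forall z, unit_disk z ->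
  series (fun n => c n * z ^+ n : R[i]^o) @ \oo --> (F z : R[i]^o).

Lemma modulus_dilation r t : 0 <= r -> modulus (r%:C * cis t) = r.
Proof. by move=> r0; rewrite modulusM modulus_real modulus_cis mulr1 ger0_norm. Qed.

(** On the circle of radius r < 1 the tail of the series is dominated by a geometric one, uniformly
    in t. *)
Lemma disc_alg_dilation c (C : R) F r : (forall i, modulus (c i) <= C) ->
  power_series_on_disk c F -> 0 <= r -> r < 1 -> disc_alg (fun t => F (r%:C * cis t)).
Proof.
move=> cC cF r0 r1 e e0.
have [N hN] := geometric_eventually (C / (1 - r)) r0 r1 e0.
exists (\poly_(i < N) (c i * r%:C ^+ i)) => t.
have mz := modulus_dilation t r0.
have zd : modulus (r%:C * cis t) < 1 by rewrite mz.
have := power_series_approx N cC zd (cF _ zd).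
rewrite mz horner_poly big_mkord.
under [X in _ - X]eq_bigr do rewrite exprMn mulrA.
move=> /le_trans; apply; apply: le_trans (hN N (leqnn N)).
by rewrite [_ ^+ N / _]mulrC mulrA.
Qed.

Lemma ell2_bounded c : cvgn (series (fun n => modulus (c n) ^+ 2)) ->
  exists C : R, forall n, modulus (c n) <= C.
Proof.
move=> cc; have [M Mc] : has_ubound (range (series (fun n => modulus (c n) ^+ 2))).
  exact/bounded_fun_has_ubound/cvg_seq_bounded.
exists (M + 1) => n; have cM : modulus (c n) ^+ 2 <= M.
  apply: le_trans (Mc (series (fun n => modulus (c n) ^+ 2) n.+1) _); last by exists n.+1.
  rewrite /series/= big_nat_recr//= lerDr sumr_ge0// => i _; exact: sqr_ge0.
have := modulus_ge0 (c n); have := sqr_ge0 (modulus (c n) - 1); nra.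
Qed.

Lemma near_left1 (P : R -> Prop) : (\forall r \near (1 : R)^'-, P r) <->
  exists d, [/\ 0 <= d, d < 1 & forall r, d < r -> r < 1 -> P r].
Proof.
split.
  move=> [e /= e0 he]; exists (Num.max 0 (1 - e)); split.
  - by rewrite le_max lexx.
  - by rewrite gt_max ltr01/= ltrBlDr ltrDl.
  - move=> r; rewrite gt_max => /andP[r0 er] r1; apply: he => //=.
    by rewrite ger0_norm ?subr_ge0 ?(ltW r1)// ltrBlDr addrC -ltrBlDr.
move=> [d [d0 d1 H]]; exists (1 - d); first by rewrite /= subr_gt0.
move=> r /= rd r1; apply: H => //; move: rd.
by rewrite ger0_norm ?subr_ge0 ?(ltW r1)//; lra.
Qed.

(** The inequality is kept in the extended reals, so that it makes sense before the dilations are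
    known to be in [L2]. *)
Lemma boundary_functionP F f : boundary_function F f <->
  L2 f /\ forall e, 0 < e -> exists d, [/\ 0 <= d, d < 1 & forall r, d < r -> r < 1 ->
    (sqnorm2 (fun t => F (r%:C * cis t) - f t)%R <= e%:E)%E].
Proof.
split=> -[lf H]; split => //.
- move=> e e0; apply/near_left1.
  move/fine_cvgP : H => [fn] /cvgrPdist_le/(_ _ e0); move: fn.
  apply: filterS2 => r fn; rewrite sub0r normrN => h.
  by rewrite -(fineK fn) lee_fin (le_trans (ler_norm _)).
- apply/fine_cvgP; split.
    have := H 1 ltr01 => /near_left1; apply: filterS => r h.
    by rewrite ge0_fin_numE ?sqnorm2_ge0// (le_lt_trans h)// ltry.
  apply/cvgrPdist_le => e e0; have /near_left1 := H _ e0; apply: filterS => r h.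
  rewrite sub0r normrN ger0_norm ?fine_ge0 ?sqnorm2_ge0// -lee_fin fineK//.
  by rewrite ge0_fin_numE ?sqnorm2_ge0// (le_lt_trans h)// ltry.
Qed.

(** The dilations are in the disc algebra, hence have no negative frequencies, and this property is
    closed in L^2. *)
Lemma H2_plus_hardy f : H2_plus f -> hardy f.
Proof.
move=> [F [c [cc cF]] /boundary_functionP[lf bF]].
have [C cC] := ell2_bounded cc.
apply: hardy_limit => // e e0; have [d [d0 d1 hd]] := bF e e0.
pose r := (d + 1) / 2; have dr : d < r by rewrite /r; lra.
have r1 : r < 1 by rewrite /r; lra.
have r0 : 0 <= r by rewrite ltW// (le_lt_trans d0).
have da := disc_alg_dilation cC cF r0 r1.
exists (fun t => F (r%:C * cis t)); first exact: disc_alg_hardy.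
rewrite nrm2_distC -lee_fin -sqnorm2E ?hd//.
by apply: L2B => //; exact: disc_alg_L2.
Qed.

End HardySpace.

(** * Fourier description of [H2_plus] and [H2_minus] *)

Section HardyExpansion.
Variable R : realType.
Implicit Types (f g h : R -> R[i]) (F : R[i] -> R[i]) (c : nat -> R[i]) (z l : R[i]) (r t e : R).

Definition fexp_nneg (k : nat) : R -> R[i] := fexp (Posz k).
Definition fexp_neg (k : nat) : R -> R[i] := fexp (Negz k).

Lemma orthonormal_nneg : orthonormal fexp_nneg.
Proof. by apply: (@orthonormal_fexp R Posz) => i j []. Qed.

Lemma orthonormal_neg : orthonormal fexp_neg.
Proof. by apply: (@orthonormal_fexp R Negz) => i j []. Qed.

Lemma inner2_nneg_neg i j : inner2 (fexp_nneg i) (fexp_neg j) = 0.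
Proof. by rewrite inner2_fexp. Qed.

Lemma inner2_neg_nneg i j : inner2 (fexp_neg i) (fexp_nneg j) = 0.
Proof. by rewrite inner2_fexp. Qed.

Lemma fourier_coef_eq0 f : L2 f -> (forall i, inner2 f (fexp_nneg i) = 0) ->
  (forall i, inner2 f (fexp_neg i) = 0) -> eq_ae f (fun=> 0) /\ nrm2 f = 0.
Proof.
move=> lf f1 f2; have f0 : eq_ae f (fun=> 0).
  apply: fourier_uniqueness; first exact: L2_L1.
  move=> n; rewrite -[n]opprK -inner2_fexpE.
  by case: (- n) => k; [exact: f1|exact: f2].
split => //; have := eq_ae_nrm2B (L2_measurable lf) (circle_measurable_cst 0) f0.
by under [X in nrm2 X]eq_fun do rewrite subr0.
Qed.

Lemma L2_cvg_nrm0 (u : nat -> R -> R[i]) f g : (forall n, L2 (u n)) -> L2 f -> L2 g ->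
  L2_cvg u g -> nrm2 (fun t => g t - f t) = 0 -> L2_cvg u f.
Proof.
move=> lu lf lg ug gf0 e e0; have [N hN] := ug _ (divr_gt0 e0 (ltr0n R 2)).
exists N => n Nn; apply: le_trans (nrm2_triangle (lu n) lg lf) _.
by rewrite gf0 mulr0 addr0; have := hN n Nn; lra.
Qed.

(** The projection g onto the nonnegative frequencies has the same Fourier coefficients as f,
    negative ones included, so the uniqueness theorem makes g - f null. *)
Lemma hardy_expansion f : hardy f ->
  L2_cvg (lincomb fexp_nneg (fun i => inner2 f (fexp_nneg i)) 0) f.
Proof.
move=> [lf f0]; have ov := orthonormal_nneg.
have [g [lg ug gf gw]] := orthonormal_expansion ov lf.
apply: L2_cvg_nrm0 ug _ => //; first by move=> n; exact: L2_lincomb.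
have [] // := @fourier_coef_eq0 (fun t => g t - f t) (L2B lg lf) => i.
  rewrite inner2Bl// ?gf ?subrr//; exact: L2_fexp.
rewrite inner2Bl//; last exact: L2_fexp.
rewrite [inner2 f _]f0 subr0 gw//; first exact: L2_fexp.
by move=> j; exact: inner2_nneg_neg.
Qed.

Lemma lincomb_sub (v : nat -> R -> R[i]) a b m n :
  (fun t => lincomb v a m n t - lincomb v b m n t) = lincomb v (fun i => a i - b i) m n.
Proof.
by apply/funext => t; rewrite /lincomb -sumrB; apply: eq_bigr => i _; rewrite mulrBl.
Qed.

Lemma one_sub_expr_le r m : 0 <= r -> r <= 1 -> 1 - r ^+ m <= m%:R * (1 - r).
Proof.
move=> r0 r1; elim: m => [|m ih]; first by rewrite expr0 subrr mul0r.
rewrite exprS -natr1; have := exprn_ge0 m r0; have := exprn_ile1 m r0 r1; nra.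
Qed.

(** The factor (1 - r^i)^2 is at most N (1 - r) for the frequencies below N and at most 1 for the
    others, whose total mass is e. The bound does not involve M. *)
Lemma lincomb_dilation_le c r (A e : R) N M : (N <= M)%N -> 0 <= r -> r <= 1 ->
  \sum_(0 <= i < N) modulus (c i) ^+ 2 <= A ->
  \sum_(N <= i < M) modulus (c i) ^+ 2 <= e ->
  nrm2 (fun t => lincomb fexp_nneg (fun i => c i * r%:C ^+ i) 0 M t -
                 lincomb fexp_nneg c 0 M t) <= N%:R * (1 - r) * A + e.
Proof.
move=> NM r0 r1 cA ce; rewrite lincomb_sub nrm2_lincomb; last exact: orthonormal_nneg.
have E i : modulus (c i * r%:C ^+ i - c i) ^+ 2 = modulus (c i) ^+ 2 * (1 - r ^+ i) ^+ 2.
  rewrite -{2}[c i]mulr1 -mulrBr modulusM exprMn; congr (_ * _).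
  rewrite -(rmorphXn (real_complex R)) -[1]/((1 : R)%:C) -realCB modulus_real.
  by rewrite real_normK ?num_real// -sqrrN opprB.
under eq_bigr do rewrite E.
have s0 i : 0 <= 1 - r ^+ i by rewrite subr_ge0 exprn_ile1.
have s1 i : (1 - r ^+ i) ^+ 2 <= 1 - r ^+ i.
  by have := s0 i; have := exprn_ge0 i r0; nra.
have s2 i : 1 - r ^+ i <= 1 by rewrite gerBl exprn_ge0.
rewrite (@big_cat_nat _ _ _ N)//= lerD//.
  apply: le_trans (ler_wpM2l _ cA); last by rewrite mulr_ge0// subr_ge0.
  rewrite mulr_sumr big_nat_cond [leRHS]big_nat_cond ler_sum// => i /andP[/andP[_ iN] _].
  rewrite mulrC ler_wpM2r ?sqr_ge0// (le_trans (s1 i))//.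
  rewrite (le_trans (one_sub_expr_le i r0 r1))// ler_wpM2r ?subr_ge0// ler_nat.
  exact: ltnW.
apply: le_trans ce; rewrite ler_sum// => i _.
by rewrite ler_piMr ?sqr_ge0// (le_trans (s1 i)).
Qed.

(** F is the power series of the nonnegative Fourier coefficients. Its dilation is compared with f
    through a dilated partial sum and the corresponding partial sum. *)
Theorem hardy_H2_plus f : hardy f -> H2_plus f.
Proof.
move=> hf; have [lf _] := hf; pose c i := inner2 f (fexp_nneg i).
have ov := orthonormal_nneg; have cc := orthonormal_coef_cvg ov lf.
have [C cC] := ell2_bounded cc.
have /choice[F FP] : forall z, exists l : R[i], unit_disk z ->
    series (fun n => c n * z ^+ n : R[i]^o) @ \oo --> (l : R[i]^o).
  move=> z; have [z1|z1] := pselect (modulus z < 1); last by exists 0 => /z1.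
  by have [l cl] := power_series_cvg cC z1; exists l.
exists F; first by exists c.
apply/boundary_functionP; split => // e e0.
(* Two uses of the weak triangle inequality turn the errors e1, 2 e1 and e1 into 2 e1 + 4 (2 e1) + 4
   e1 = 14 e1. *)
pose e1 := e / 14; have e10 : 0 < e1 by rewrite divr_gt0.
have [N hN] := series_cauchy_tail cc e10.
pose A := nrm2 f + 1; have A0 : 0 < A by rewrite ltr_wpDl ?nrm2_ge0.
have cA : \sum_(0 <= i < N) modulus (c i) ^+ 2 <= A.
  by rewrite (le_trans (bessel N ov lf))// lerDl.
(* Beyond this radius N (1 - r) A <= e1; the successor keeps the denominator positive when N = 0. *)
pose d := Num.max 0 (1 - e1 / (N.+1%:R * A)).
have NA0 : 0 < N.+1%:R * A by rewrite mulr_gt0.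
exists d; split.
- by rewrite le_max lexx.
- by rewrite gt_max ltr01/= ltrBlDr ltrDl divr_gt0.
move=> r; rewrite gt_max => /andP[/ltW r0 dr] r1.
have rd : N%:R * (1 - r) * A <= e1.
  have : (1 - r) * (N.+1%:R * A) <= e1 by rewrite -ler_pdivlMr// lerBlDr addrC -lerBlDr ltW.
  apply: le_trans; rewrite mulrAC mulrC ler_wpM2l ?subr_ge0 ?(ltW r1)//.
  by rewrite ler_wpM2r ?(ltW A0)// ler_nat.
have [N2 hN2] := hardy_expansion hf e10.
have s0 : 0 < Num.sqrt e1 by rewrite sqrtr_gt0.
have [N3 hN3] := geometric_eventually (C / (1 - r)) r0 r1 s0.
(* M may depend on r through [N3], whereas N and d were fixed before r. *)
pose M := maxn N (maxn N2 N3).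
have NM : (N <= M)%N := leq_maxl _ _.
have N2M : (N2 <= M)%N by rewrite /M !leq_max leqnn orbT.
have N3M : (N3 <= M)%N by rewrite /M !leq_max leqnn !orbT.
have da := disc_alg_dilation cC FP r0 r1.
pose S := lincomb fexp_nneg c 0 M.
pose Sr := lincomb fexp_nneg (fun i => c i * r%:C ^+ i) 0 M.
have lS : L2 S by exact: L2_lincomb.
have lSr : L2 Sr by exact: L2_lincomb.
have lF := disc_alg_L2 da.
have b1 : nrm2 (fun t => F (r%:C * cis t) - Sr t) <= e1.
  rewrite -[leRHS]sqr_sqrtr ?(ltW e10)//; apply: nrm2_bounded.
    by apply: L2_measurable; exact: L2B.
  move=> t _; have mz := modulus_dilation t r0.
  have zd : modulus (r%:C * cis t) < 1 by rewrite mz.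
  have := power_series_approx M cC zd (FP _ zd); rewrite mz.
  have -> : \sum_(0 <= i < M) c i * (r%:C * cis t) ^+ i = Sr t.
    by apply: eq_bigr => i _; rewrite exprMn mulrA /fexp_nneg fexp_nat.
  move=> /le_trans; apply; apply: le_trans (hN3 M N3M).
  by rewrite [_ ^+ M / _]mulrC mulrA.
have b2 : nrm2 (fun t => Sr t - S t) <= 2 * e1.
  have tl : \sum_(N <= i < M) modulus (c i) ^+ 2 <= e1.
    by rewrite (le_trans (ler_norm _))// hN.
  by apply: le_trans (lincomb_dilation_le NM r0 (ltW r1) cA tl) _; lra.
have b3 : nrm2 (fun t => S t - f t) <= e1 := hN2 M N2M.
rewrite sqnorm2E; last exact: L2B.
rewrite lee_fin; have t1 := nrm2_triangle lF lSr lf; have t2 := nrm2_triangle lSr lS lf.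
have : e = 14 * e1 by rewrite /e1; field.
by lra.
Qed.

Lemma H2_plusP f : H2_plus f <-> hardy f.
Proof. by split; [exact: H2_plus_hardy|exact: hardy_H2_plus]. Qed.

(** Every Hardy function is an L^2 limit of combinations of nonnegative characters, so orthogonality
    to these characters suffices. *)
Lemma H2_minusP f : H2_minus f <-> L2 f /\ forall i, inner2 f (fexp_nneg i) = 0.
Proof.
split=> -[lf f0]; split => //.
- move=> i; apply: f0; apply/H2_plusP; split; first exact: L2_fexp.
  by move=> k; exact: inner2_nneg_neg.
- move=> h /H2_plusP hh; have [lh _] := hh.
  have ov := orthonormal_nneg.
  have ch := hardy_expansion hh.
  apply: modulus_le_eps => e e0.
  have A0 : 0 < nrm2 f + 1 by rewrite ltr_wpDl ?nrm2_ge0.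
  have [N hN] := ch _ (divr_gt0 (exprn_gt0 2 e0) A0).
  have lS := L2_lincomb (fun i => inner2 h (fexp_nneg i)) 0 N ov.
  have fS : inner2 f (lincomb fexp_nneg (fun i => inner2 h (fexp_nneg i)) 0 N) = 0.
    rewrite inner2C// inner2_lincombl// big1 ?conjJ0// => i _.
    have le : L2 (fexp_nneg i) by exact: L2_fexp.
    by rewrite (inner2C lf le) f0 conjJ0 mulr0.
  rewrite -[inner2 f h]subr0 -fS -inner2Br//.
  have := cauchy_schwarz lf (L2B lh lS); rewrite nrm2_distC => cs.
  rewrite -ler_sqr ?nnegrE ?modulus_ge0 ?(ltW e0)//.
  apply: le_trans cs _; apply: le_trans (ler_wpM2l (nrm2_ge0 _) (hN N (leqnn N))) _.
  rewrite mulrA ler_pdivrMr// mulrC ler_wpM2l ?sqr_ge0// lerDl//.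
Qed.

End HardyExpansion.

(** * Outer functions *)

Section Herglotz.
Variable R : realType.
Implicit Types (f g h : R -> R[i]) (z w : R[i]) (r s t e : R) (psi : R -> R).

Local Notation mu := (@lebesgue_measure R).
Local Notation angles := (@angles R).
Let mA := @measurable_angles R.
Local Hint Resolve mA : core.

Definition cayley w : R[i] := (1 + w) / (1 - w).

(** The exponent in the definition of [outer]; its real part is the Poisson extension of psi. *)
Definition herglotz psi z : R[i] :=
  circle_mean (fun s => (cis s + z) / (cis s - z) * (psi s)%:C).

Lemma one_sub_neq0 w : modulus w < 1 -> 1 - w != 0.
Proof.
move=> w1; apply/eqP => /eqP; rewrite subr_eq0 => /eqP e.
by move: w1; rewrite -e modulus1 ltxx.
Qed.

Lemma modulus_one_sub_ge w : 1 - modulus w <= modulus (1 - w).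
Proof.
rewrite lerBlDr -[leLHS](modulus1 R) -{1}(subrK w 1).
exact: modulusD.
Qed.

(** Truncation of 1 + 2 w + 2 w^2 + ..., written as twice a geometric sum minus 1. *)
Lemma cayley_approx w N : modulus w < 1 ->
  modulus (cayley w - (2 * (\sum_(k < N) w ^+ k) - 1)) <= 2 / (1 - modulus w) * modulus w ^+ N.
Proof.
move=> w1; have w0 := one_sub_neq0 w1.
have -> : cayley w - (2 * (\sum_(k < N) w ^+ k) - 1) = 2 * w ^+ N / (1 - w).
  rewrite /cayley; have := subrX1 w N; set S := \sum_(i < N) _ => e.
  apply: (mulIf w0); rewrite mulrBl !divfK//.
  have -> : w ^+ N = (w - 1) * S + 1 by rewrite -e subrK.
  ring.
rewrite !modulusM modulusV modulusX -[2](rmorph_nat (real_complex R)) modulus_real ger0_norm//.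
rewrite [leRHS]mulrAC ler_wpM2l ?mulr_ge0 ?exprn_ge0 ?modulus_ge0//.
by rewrite lef_pV2 ?posrE ?subr_gt0 ?(lt_le_trans _ (modulus_one_sub_ge w)) ?subr_gt0 ?modulus_one_sub_ge.
Qed.

Lemma cayley_bounded w r : modulus w <= r -> r < 1 -> modulus (cayley w) <= 2 / (1 - r) + 1.
Proof.
move=> wr r1; have w1 := le_lt_trans wr r1; have := @cayley_approx w 0 w1.
rewrite big_ord0 mulr0 sub0r opprK expr0 mulr1 => h.
rewrite -(addrK 1 (cayley w)) (le_trans (modulusB _ _))// modulus1 lerD2r.
rewrite (le_trans h)// ler_wpM2l// lef_pV2 ?posrE ?subr_gt0//.
by rewrite lerB.
Qed.

Lemma Re_cayley_ge0 w : modulus w < 1 -> 0 <= Re (cayley w).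
Proof.
move=> w1; have w0 := one_sub_neq0 w1.
have m0 : 0 < modulus (1 - w).
  by rewrite (lt_le_trans _ (modulus_one_sub_ge w))// subr_gt0.
(* Rationalising the denominator shows the Poisson kernel (1 - |w|^2) / |1 - w|^2 as the real
   part. *)
have -> : cayley w = ((modulus (1 - w) ^+ 2)^-1)%:C * ((1 + w) * (1 - w)^*).
  have e : (1 - w) * (1 - w)^* = (modulus (1 - w) ^+ 2)%:C := mulcJ _.
  have j0 : (1 - w)^* != 0.
    apply/eqP => j0; have := modulus_conj (1 - w); rewrite j0 modulus0 => m.
    by move: m0; rewrite -m ltxx.
  have -> : ((modulus (1 - w) ^+ 2)^-1)%:C = ((modulus (1 - w) ^+ 2)%:C)^-1 by exact: fmorphV.
  rewrite -e /cayley; move: j0; move: ((1 - w)^*) => v v0.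
  by field; rewrite v0 w0.
rewrite Re_realM mulr_ge0 ?invr_ge0 ?sqr_ge0// ReM !(ReJ, ImJ, ReD, ImD, ReN, ImN)/=.
have := sqr_modulus w; have := modulus_ge0 w.
move: (modulus w) w1 (Re w) (Im w) => m m1 x y; nra.
Qed.

Lemma herglotz_kernel s z : (cis s + z) / (cis s - z) = cayley (z * (cis s)^*).
Proof.
have c0 := cis_neq0 s; rewrite /cayley cisJV.
have -> : 1 + z * (cis s)^-1 = (cis s + z) * (cis s)^-1 by rewrite mulrDl mulfV.
have -> : 1 - z * (cis s)^-1 = (cis s - z) * (cis s)^-1 by rewrite mulrBl mulfV.
by rewrite -mulf_div divff ?invr_eq0// mulr1.
Qed.

Lemma cayley_conj w : (cayley w)^* = cayley w^*.
Proof. by rewrite /cayley conjcM conjcV conjcD conjcB conjJ1. Qed.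

Lemma disc_alg_cayley z : modulus z < 1 -> disc_alg (fun t => cayley (z * cis t)).
Proof.
move=> z1 e e0.
have [N hN] := geometric_eventually (2 / (1 - modulus z)) (modulus_ge0 z) z1 e0.
exists (2%:P * (\poly_(k < N) z ^+ k) - 1) => t.
have mz : modulus (z * cis t) = modulus z by rewrite modulusM modulus_cis mulr1.
have zt1 : modulus (z * cis t) < 1 by rewrite mz.
rewrite !hornerE horner_poly; apply: le_trans (hN N (leqnn N)).
have := cayley_approx N zt1; rewrite mz.
by under eq_bigr do rewrite exprMn.
Qed.

Lemma circle_mean_cayley z : modulus z < 1 -> circle_mean (fun t => cayley (z * cis t)) = 1.
Proof.
move=> z1; apply/eqP; rewrite -subr_eq0; apply/eqP/modulus_le_eps => e e0.
have [N hN] := geometric_eventually (2 / (1 - modulus z)) (modulus_ge0 z) z1 e0.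
pose p := 2%:P * (\poly_(k < N.+1) z ^+ k) - 1.
have p0 : circle_mean (fun t => p.[cis t]) = 1.
  rewrite circle_mean_horner /p !hornerE horner_coef0 coef_poly/= expr0; ring.
rewrite -p0; apply: circle_mean_dist => [||t].
- exact/disc_alg_L1/disc_alg_cayley.
- exact/disc_alg_L1/disc_alg_poly.
have mz : modulus (z * cis t) = modulus z by rewrite modulusM modulus_cis mulr1.
have zt1 : modulus (z * cis t) < 1 by rewrite mz.
rewrite /p !hornerE horner_poly; apply: le_trans (hN N.+1 (leqnSn N)).
have := cayley_approx N.+1 zt1; rewrite mz.
by under eq_bigr do rewrite exprMn.
Qed.

Lemma measurable_herglotz_kernel z : modulus z < 1 ->
  circle_measurable (fun s => (cis s + z) / (cis s - z)).
Proof.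
move=> z1; have zc1 : modulus z^* < 1 by rewrite modulus_conj.
(* As a function of s the kernel is conjugate analytic, so its conjugate lies in the disc
   algebra. *)
rewrite (_ : (fun s => _) = fun s => (cayley (z^* * cis s))^*).
  exact/circle_measurableJ/disc_alg_measurable/disc_alg_cayley.
by apply/funext => s; rewrite herglotz_kernel cayley_conj conjcM conjJK.
Qed.

Lemma modulus_mul_conj_cis z s : modulus (z * (cis s)^*) = modulus z.
Proof. by rewrite modulusM modulus_conj modulus_cis mulr1. Qed.

Lemma L1_herglotz psi z : mu.-integrable angles (EFin \o psi) -> modulus z < 1 ->
  L1 (fun s => (cis s + z) / (cis s - z) * (psi s)%:C).
Proof.
move=> ip z1; apply: (L1Mr_bounded (k := 2 / (1 - modulus z) + 1)).
- by split => //; exact: integrable_cst_angles.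
- exact: measurable_herglotz_kernel.
- by move=> s _; rewrite herglotz_kernel; apply: cayley_bounded; rewrite ?modulus_mul_conj_cis.
Qed.

Lemma herglotzB psi1 psi2 z : mu.-integrable angles (EFin \o psi1) ->
  mu.-integrable angles (EFin \o psi2) -> modulus z < 1 ->
  herglotz (fun s => psi1 s - psi2 s) z = herglotz psi1 z - herglotz psi2 z.
Proof.
move=> i1 i2 z1; rewrite /herglotz -circle_meanB; [|exact: L1_herglotz..].
by congr circle_mean; apply/funext => s; rewrite realCB mulrBr.
Qed.

Lemma herglotz_cst (k : R) z : modulus z < 1 -> herglotz (fun=> k) z = k%:C.
Proof.
move=> z1; have zc1 : modulus z^* < 1 by rewrite modulus_conj.
have lc := disc_alg_L1 (disc_alg_cayley zc1).
rewrite /herglotz (_ : (fun s => _) = fun s => k%:C * (cayley (z^* * cis s))^*).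
  rewrite circle_meanZ; last exact: L1J.
  rewrite circle_meanJ// circle_mean_cayley//.
  by rewrite conjJ1 mulr1.
by apply/funext => s; rewrite herglotz_kernel cayley_conj conjcM conjJK mulrC.
Qed.

Lemma Re_herglotz_ge0 psi z : mu.-integrable angles (EFin \o psi) -> modulus z < 1 ->
  (forall s, angles s -> 0 <= psi s) -> 0 <= Re (herglotz psi z).
Proof.
move=> ip z1 p0; rewrite -[leLHS]/(Re (0 : R[i])) -{1}(circle_mean_cst 0).
apply: Re_circle_mean_le => [||s as_]; [exact: L1_cst|exact: L1_herglotz|].
rewrite mulrC Re_realM mulr_ge0 ?p0// herglotz_kernel Re_cayley_ge0//.
by rewrite modulus_mul_conj_cis.
Qed.

(** [cayley_approx] is integrated against psi, which makes the polynomial coefficients Fourier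
    coefficients of psi scaled by r^k. The value at 0 is 2 c_0 - c_0; for N = 0 the sum is empty and
    the value would be -c_0, hence the guard. *)
Lemma herglotz_approx psi r N : mu.-integrable angles (EFin \o psi) -> 0 <= r -> r < 1 ->
  exists p : {poly R[i]}, ((0 < N)%N -> p.[0] = circle_mean (fun s => (psi s)%:C)) /\
  forall t, modulus (herglotz psi (r%:C * cis t) - p.[cis t]) <=
    2 / (1 - r) * Re (circle_mean (fun s => `|psi s|%:C)) * r ^+ N.
Proof.
move=> ip r0 r1.
have lp : L1 (fun s => (psi s)%:C) by split => //; exact: integrable_cst_angles.
have lpJ (k : nat) : L1 (fun s => (cis s)^* ^+ k * (psi s)%:C).
  apply: (L1Mr_bounded (k := 1)) => //.
    exact/circle_measurableX/circle_measurableJ/circle_measurable_cis.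
  by move=> s _; rewrite modulusX modulus_conj modulus_cis expr1n.
pose c (k : nat) := circle_mean (fun s => (cis s)^* ^+ k * (psi s)%:C).
pose p := 2%:P * (\poly_(k < N) (c k * r%:C ^+ k)) - (c 0%N)%:P.
have c0E : c 0%N = circle_mean (fun s => (psi s)%:C).
  by rewrite /c; under eq_fun do rewrite expr0 mul1r.
exists p; split.
  move=> N0; rewrite /p !hornerE horner_coef0 coef_poly N0 expr0 mulr1 -c0E; ring.
move=> t; set z := r%:C * cis t; have mz : modulus z = r by exact: modulus_dilation.
have z1 : modulus z < 1 by rewrite mz.
have lsum : L1 (fun s => \sum_(k < N) z ^+ k * ((cis s)^* ^+ k * (psi s)%:C)).
  by apply: L1_sum => k; apply: L1Z; exact: lpJ.
have pE : p.[cis t] = circle_mean (fun s =>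
    2 * (\sum_(k < N) z ^+ k * ((cis s)^* ^+ k * (psi s)%:C)) - (psi s)%:C).
  rewrite circle_meanB//; last exact: L1Z.
  rewrite circle_meanZ// circle_mean_sum; last by move=> k; apply: L1Z; exact: lpJ.
  rewrite /p !hornerE horner_poly -c0E; congr (2 * _ - _).
  apply: eq_bigr => k _; rewrite circle_meanZ; last exact: lpJ.
  by rewrite -/(c k) /z exprMn -mulrA mulrC.
have lH := L1_herglotz ip z1.
rewrite pE /herglotz -circle_meanB//; last by apply: L1B => //; exact: L1Z.
set K := 2 / (1 - r) * r ^+ N.
have iK := integrableZl mA K (integrable_norm ip).
have := @modulus_circle_mean_le _ (fun s => (cis s + z) / (cis s - z) * (psi s)%:C -
   (2 * (\sum_(k < N) z ^+ k * ((cis s)^* ^+ k * (psi s)%:C)) - (psi s)%:C))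
   (fun s => K * `|psi s|) _ iK _.
have -> : circle_mean (fun s => (K * `|psi s|)%:C) = K%:C * circle_mean (fun s => `|psi s|%:C).
  rewrite -circle_meanZ; last first.
    by split; [exact: integrable_norm|exact: integrable_cst_angles].
  by congr circle_mean; apply/funext => s; rewrite realCM.
rewrite Re_realM mulrAC; apply.
  by apply: L1B => //; apply: L1B => //; exact: L1Z.
move=> s _; rewrite herglotz_kernel.
have w1 : modulus (z * (cis s)^*) < 1 by rewrite modulus_mul_conj_cis.
rewrite (_ : _ - _ = (cayley (z * (cis s)^*) - (2 * (\sum_(k < N) (z * (cis s)^*) ^+ k) - 1)) * (psi s)%:C).
  rewrite modulusM modulus_real ler_wpM2r//.
  by have := cayley_approx N w1; rewrite modulus_mul_conj_cis mz.
have -> : \sum_(k < N) z ^+ k * ((cis s)^* ^+ k * (psi s)%:C) =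
    (\sum_(k < N) (z * (cis s)^*) ^+ k) * (psi s)%:C.
  by rewrite mulr_suml; apply: eq_bigr => k _; rewrite [in RHS]exprMn mulrA.
ring.
Qed.

Lemma disc_alg_herglotz psi r : mu.-integrable angles (EFin \o psi) -> 0 <= r -> r < 1 ->
  disc_alg (fun t => herglotz psi (r%:C * cis t)).
Proof.
move=> ip r0 r1 e e0.
have [N hN] := geometric_eventually (2 / (1 - r) * Re (circle_mean (fun s => `|psi s|%:C))) r0 r1 e0.
have [p [_ pP]] := herglotz_approx N ip r0 r1; exists p => t.
exact: le_trans (pP t) (hN N (leqnn N)).
Qed.

Lemma circle_mean_herglotz psi r : mu.-integrable angles (EFin \o psi) -> 0 <= r -> r < 1 ->
  circle_mean (fun t => herglotz psi (r%:C * cis t)) = circle_mean (fun s => (psi s)%:C).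
Proof.
move=> ip r0 r1; apply/eqP; rewrite -subr_eq0; apply/eqP/modulus_le_eps => e e0.
have [N hN] := geometric_eventually (2 / (1 - r) * Re (circle_mean (fun s => `|psi s|%:C))) r0 r1 e0.
have [p [p0 pP]] := herglotz_approx N.+1 ip r0 r1.
rewrite -p0// -circle_mean_horner; apply: circle_mean_dist => [||t].
- exact/disc_alg_L1/disc_alg_herglotz.
- exact/disc_alg_L1/disc_alg_poly.
- exact: le_trans (pP t) (hN N.+1 (leqnSn N)).
Qed.

End Herglotz.

(** * Multiplication and division by an outer function *)

Section OuterFunctions.
Variable R : realType.
Implicit Types (f g h b : R -> R[i]) (z w : R[i]) (r s t e : R) (psi phi : R -> R).

Local Notation mu := (@lebesgue_measure R).
Local Notation angles := (@angles R).
Let mA := @measurable_angles R.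
Local Hint Resolve mA : core.

Lemma circle_mean_real psi : circle_mean (fun s => (psi s)%:C) =
  (Re (circle_mean (fun s => (psi s)%:C)))%:C.
Proof.
by apply: eq_ReIm => //; rewrite Im_circle_mean Rintegral_cst// mul0r mulr0.
Qed.

Lemma integrable_funrpos_shift psi (k : R) : mu.-integrable angles (EFin \o psi) ->
  mu.-integrable angles (EFin \o (fun s => Num.max (psi s + k) 0)).
Proof.
move=> ip; have iD := integrableD mA ip (integrable_cst_angles k).
have mp : measurable_fun angles psi by move: ip => /measurable_int/measurable_EFinP.
apply: le_integrable iD => //.
  apply/measurable_EFinP; apply: measurable_maxr => //.
  by apply: measurable_funD.
move=> s _; rewrite /= lee_fin; case: (leP (psi s + k) 0) => h.
  by rewrite normr0.
by [].
Qed.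

(** Dominated convergence with bound |psi|: at each s the truncation is 0 as soon as n >= |psi
    s|. *)
Lemma cvg_mean_truncation psi e : mu.-integrable angles (EFin \o psi) -> 0 < e ->
  exists n : nat, Re (circle_mean (fun s => (Num.max (- psi s - n%:R) 0)%:C)) <= e.
Proof.
move=> ip e0; have iN : mu.-integrable angles (EFin \o (fun s => - psi s)).
  by have := integrableN ip.
pose F (n : nat) s := (Num.max (- psi s - n%:R) 0)%:E.
have iF n : mu.-integrable angles (F n) by exact: (integrable_funrpos_shift (- n%:R) iN).
have mF n : measurable_fun angles (F n) by exact: measurable_int (iF n).
have in_ := integrable_norm ip.
have cF : {ae mu, forall s, angles s -> F n s @[n --> \oo] --> (0 : R)%:E}.
  apply: aeW => s _; apply/fine_cvgP; split; first exact: nearW.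
  apply/cvgrPdist_le => d d0; exists (Num.trunc `|psi s|).+1 => // n /= hn.
  have : `|psi s| <= n%:R.
    by rewrite (le_trans (ltW (truncnS_gt _)))// ler_nat.
  rewrite ler_norml => /andP[h1 h2]; rewrite sub0r normrN.
  case: (leP (- psi s - n%:R) 0) => h; first by rewrite normr0 ltW.
  by exfalso; lra.
have bF : {ae mu, forall s (n : nat), angles s -> (`|F n s| <= `|psi s|%:E)%E}.
  apply: aeW => s n _; rewrite lee_fin; case: (leP (- psi s - n%:R) 0) => h.
    by rewrite normr0.
  rewrite ger0_norm ?(ltW h)//; have := ler_norm (- psi s); rewrite normrN.
  by have := ler0n R n; lra.
have [_ _] := dominated_convergence mA mF (measurable_cst _) cF in_ bF.
rewrite integral0 => /fine_cvgP[_ /cvgrPdist_le cv].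
have tp := twopi_gt0 R; have [N _ hN] := cv _ (mulr_gt0 e0 tp).
exists N; rewrite Re_circle_mean; have := hN N (leqnn N).
rewrite /= sub0r normrN => h; rewrite mulrC ler_pdivrMr//.
exact: le_trans (ler_norm _) h.
Qed.

Lemma hardy_of_approx f : L2 f ->
  (forall e, 0 < e -> exists u b, [/\ L2 (fun t => u t * b t), hardy (fun t => u t * b t * f t) &
     nrm2 (fun t => 1 - u t * b t) <= e]) -> hardy f.
Proof.
move=> lf H; split=> // k.
have lE := L2_fexp R (Negz k); set E := fexp (Negz k) in lE *.
have mEJ : circle_measurable (fun t => (E t)^*) by exact/circle_measurableJ/circle_measurable_fexp.
have EJ1 t : angles t -> modulus ((E t)^*) <= 1 by rewrite modulus_conj modulus_fexp.
have lfE : L2 (fun t => (E t)^* * f t) by exact: L2M_bounded EJ1.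
have nfE : nrm2 (fun t => (E t)^* * f t) <= nrm2 f.
  by have := nrm2M_bounded lf mEJ EJ1; rewrite expr1n mul1r.
apply: modulus_le_eps => e e0.
have A0 : 0 < nrm2 f + 1 by rewrite ltr_wpDl ?nrm2_ge0.
have [u [b [lub [lubf ubf0] ub1]]] := H _ (divr_gt0 (exprn_gt0 2 e0) A0).
have l1 : L2 (fun t => 1 - u t * b t) by apply: L2B => //; exact: L2_cst.
have eq : inner2 f E = inner2 (fun t => (E t)^* * f t) (fun t => (1 - u t * b t)^*).
  rewrite -[LHS]subr0 -(ubf0 k) -inner2Bl//; congr circle_mean; apply/funext => t.
  by rewrite conjJK; ring.
have nJ : nrm2 (fun t => (1 - u t * b t)^*) = nrm2 (fun t => 1 - u t * b t).
  by rewrite /nrm2 /sqnorm2; under eq_integral do rewrite modulus_conj.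
have := cauchy_schwarz lfE (L2J l1); rewrite -eq nJ => cs.
rewrite -ler_sqr ?nnegrE ?modulus_ge0 ?(ltW e0)//; apply: le_trans cs _.
apply: (@le_trans _ _ (nrm2 f * (e ^+ 2 / (nrm2 f + 1)))).
  by apply: ler_pM; rewrite ?nrm2_ge0.
by rewrite mulrA ler_pdivrMr// mulrC ler_wpM2l ?sqr_ge0// lerDl.
Qed.

(* The function exp (- H (max (log phi + n, 0))), of modulus at most 1,
   multiplied by the outer function with data phi is lam e^-n times a function
   of modulus at most 1 whose mean tends to 1. *)
Lemma outer_approx F e : outer F -> 0 < e ->
  exists (lam : R[i]) (n : nat) (u q : R -> R -> R[i]), modulus lam = 1 /\
  forall r, 0 <= r -> r < 1 ->
  [/\ disc_alg (u r), disc_alg (q r), (forall t, modulus (u r t) <= expR n%:R),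
     (forall t, u r t * F (r%:C * cis t) = q r t) &
     nrm2 (fun t => 1 - q r t) <= e].
Proof.
move=> [lam [phi [lam1 [mphi phi0] iL FE]]] e0.
pose L s := ln (phi s); have iL' : mu.-integrable angles (EFin \o L) by [].
have e2 : 0 < e / 2 by rewrite divr_gt0.
have [n hn] := cvg_mean_truncation iL' e2.
pose p s := Num.max (L s + n%:R) 0; pose m s := Num.max (- L s - n%:R) 0.
have ip : mu.-integrable angles (EFin \o p) by exact: integrable_funrpos_shift.
have im : mu.-integrable angles (EFin \o m).
  by apply: (@integrable_funrpos_shift (fun s => - L s) (- n%:R)); exact: (integrableN iL').
(* p and m are the positive and negative parts of log phi + n. *)
have pm s : L s = p s - (m s + n%:R).
  rewrite /p /m; case: (leP (L s + n%:R) 0); case: (leP (- L s - n%:R) 0) => h1 h2; lra.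
have lamJ : lam^* * lam = 1 by rewrite mulrC mulcJ lam1 expr1n.
(* The conjugate of [lam] and the factor e^n are put into u, so that u F is exactly q = exp (-H m),
   with no constant left over. *)
exists lam, n, (fun r t => lam^* * (expR n%:R)%:C * cexp (- herglotz p (r%:C * cis t))),
  (fun r t => cexp (- herglotz m (r%:C * cis t))).
split => // r r0 r1.
have z1 t : modulus (r%:C * cis t) < 1 by rewrite modulus_dilation.
have dN psi : mu.-integrable angles (EFin \o psi) ->
    disc_alg (fun t => - herglotz psi (r%:C * cis t)).
  move=> i; apply: (@eq_disc_alg _ (fun t => -1 * herglotz psi (r%:C * cis t))).
    by move=> t; rewrite mulN1r.
  exact/disc_algZ/disc_alg_herglotz.
have dq := disc_alg_cexp (dN _ im).
have lq := disc_alg_L2 dq.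
have p0 s : 0 <= p s by rewrite /p le_max lexx orbT.
have m0 s : 0 <= m s by rewrite /m le_max lexx orbT.
have q1 t : modulus (cexp (- herglotz m (r%:C * cis t))) <= 1.
  by rewrite modulus_cexp -expR0 ler_expR ReN oppr_le0 Re_herglotz_ge0.
split.
- by apply: disc_algZ; exact: disc_alg_cexp (dN _ ip).
- exact: dq.
- move=> t; rewrite (modulusM (lam^* * _)) (modulusM lam^*) modulus_conj lam1 mul1r.
  rewrite modulus_real ger0_norm ?expR_ge0//.
  by rewrite modulus_cexp ler_piMr ?expR_ge0// -expR0 ler_expR ReN oppr_le0 Re_herglotz_ge0.
- move=> t; rewrite FE; last exact: z1.
  have HL : circle_mean (fun s => (cis s + r%:C * cis t) / (cis s - r%:C * cis t) * (ln (phi s))%:C)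
      = herglotz p (r%:C * cis t) - (herglotz m (r%:C * cis t) + (n%:R : R)%:C).
    have imn : mu.-integrable angles (EFin \o (fun s => m s + n%:R)).
      exact: (integrableD mA im (integrable_cst_angles n%:R)).
    rewrite -[LHS]/(herglotz L (r%:C * cis t)) (_ : L = fun s => p s - (m s + n%:R)); last exact/funext.
    rewrite herglotzB//; congr (_ - _).
    rewrite -[in RHS](herglotz_cst n%:R (z1 t)) /herglotz -circle_meanD.
    + by congr circle_mean; apply/funext => s; rewrite realCD mulrDr.
    + exact: L1_herglotz.
    + by apply: L1_herglotz => //; exact: integrable_cst_angles.
  rewrite HL; have -> : (expR n%:R)%:C = cexp (n%:R : R)%:C by rewrite /cexp/= cis0 mulr1.
  set x := cexp _; set y := cexp _; set v := cexp (_ - _).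
  rewrite (_ : lam^* * x * y * (lam * v) = (lam^* * lam) * (x * y * v)); last by ring.
  rewrite lamJ mul1r -!cexpD; congr cexp.
  by ring.
(* With c the mean of m, the squared norm is at most 2 - 2 e^-c <= 2 c <= e. This is why the
   truncation was taken with e / 2. *)
- rewrite nrm2B//; last exact: L2_cst.
  have n1 : nrm2 (fun=> 1 : R[i]) <= 1.
    rewrite -[leRHS](expr1n R 2); apply: nrm2_bounded; first exact: circle_measurable_cst.
    by move=> t _; rewrite modulus1.
  have nq : nrm2 (fun t => cexp (- herglotz m (r%:C * cis t))) <= 1.
    by rewrite -[leRHS](expr1n R 2); apply: nrm2_bounded => //; exact: L2_measurable.
  have -> : inner2 (fun=> 1) (fun t => cexp (- herglotz m (r%:C * cis t))) =
     (circle_mean (fun t => cexp (- herglotz m (r%:C * cis t))))^*.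
    rewrite -circle_meanJ; last exact: disc_alg_L1.
    by congr circle_mean; apply/funext => t; rewrite mul1r.
  rewrite ReJ circle_mean_cexp; last exact: dN.
  rewrite circle_meanN; last exact/disc_alg_L1/disc_alg_herglotz.
  rewrite circle_mean_herglotz// circle_mean_real.
  set c := Re (circle_mean (fun s => (m s)%:C)).
  have -> : Re (cexp (- c%:C)) = expR (- c) by rewrite /cexp Re_realM/= oppr0 cos0 mulr1.
  have := expR_ge1Dx (- c); have : c <= e / 2 := hn; lra.
Qed.

Lemma outer_disc_alg F r : outer F -> 0 <= r -> r < 1 ->
  disc_alg (fun t => F (r%:C * cis t)).
Proof.
move=> [lam [phi [lam1 [mphi phi0] iL FE]]] r0 r1.
apply: (@eq_disc_alg _ (fun t => lam * cexp (herglotz (fun s => ln (phi s)) (r%:C * cis t)))).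
  move=> t; rewrite FE//.
  by have : modulus (r%:C * cis t) < 1 by rewrite modulus_dilation.
exact/disc_algZ/disc_alg_cexp/disc_alg_herglotz.
Qed.

(** The multiplier u(r) of [outer_approx] is in the disc algebra, so u b f stays in [hardy]. The
    distance from u b to 1 is split at u F_r = q, where F_r is the dilation of F. *)
Theorem outer_division F b f : outer F -> boundary_function F b -> L2 f ->
  hardy (fun t => b t * f t) -> hardy f.
Proof.
move=> oF /boundary_functionP[lb bF] lf hbf; apply: hardy_of_approx => // e e0.
have e4 : 0 < e / 4 by rewrite divr_gt0.
have [lam [n [u [q [lam1 uqP]]]]] := outer_approx oF e4.
have E0 : 0 < expR n%:R ^+ 2 :> R by rewrite exprn_gt0// expR_gt0.
(* The bound e^n for u holds for all r, so r can be taken close enough to 1 to absorb its square. *)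
have [d [d0 d1 hd]] := bF _ (divr_gt0 e4 E0).
pose r := (d + 1) / 2; have dr : d < r by rewrite /r; lra.
have r1 : r < 1 by rewrite /r; lra.
have r0 : 0 <= r by rewrite ltW// (le_lt_trans d0).
have [du dq ub uF nq] := uqP r r0 r1.
have mu_ := disc_alg_measurable du.
have lub : L2 (fun t => u r t * b t) by apply: (L2M_bounded (k := expR n%:R)).
exists (u r), b; split => //.
  have := hardy_disc_algM du hbf.
  by under [X in hardy X]eq_fun do rewrite mulrA.
have lq := disc_alg_L2 dq; have l1 := L2_cst (1 : R[i]).
have t1 := nrm2_triangle l1 lq lub.
have b2 : nrm2 (fun t => q r t - u r t * b t) <= e / 4.
  pose D t := F (r%:C * cis t) - b t.
  have uD t : q r t - u r t * b t = u r t * D t by rewrite /D mulrBr uF.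
  have nD := hd r dr r1.
  have lD : L2 D by apply: L2B => //; exact/disc_alg_L2/outer_disc_alg.
  under [X in nrm2 X]eq_fun do rewrite uD.
  apply: le_trans (nrm2M_bounded lD mu_ (fun t _ => ub t)) _.
  rewrite -ler_pdivlMl// mulrC -lee_fin.
  by rewrite -sqnorm2E.
by lra.
Qed.

(** The dilation F_r is in the disc algebra, so F_r f has zero negative coefficients. Those of b f
    are then inner products involving f and F_r - b, which tend to 0 by Cauchy-Schwarz. *)
Theorem outer_multiplication F b f : outer F -> boundary_function F b ->
  L2 (fun t => b t * f t) -> hardy f -> hardy (fun t => b t * f t).
Proof.
move=> oF /boundary_functionP[lb bF] lbf hf; have [lf _] := hf.
split=> // k; have lE := L2_fexp R (Negz k); set E := fexp (Negz k) in lE *.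
have mEJ : circle_measurable (fun t => (E t)^*) by exact/circle_measurableJ/circle_measurable_fexp.
have EJ1 t : angles t -> modulus ((E t)^*) <= 1 by rewrite modulus_conj modulus_fexp.
have lfE : L2 (fun t => (E t)^* * f t) by exact: L2M_bounded EJ1.
have nfE : nrm2 (fun t => (E t)^* * f t) <= nrm2 f.
  by have := nrm2M_bounded lf mEJ EJ1; rewrite expr1n mul1r.
apply: modulus_le_eps => e e0.
have A0 : 0 < nrm2 f + 1 by rewrite ltr_wpDl ?nrm2_ge0.
have [d [d0 d1 hd]] := bF _ (divr_gt0 (exprn_gt0 2 e0) A0).
pose r := (d + 1) / 2; have dr : d < r by rewrite /r; lra.
have r1 : r < 1 by rewrite /r; lra.
have r0 : 0 <= r by rewrite ltW// (le_lt_trans d0).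
have da := outer_disc_alg oF r0 r1.
have [lBf Bf0] := hardy_disc_algM da hf.
pose D t := F (r%:C * cis t) - b t.
have lD : L2 D by apply: L2B => //; exact: disc_alg_L2.
have eq : inner2 (fun t => b t * f t) E = - inner2 (fun t => (E t)^* * f t) (fun t => (D t)^*).
  rewrite -inner2Nl//; last exact: L2J.
  rewrite -[LHS]subr0 -(Bf0 k) -inner2Bl//; congr circle_mean; apply/funext => t.
  by rewrite conjJK /D -/E; ring.
have nJ : nrm2 (fun t => (D t)^*) = nrm2 D.
  by rewrite /nrm2 /sqnorm2; under eq_integral do rewrite modulus_conj.
have := cauchy_schwarz lfE (L2J lD); rewrite nJ => cs.
rewrite eq modulusN -ler_sqr ?nnegrE ?modulus_ge0 ?(ltW e0)//; apply: le_trans cs _.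
have nD : nrm2 D <= e ^+ 2 / (nrm2 f + 1) by rewrite -lee_fin -sqnorm2E// hd.
apply: (@le_trans _ _ (nrm2 f * (e ^+ 2 / (nrm2 f + 1)))).
  by apply: ler_pM; rewrite ?nrm2_ge0.
by rewrite mulrA ler_pdivrMr// mulrC ler_wpM2l ?sqr_ge0// lerDl.
Qed.

End OuterFunctions.

(** * Kernels *)

Section Kernels.
Variable R : realType.
Implicit Types (a b f g h u v : R -> R[i]).

Local Notation mu := (@lebesgue_measure R).
Local Notation angles := (@angles R).
Let mA := @measurable_angles R.
Local Hint Resolve mA : core.

(** Here the bound on a holds only almost everywhere, so the integrals rather than the functions are
    compared. *)
Lemma L2M_Linfty a f : Linfty a -> L2 f -> L2 (fun t => a t * f t).
Proof.
move=> [ma [M aM]] /L2P[mf int_f]; have mfa := circle_measurableM ma mf.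
apply/L2P; split => //; apply/integrableP; split.
  by apply/measurable_EFinP; exact: measurable_sqr_modulus.
have iM := integrableZl mA (M ^+ 2) int_f.
have /integrableP[mM] := iM; apply: le_lt_trans.
apply: ae_ge0_le_integral => //.
- apply: measurableT_comp => //; apply/measurable_EFinP; exact: measurable_sqr_modulus.
- exact: measurableT_comp.
apply: ae_imp aM => t aM at_; rewrite lee_fin ger0_norm ?sqr_ge0//.
rewrite (le_trans _ (ler_norm _))//= modulusM exprMn ler_wpM2r ?sqr_ge0//.
by rewrite lerXn2r ?nnegrE ?modulus_ge0 ?aM// (le_trans (modulus_ge0 _) (aM at_)).
Qed.

Lemma H2_minus_proj_exists g : L2 g -> exists v, is_orth_proj (@H2_minus R) g v.
Proof.
move=> lg; have ov := orthonormal_neg R.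
have [v [lv _ vg vw]] := orthonormal_expansion ov lg; exists v; split.
  apply/H2_minusP; split=> // i; apply: vw; first exact: L2_fexp.
  by move=> j; exact: inner2_neg_nneg.
move=> h [lh h0]; have lgv := L2B lg lv.
rewrite inner2C// h0 ?conjJ0//; apply/H2_plusP; split => // k.
have lE := L2_fexp R (Negz k).
by rewrite inner2Bl// [inner2 v _]vg subrr.
Qed.

Lemma P_minusP g : L2 g -> is_orth_proj (@H2_minus R) g (P_minus g).
Proof.
move=> /H2_minus_proj_exists[v vP]; rewrite /P_minus /orth_proj.
exact: (xgetPex (fun=> 0) (ex_intro _ v vP)).
Qed.

Lemma hardy0 : hardy (fun=> 0 : R[i]).
Proof.
split=> [|k]; first exact: L2_cst.
by apply: inner2_nrm0; [exact: L2_cst|exact: L2_fexp|exact: nrm2_0].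
Qed.

(** [xget] returns either an element of [H2_plus] or the default 0, and both are in [hardy]. *)
Lemma hardy_P_plus g : hardy (P_plus g).
Proof.
rewrite /P_plus /orth_proj; case: xgetP => [v _ [/H2_plusP//]|_].
exact: hardy0.
Qed.

(** Pairing the null sum u + v with u and with v isolates the two squared norms, by
    orthogonality. *)
Lemma hardy_add_H2_minus_eq0 u v : hardy u -> H2_minus v ->
  eq_ae (fun t => u t + v t) (fun=> 0) -> eq_ae u (fun=> 0) /\ nrm2 v = 0.
Proof.
move=> hu [lv v0] uv0; have [lu _] := hu; have l0 := L2_cst (0 : R[i]).
have vu : inner2 v u = 0 by apply: v0; apply/H2_plusP.
have uv : inner2 u v = 0 by rewrite inner2C// vu conjJ0.
have s0 w : L2 w -> inner2 (fun t => u t + v t) w = 0.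
  move=> lw; rewrite (eq_ae_inner2l _ l0 lw uv0); last exact: L2D.
  by apply: inner2_nrm0 => //; exact: nrm2_0.
have uu : inner2 u u = 0 by rewrite -(s0 u lu) inner2Dl// vu addr0.
have vv : inner2 v v = 0 by rewrite -(s0 v lv) inner2Dl// uv add0r.
split.
  by apply: nrm2_eq0 => //; apply: (@complexI R); rewrite -inner2_self.
by apply: (@complexI R); rewrite -inner2_self.
Qed.

(** The squared norm of the projection is its inner product with g, and g is orthogonal to
    [H2_minus]. *)
Lemma P_minus_hardy_eq0 g : hardy g -> eq_ae (P_minus g) (fun=> 0).
Proof.
move=> hg; have [lg _] := hg; have [Pm Po] := P_minusP lg; have [lP P0] := Pm.
have gP : inner2 g (P_minus g) = 0.
  by rewrite inner2C// P0 ?conjJ0//; apply/H2_plusP.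
apply: nrm2_eq0 => //; apply: (@complexI R); rewrite -inner2_self//.
by have := Po _ Pm; rewrite inner2Bl// gP sub0r => /eqP; rewrite oppr_eq0 => /eqP.
Qed.

(** Negative characters lie in [H2_minus], so g and [P_minus g] have the same negative
    coefficients. *)
Lemma P_minus_eq0_hardy g : L2 g -> nrm2 (P_minus g) = 0 -> hardy g.
Proof.
move=> lg P0; have [[lP Pm] Po] := P_minusP lg; split=> // k.
have lE := L2_fexp R (Negz k).
have mE : H2_minus (fexp (Negz k) : R -> R[i]).
  by apply/H2_minusP; split => // i; exact: inner2_neg_nneg.
by have := Po _ mE; rewrite inner2Bl// (inner2_nrm0 lP lE P0) subr0.
Qed.

Theorem ker_toeplitz_ker_Sigma a b : outer_Hinfty b -> ker_toeplitz a = ker_Sigma a b.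
Proof.
move=> [bL [F [_ oF bF]]]; apply/seteqP; split=> f.
- move=> [/H2_plusP hf Tf]; have [lf _] := hf; split => //.
  have hbf := outer_multiplication oF bF (L2M_Linfty bL lf) hf.
  have := P_minus_hardy_eq0 hbf; apply: ae_imp2 Tf => t + + at_ => /(_ at_) Tf /(_ at_) Pf.
  by rewrite /Sigma_op Pf addr0; exact: Tf.
- move=> [lf Sf]; have lbf := L2M_Linfty bL lf.
  have [Pm _] := P_minusP lbf.
  (* [toeplitz a f] and the first summand of [Sigma_op a b f] are the same chosen representative, so
     [T0] is already the Toeplitz equation. *)
  have [T0 P0] := hardy_add_H2_minus_eq0 (hardy_P_plus _) Pm Sf.
  split; last exact: T0.
  by apply/H2_plusP; apply: outer_division oF bF lf _; exact: P_minus_eq0_hardy.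
Qed.

Lemma Linfty1 : Linfty (fun=> 1 : R[i]).
Proof.
split; first exact: circle_measurable_cst.
by exists 1; apply: aeW => t _; rewrite modulus1.
Qed.

(** The constant 1 is outer with [lam] = 1 and [phi] = 1; it serves as the concrete b that exhibits
    a Toeplitz kernel as a transposed paired kernel. *)
Lemma outer_Hinfty1 : outer_Hinfty (fun=> 1 : R[i]).
Proof.
split; first exact: Linfty1.
exists (fun=> 1); split.
- split=> [z _|]; first exact: derivable_cst.
  by exists 1 => z _; rewrite modulus1.
- exists 1, (fun=> 1); split; first exact: modulus1.
  + by split; [exact: measurable_cst|].
  + by rewrite ln1; exact: integrable_cst_angles.
  + move=> z _; rewrite ln1; under [X in circle_mean X]eq_fun do rewrite mulr0.
    by rewrite circle_mean_cst cexp0 mulr1.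
- apply/boundary_functionP; split; first exact: L2_cst.
  move=> e e0; exists 0; split => // r _ _; rewrite subrr sqnorm2E; last exact: L2_cst.
  by rewrite nrm2_0 lee_fin ltW.
Qed.

End Kernels.

Theorem proposition4p2 (R : realType) (a : R -> complex R) (ha : Linfty a) :
  transposed_paired_kernel (ker_toeplitz a) /\
  (forall b : R -> complex R, outer_Hinfty b -> ker_toeplitz a = ker_Sigma a b).
Proof.
split; last by move=> b; exact: ker_toeplitz_ker_Sigma.
exists a, (fun=> 1); split => //; first exact: Linfty1.
exact/ker_toeplitz_ker_Sigma/outer_Hinfty1.
Qed.
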